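(* Let $f(y):=\frac14\sum_{n=1}^\infty\frac{B_{2n}}{((2n)!)^2}(4\pi y)^{2n}=\sum_{a=1}^{\infty}\sin^2\left(\frac{y}{a}\right)$. (i) For every $\theta\in(0,1)$, every $x>0$ and every $n=0,1,2,\ldots$, $$\sum_{m=1}^{\infty}\frac{J_1\left(4\pi\sqrt{m(n+\theta)x}\right)}{\sqrt{m(n+\theta)}}=\sqrt{x}\left(-\pi+\frac{1}{2Y_n}+2\,\frac{f(Y_n)}{Y_n}\right),\qquad Y_n=\pi(n+\theta)x.$$ (ii) For every $x>0$, the error term $P(x)$ defined by $\sum^{*}_{0\le n\le x}r_2(n)=\pi x+P(x)$ satisfies $$P(x)=1+4x\sum_{n=0}^{\infty}\left(\frac{f(Y_n)}{Y_n}-\frac{f(Y_n^{*})}{Y_n^{*}}\right),$$ where now $Y_n=\pi\left(n+\tfrac14\right)x$ and $Y_n^{*}=\pi\left(n+\tfrac34\right)x$.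
   Context: $J_1(z)=\sum_{k=0}^\infty\frac{(-1)^k}{k!\,\Gamma(k+2)}\left(\frac z2\right)^{1+2k}$ is the Bessel function of the first kind of order $1$. $B_{2n}$ are the Bernoulli numbers (with $B_2=1/6$, $B_4=-1/30$, and so on). $r_2(n)$ is the number of representations of $n$ as a sum of two squares of integers (counting order and signs), with $r_2(0)=1$. The asterisk in $\sum^{*}_{0\le n\le x}r_2(n)$ means that if $x$ is an integer, the last term is counted only as $\frac12 r_2(x)$. *)

(* Defs.v *)
From Stdlib Require Import Reals Lra Lia ZArith Arith List FinFun.
From Coquelicot Require Import Coquelicot.
Open Scope R_scope.

(** Everything is over the concrete reals [R] of the standard library. *)

(** Euler's integral, used for [s > 0]. *)
Definition Gamma (s : R) : R :=
  RInt_gen (fun t => Rpower t (s - 1) * exp (- t))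
    (at_right 0) (Rbar_locally p_infty).

Definition BesselJ1 (z : R) : R :=
  Series (fun k : nat =>
    (-1) ^ k / (INR (fact k) * Gamma (INR k + 2)) * (z / 2) ^ (1 + 2 * k)).

(** [bernoulli_table n k] is [B_k] for [k <= n]; a new entry is computed from
    [sum_(k <= n) binom(n+1, k) B_k = 0] for [n >= 1]. *)
Fixpoint bernoulli_table (n : nat) : nat -> R :=
  match n with
  | O => fun _ => 1
  | S p => fun k =>
      if (k <=? p)%nat then bernoulli_table p k
      else - sum_f_R0 (fun j => Binomial.C (S (S p)) j * bernoulli_table p j) p
             / INR (S (S p))
  end.

Definition bernoulli (n : nat) : R := bernoulli_table n n.

Lemma bernoulli_tableE (n k : nat) :
  (k <= n)%nat -> bernoulli_table n k = bernoulli k.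
Proof.
  induction n as [|n IH]; intros H.
  - replace k with O by lia; reflexivity.
  - destruct (Nat.eq_dec k (S n)) as [->|Hk]; [reflexivity|].
    simpl; rewrite (proj2 (Nat.leb_le k n)) by lia; apply IH; lia.
Qed.

Lemma bernoulli_0 : bernoulli 0 = 1.
Proof. reflexivity. Qed.

Lemma bernoulli_rec (n : nat) : (1 <= n)%nat ->
  sum_f_R0 (fun k => Binomial.C (S n) k * bernoulli k) n = 0.
Proof.
  destruct n as [|p]; [lia|intros _].
  rewrite tech5.
  assert (HC : Binomial.C (S (S p)) (S p) = INR (S (S p))).
  { rewrite pascal_step1 by lia.
    replace (S (S p) - S p)%nat with 1%nat by lia.
    unfold Binomial.C. replace (S (S p) - 1)%nat with (S p) by lia.
    change (fact (S (S p))) with ((S (S p)) * fact (S p))%nat.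
    rewrite mult_INR. change (INR (fact 1)) with 1.
    field. apply INR_fact_neq_0. }
  rewrite HC.
  unfold bernoulli at 2; cbn [bernoulli_table].
  rewrite (proj2 (Nat.leb_gt (S p) p)) by lia.
  rewrite (sum_eq _ (fun j => Binomial.C (S (S p)) j * bernoulli_table p j)).
  - field. apply not_0_INR; lia.
  - intros i Hi; rewrite bernoulli_tableE by exact Hi; reflexivity.
Qed.

Lemma bernoulli_2 : bernoulli 2 = 1 / 6.
Proof. unfold bernoulli; simpl; unfold Binomial.C; simpl; field. Qed.

Lemma bernoulli_4 : bernoulli 4 = - (1 / 30).
Proof. unfold bernoulli; simpl; unfold Binomial.C; simpl; field. Qed.

(** The summand of index [n >= 1] is stored at [n - 1]. *)
Definition f_term (y : R) (i : nat) : R :=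
  let n := S i in
  bernoulli (2 * n) / (INR (fact (2 * n))) ^ 2 * (4 * PI * y) ^ (2 * n).

Definition f_sum (y : R) : R := 1 / 4 * Series (f_term y).

Definition Y_arg (theta x : R) (n : nat) : R := PI * (INR n + theta) * x.

(** [-n, ..., n]. *)
Definition int_range (n : nat) : list Z :=
  map (fun i => (Z.of_nat i - Z.of_nat n)%Z) (seq 0 (2 * n + 1)).

(** A solution of [a^2 + b^2 = n] has [|a|, |b| <= n], so the search box is
    exhaustive (see [two_squares_spec]). *)
Definition two_squares (n : nat) : list (Z * Z) :=
  filter (fun p => (fst p * fst p + snd p * snd p =? Z.of_nat n)%Z)
    (list_prod (int_range n) (int_range n)).

Definition r2 (n : nat) : nat := length (two_squares n).

Lemma in_int_range (n : nat) (a : Z) :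
  In a (int_range n) <-> (- Z.of_nat n <= a <= Z.of_nat n)%Z.
Proof.
  unfold int_range; rewrite in_map_iff; split.
  - intros [i [<- Hi]]; apply in_seq in Hi; lia.
  - intros H; exists (Z.to_nat (a + Z.of_nat n)); rewrite in_seq; lia.
Qed.

Lemma two_squares_spec (n : nat) (a b : Z) :
  In (a, b) (two_squares n) <-> (a * a + b * b = Z.of_nat n)%Z.
Proof.
  unfold two_squares; rewrite filter_In, in_prod_iff, !in_int_range; simpl.
  rewrite Z.eqb_eq; split; [tauto|intros H; split; [nia|exact H]].
Qed.

Lemma NoDup_list_prod (A B : Type) (l : list A) (l' : list B) :
  NoDup l -> NoDup l' -> NoDup (list_prod l l').
Proof.
  intros H H'; induction H as [|a l Ha Hl IH]; simpl; [constructor|].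
  apply NoDup_app; [|exact IH|].
  - apply Injective_map_NoDup; [|exact H'].
    intros u v E; injection E; auto.
  - intros [u v] Hu Hv; apply in_map_iff in Hu as [w [E _]].
    injection E as -> ->; apply in_prod_iff in Hv; tauto.
Qed.

Lemma two_squares_NoDup (n : nat) : NoDup (two_squares n).
Proof.
  assert (H : NoDup (int_range n)).
  { apply Injective_map_NoDup; [intros i j; lia|apply seq_NoDup]. }
  apply NoDup_filter, NoDup_list_prod; exact H.
Qed.

(** The sum over [0 <= n <= x], the term [n = x] (if any) being halved. *)
Definition starred_sum (u : nat -> R) (x : R) : R :=
  sum_f_R0 (fun n => (if Req_EM_T (INR n) x then 1 / 2 else 1) * u n)
    (Z.to_nat (Int_part x)).

Definition circle_error (x : R) : R := starred_sum (fun n => INR (r2 n)) x - PI * x.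

(* Main.v *)
Require Import Defs.
From Stdlib Require Import Reals Lra Lia ZArith Znumtheory Arith List FinFun.
From mathcomp Require ssrbool ssrnat eqtype div prime binomial.
From Coquelicot Require Import Coquelicot.
Open Scope R_scope.

(** Why the theorem holds.

    Write [J_1(2 sqrt t) = sqrt t * E_1(t)] with the entire functions
    [E_n(t) = sum_k (-1)^k t^k / (k! (k + n)!)], for which [E_n' = - E_(n+1)].  With [Y = Y_n] and
    [u = 4 pi Y], the [m]-th term of the series in (i) is [2 pi sqrt x * E_1(u m)], so (i) says
      [sum_(m >= 1) E_1(u m) = 1/u - 1/2 + (4/u) f(u / (4 pi))]   (lemma [is_series_bessel]).
    This is Poisson summation for [t |-> E_1(u t)]: [1/u] is its integral, [- 1/2] comes from its value
    at [0], and its cosine transform at the integer frequency [k] is [(2/u) sin^2 (u / (4 pi k))].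
    Since the series converges only conditionally, it is reached through second order Euler-Maclaurin
    summation ([euler_maclaurin_bessel]), in which the periodic Bernoulli function is replaced by its
    uniformly convergent Fourier series ([bern_fourier]).  What remains are the integrals of
    [E_3(t) cos(b t)], which repeated integration by parts expands into the cosine series at [1/b]
    ([is_lim_bessel_cos_3]).  Two elementary estimates of the [E_n] carry the analysis: the identity
    [J_0^2 + 2 sum_n J_n^2 = 1] ([is_lim_neumann_sum]) gives [|J_n| <= 1], and an energy argument
    ([bessel_decay]) gives decay at infinity.

    The two expressions of [f] agree by Euler's evaluation of the zeta function at even integers, which is
    the same Fourier expansion of Bernoulli polynomials taken at [t = 0] ([is_series_zeta]), and by an
    interchange of two absolutely convergent sums ([f_term_sum]).

    For (ii), [r_2(n) = 4 sum_(d | n) chi(d)] with the character [chi] modulo 4 ([jacobi_two_squares]), so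
    the halved sum of [r_2] over [1 <= n <= x] is [4 sum_a W(x/a)], where [W(v)] is the halved sum of
    [chi(d)] over [d <= v].  On the other side, inserting [f(y) = sum_a sin^2 (y/a)] turns the [N]-th partial
    sum of the series in (ii), times [4 x], into [(8/pi) sum_a S_N(x/a)], where [S_N] is a Fourier partial
    sum ([wave]) converging to [(pi/2) W].  Exchanging [N -> oo] with the sum over [a] would give the
    halved sum of [r_2] itself; the exchange is illegitimate, and its defect is exactly the area term [pi x].
    Indeed [W] vanishes near [0] whereas [S_N(v) = - sin^2 (pi N v) / (4 N) + O(v^2 / N)] there
    ([wave_near_0]), and the sum of these terms over all [v = x/a] is [- f(pi N x) / (4 N)], which tends to
    [- pi^2 x / 8] because [f(y) / y -> pi / 2].  That last limit ([is_lim_f_sum]) is read off from (i), the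
    Bessel series being small for large [u]. *)

(** * Finite sums and a mean value inequality *)

Fixpoint Rsum (f : nat -> R) (n : nat) : R :=
  match n with O => 0 | S m => Rsum f m + f m end.

(** The lemmas on general normed modules leave equations that only unify with [R]; [ring] and
    [field] need to see [R] itself. *)
Ltac eq_in_R := match goal with |- @eq _ ?a ?b => change (@eq R a b) end.

Lemma Rsum_ext (f g : nat -> R) (n : nat) :
  (forall i, (i < n)%nat -> f i = g i) -> Rsum f n = Rsum g n.
Proof.
  induction n as [|n IH]; intros H; simpl; [reflexivity|].
  rewrite IH by (intros; apply H; lia). rewrite H by lia. reflexivity.
Qed.

Lemma Rsum_plus (f g : nat -> R) (n : nat) :
  Rsum (fun i => f i + g i) n = Rsum f n + Rsum g n.
Proof. induction n as [|n IH]; simpl; [lra|rewrite IH; lra]. Qed.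

Lemma Rsum_scal (c : R) (f : nat -> R) (n : nat) :
  Rsum (fun i => c * f i) n = c * Rsum f n.
Proof. induction n as [|n IH]; simpl; [lra|rewrite IH; lra]. Qed.

Lemma Rsum_minus (f g : nat -> R) (n : nat) :
  Rsum (fun i => f i - g i) n = Rsum f n - Rsum g n.
Proof. induction n as [|n IH]; simpl; [lra|rewrite IH; lra]. Qed.

Lemma Rsum_le (f g : nat -> R) (n : nat) :
  (forall i, (i < n)%nat -> f i <= g i) -> Rsum f n <= Rsum g n.
Proof.
  induction n as [|n IH]; intros H; simpl; [lra|].
  apply Rplus_le_compat; [apply IH; intros|]; apply H; lia.
Qed.

Lemma Rsum_0 (n : nat) : Rsum (fun _ => 0) n = 0.
Proof. induction n as [|n IH]; simpl; lra. Qed.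

Lemma Rsum_const (c : R) (n : nat) : Rsum (fun _ => c) n = INR n * c.
Proof. induction n as [|n IH]; [simpl; lra|]. rewrite S_INR; simpl; rewrite IH; lra. Qed.

Lemma Rsum_pos (f : nat -> R) (n : nat) : (forall i, (i < n)%nat -> 0 <= f i) -> 0 <= Rsum f n.
Proof. intros H; rewrite <- (Rsum_0 n); apply Rsum_le; exact H. Qed.

Lemma Rsum_Rabs (f : nat -> R) (n : nat) :
  Rabs (Rsum f n) <= Rsum (fun i => Rabs (f i)) n.
Proof.
  induction n as [|n IH]; simpl; [rewrite Rabs_R0; lra|].
  eapply Rle_trans; [apply Rabs_triang|lra].
Qed.

Lemma Rsum_add (f : nat -> R) (n m : nat) :
  Rsum f (n + m) = Rsum f n + Rsum (fun i => f (n + i)%nat) m.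
Proof.
  induction m as [|m IH]; simpl; [rewrite Nat.add_0_r; lra|].
  rewrite Nat.add_succ_r; simpl; rewrite IH; lra.
Qed.

Lemma Rsum_shift (f : nat -> R) (n : nat) :
  Rsum f (S n) = f O + Rsum (fun i => f (S i)) n.
Proof. change (S n) with (1 + n)%nat; rewrite Rsum_add; simpl; lra. Qed.

Lemma Rsum_swap (f : nat -> nat -> R) (n m : nat) :
  Rsum (fun i => Rsum (f i) m) n = Rsum (fun j => Rsum (fun i => f i j) n) m.
Proof.
  induction n as [|n IH]; simpl; [rewrite Rsum_0; reflexivity|].
  rewrite IH, <- Rsum_plus; reflexivity.
Qed.

Lemma Rsum_sum_f_R0 (f : nat -> R) (n : nat) : sum_f_R0 f n = Rsum f (S n).
Proof. induction n as [|n IH]; simpl; [lra|]. rewrite IH; reflexivity. Qed.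

Lemma is_series_Rsum (a : nat -> R) (l : R) :
  is_series a l <-> is_lim_seq (Rsum a) l.
Proof.
  assert (E : forall n, sum_n a n = Rsum a (S n)).
  { intros n; rewrite sum_n_Reals; apply Rsum_sum_f_R0. }
  rewrite (is_lim_seq_incr_1 (Rsum a)); split; intros H.
  - apply is_lim_seq_ext with (sum_n a); [exact E|exact H].
  - apply (is_lim_seq_ext _ (sum_n a) l (fun n => eq_sym (E n))) in H; exact H.
Qed.

Lemma is_lim_seq_Rsum (f : nat -> nat -> R) (l : nat -> R) (n : nat) :
  (forall i, (i < n)%nat -> is_lim_seq (fun N => f N i) (l i)) ->
  is_lim_seq (fun N => Rsum (f N) n) (Rsum l n).
Proof.
  induction n as [|n IH]; intros H; simpl; [apply is_lim_seq_const|].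
  apply is_lim_seq_plus'; [apply IH; intros; apply H; lia|apply H; lia].
Qed.

Lemma is_derive_Rsum (f df : nat -> R -> R) (n : nat) (t : R) :
  (forall i, (i < n)%nat -> is_derive (f i) t (df i t)) ->
  is_derive (fun t => Rsum (fun i => f i t) n) t (Rsum (fun i => df i t) n).
Proof.
  induction n as [|n IH]; intros H; simpl; [apply @is_derive_const|].
  apply @is_derive_plus; [apply IH; intros; apply H; lia|apply H; lia].
Qed.

Lemma incr_of_derive (h dh : R -> R) (a b : R) : a <= b ->
  (forall t, a <= t <= b -> is_derive h t (dh t)) ->
  (forall t, a <= t <= b -> 0 <= dh t) -> h a <= h b.
Proof.
  intros Hab Hd Hp.
  destruct (MVT_gen h a b dh) as [c [Hc E]].
  - intros x Hx; apply Hd. rewrite Rmin_left, Rmax_right in Hx by lra; lra.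
  - intros x Hx. rewrite Rmin_left, Rmax_right in Hx by lra.
    apply derivable_continuous_pt. exists (dh x). apply is_derive_Reals, Hd; lra.
  - rewrite Rmin_left, Rmax_right in Hc by lra.
    assert (0 <= dh c * (b - a)) by (apply Rmult_le_pos; [apply Hp; lra|lra]). lra.
Qed.

(** Replaces bounds on integrals: [g] is a primitive of a majorant of the derivative of [h]. *)
Lemma derive_compare (h dh g dg : R -> R) (a b : R) : a <= b ->
  (forall t, a <= t <= b -> is_derive h t (dh t)) ->
  (forall t, a <= t <= b -> is_derive g t (dg t)) ->
  (forall t, a <= t <= b -> Rabs (dh t) <= dg t) -> Rabs (h b - h a) <= g b - g a.
Proof.
  intros Hab Hh Hg Hb.
  assert (H1 : g a - h a <= g b - h b).
  { apply (incr_of_derive (fun t => g t - h t) (fun t => dg t - dh t)); [exact Hab| |].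
    - intros t Ht; apply @is_derive_minus; [apply Hg|apply Hh]; exact Ht.
    - intros t Ht; specialize (Hb t Ht); apply Rabs_le_between in Hb; lra. }
  assert (H2 : g a + h a <= g b + h b).
  { apply (incr_of_derive (fun t => g t + h t) (fun t => dg t + dh t)); [exact Hab| |].
    - intros t Ht; apply @is_derive_plus; [apply Hg|apply Hh]; exact Ht.
    - intros t Ht; specialize (Hb t Ht); apply Rabs_le_between in Hb; lra. }
  apply Rabs_le; lra.
Qed.

Lemma derive_bound (h dh : R -> R) (a b M : R) : a <= b ->
  (forall t, a <= t <= b -> is_derive h t (dh t)) ->
  (forall t, a <= t <= b -> Rabs (dh t) <= M) -> Rabs (h b - h a) <= M * (b - a).
Proof.
  intros Hab Hh Hb.
  replace (M * (b - a)) with (M * b - M * a) by ring.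
  apply (derive_compare h dh (fun t => M * t) (fun _ => M)); auto.
  intros t _. auto_derive; [exact I|ring].
Qed.

(** The uniform error bounds below have the form [C / (N + 1)], to be meaningful at [N = 0] too. *)
Lemma is_lim_seq_inv_S (C : R) : is_lim_seq (fun N => C / (INR N + 1)) 0.
Proof.
  replace 0 with (C * 0) by ring.
  apply is_lim_seq_ext with (fun N => C * / INR (S N)).
  { intros n; rewrite S_INR; reflexivity. }
  apply (is_lim_seq_scal_l (fun n => / INR (S n)) C (Finite 0)).
  apply (is_lim_seq_incr_1 (fun n => / INR n)).
  replace (Finite 0) with (Rbar_inv p_infty) by reflexivity.
  apply is_lim_seq_inv; [apply is_lim_seq_INR|discriminate].
Qed.

Lemma is_lim_seq_bound_inv (u : nat -> R) (l C : R) :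
  (forall N, Rabs (u N - l) <= C / (INR N + 1)) -> is_lim_seq u l.
Proof.
  intros H. apply is_lim_seq_ext with (fun N => l + (u N - l)); [intros; ring|].
  replace l with (l + 0) at 1 by ring.
  apply is_lim_seq_plus'; [apply is_lim_seq_const|].
  apply is_lim_seq_abs_0.
  apply is_lim_seq_le_le with (fun _ => 0) (fun N => C / (INR N + 1)).
  - intros n; split; [apply Rabs_pos|apply H].
  - apply is_lim_seq_const.
  - apply is_lim_seq_inv_S.
Qed.

Lemma is_lim_seq_eps (u : nat -> R) (l : R) :
  (forall eps : R, 0 < eps -> exists N, forall n, (N <= n)%nat -> Rabs (u n - l) <= eps) ->
  is_lim_seq u l.
Proof.
  intros H; apply is_lim_seq_spec; intros eps.
  destruct (H (eps / 2)) as [N HN]; [destruct eps; simpl; lra|].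
  exists N; intros n Hn; specialize (HN n Hn); destruct eps as [e He]; simpl in *; lra.
Qed.

Lemma is_lim_seq_elim (u : nat -> R) (l : R) : is_lim_seq u l ->
  forall eps : R, 0 < eps -> exists N, forall n, (N <= n)%nat -> Rabs (u n - l) <= eps.
Proof.
  intros H eps He; apply is_lim_seq_spec in H.
  destruct (H (mkposreal eps He)) as [N HN]; exists N; intros n Hn.
  left; apply HN, Hn.
Qed.

Lemma is_lim_seq_Rabs_le (u : nat -> R) (l M : R) :
  is_lim_seq u l -> (forall n, Rabs (u n) <= M) -> Rabs l <= M.
Proof.
  intros H Hb. apply is_lim_seq_abs in H.
  apply (is_lim_seq_le (fun n => Rabs (u n)) (fun _ => M) (Rabs l) M Hb H (is_lim_seq_const M)).
Qed.

Lemma eq_of_Rabs_small (a b C : R) :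
  (forall N : nat, Rabs (a - b) <= C / (INR N + 1)) -> a = b.
Proof.
  intros H.
  assert (L : is_lim_seq (fun _ : nat => a) b) by (apply is_lim_seq_bound_inv with C, H).
  apply is_lim_seq_unique in L. rewrite Lim_seq_const in L. injection L; auto.
Qed.

(** Telescoping, from [1 / k^2 <= 2 / k - 2 / (k + 1)]. *)
Lemma Rsum_inv_sqr_tail (N M : nat) :
  Rsum (fun i => / (INR (N + i) + 1) ^ 2) M <= 2 / (INR N + 1).
Proof.
  enough (H : Rsum (fun i => / (INR (N + i) + 1) ^ 2) M <= 2 / (INR N + 1) - 2 / (INR (N + M) + 1)).
  { assert (0 < 2 / (INR (N + M) + 1)); [|lra].
    apply Rdiv_lt_0_compat; [lra|]. pose proof (pos_INR (N + M)); lra. }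
  induction M as [|M IH]; cbn [Rsum].
  - rewrite Nat.add_0_r; lra.
  - eapply Rle_trans; [apply Rplus_le_compat_r, IH|].
    rewrite Nat.add_succ_r, S_INR. set (k := INR (N + M)).
    assert (0 <= k) by apply pos_INR. pose proof (pos_INR N).
    apply Rminus_le_0.
    replace (_ - _) with (k / ((k + 1) ^ 2 * (k + 2))) by (field; lra).
    apply Rdiv_le_0_compat; [lra|]. apply Rmult_lt_0_compat; [apply pow_lt|]; lra.
Qed.

(** * Fourier series of the Bernoulli polynomials *)

(** Fourier partial sum of the function equal to [1/2 - t] on [(0, 1)]. *)
Definition sawtooth (N : nat) (t : R) : R :=
  Rsum (fun k => sin (2 * PI * INR (S k) * t) / (PI * INR (S k))) N.

Lemma dirichlet_kernel (N : nat) (t : R) :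
  sin (PI * t) * (1 + 2 * Rsum (fun k => cos (2 * PI * INR (S k) * t)) N)
  = sin ((2 * INR N + 1) * (PI * t)).
Proof.
  induction N as [|N IH]; cbn [Rsum].
  - simpl INR. replace ((2 * 0 + 1) * (PI * t)) with (PI * t) by ring. ring.
  - set (S := Rsum _ N) in *. rewrite S_INR. set (c := cos _).
    replace (sin (PI * t) * (1 + 2 * (S + c))) with (sin (PI * t) * (1 + 2 * S) + 2 * sin (PI * t) * c) by ring.
    rewrite IH. unfold c.
    replace ((2 * (INR N + 1) + 1) * (PI * t)) with (2 * PI * (INR N + 1) * t + PI * t) by ring.
    replace ((2 * INR N + 1) * (PI * t)) with (2 * PI * (INR N + 1) * t - PI * t) by ring.
    rewrite sin_plus, sin_minus. ring.
Qed.

Lemma is_derive_sawtooth (N : nat) (t : R) :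
  is_derive (sawtooth N) t (2 * Rsum (fun k => cos (2 * PI * INR (S k) * t)) N).
Proof.
  unfold sawtooth. rewrite <- Rsum_scal.
  apply (is_derive_Rsum (fun k t => sin (2 * PI * INR (S k) * t) / (PI * INR (S k)))
          (fun k t => 2 * cos (2 * PI * INR (S k) * t))).
  intros k _. assert (H : INR (S k) <> 0) by (apply not_0_INR; lia).
  revert H; generalize (INR (S k)); intros m H.
  auto_derive; [exact I|]. field. split; [assumption|exact PI_neq0].
Qed.

Lemma sin_int_PI (n : nat) : sin (INR n * PI) = 0.
Proof. apply sin_eq_0_1. exists (Z.of_nat n). rewrite <- INR_IZR_INZ; reflexivity. Qed.

Lemma cos_int_PI (n : nat) : cos (INR n * PI) = (-1) ^ n.
Proof.
  induction n as [|n IH]; [simpl; rewrite Rmult_0_l; apply cos_0|].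
  rewrite S_INR, Rmult_plus_distr_r, Rmult_1_l, neg_cos, IH. simpl; ring.
Qed.

Lemma sin_period_nat (x : R) (n : nat) : sin (x + INR n * (2 * PI)) = sin x.
Proof. rewrite <- (sin_period x n). f_equal; ring. Qed.

Lemma sawtooth_period (N : nat) (t : R) : sawtooth N (t + 1) = sawtooth N t.
Proof.
  apply Rsum_ext; intros k _. f_equal.
  rewrite <- (sin_period_nat (2 * PI * INR (S k) * t) (S k)). f_equal; ring.
Qed.

Lemma sawtooth_opp (N : nat) (t : R) : sawtooth N (- t) = - sawtooth N t.
Proof.
  replace (- sawtooth N t) with (-1 * sawtooth N t) by ring.
  unfold sawtooth; rewrite <- Rsum_scal.
  apply Rsum_ext; intros k _.
  replace (2 * PI * INR (S k) * - t) with (- (2 * PI * INR (S k) * t)) by ring.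
  rewrite sin_neg. unfold Rdiv; ring.
Qed.

Lemma sawtooth_half (N : nat) : sawtooth N (1 / 2) = 0.
Proof.
  unfold sawtooth; rewrite <- (Rsum_0 N); apply Rsum_ext; intros k _.
  replace (2 * PI * INR (S k) * (1 / 2)) with (INR (S k) * PI) by field.
  rewrite sin_int_PI. unfold Rdiv; ring.
Qed.

Lemma sin_PI_pos (t : R) : 0 < t < 1 -> 0 < sin (PI * t).
Proof.
  intros H; apply sin_gt_0; [apply Rmult_lt_0_compat; [apply PI_RGT_0|lra]|].
  rewrite <- (Rmult_1_r PI) at 2. apply Rmult_lt_compat_l; [apply PI_RGT_0|lra].
Qed.

(** The derivative of the error is the Dirichlet kernel [sin ((2 N + 1) pi t) / sin (pi t)]; one integration
    by parts gains the factor [1 / (2 N + 1)], and the error vanishes at [t = 1/2]. *)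
Lemma sawtooth_bound_left (N : nat) (t : R) : 0 < t <= 1 / 2 ->
  Rabs (sawtooth N t - (1 / 2 - t)) <= 2 / ((2 * INR N + 1) * PI * sin (PI * t)).
Proof.
  intros Ht. pose proof PI_RGT_0 as HPI. pose proof (pos_INR N) as HN.
  set (m := 2 * INR N + 1). assert (Hm : 0 < m) by (unfold m; lra).
  (* the last summand is the boundary term of the integration by parts *)
  set (Phi := fun u => sawtooth N u - (1 / 2 - u) + cos (m * (PI * u)) / (m * PI * sin (PI * u))).
  assert (HPhi : Rabs (Phi (1 / 2) - Phi t) <=
    - / (m * PI * sin (PI * (1 / 2))) - - / (m * PI * sin (PI * t))).
  { apply (derive_compare Phi (fun u => - cos (m * (PI * u)) * cos (PI * u) / (m * sin (PI * u) ^ 2))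
      (fun u => - / (m * PI * sin (PI * u))) (fun u => cos (PI * u) / (m * sin (PI * u) ^ 2))); [lra| | |].
    - intros u Hu. assert (Hs := sin_PI_pos u ltac:(lra)).
      unfold Phi. evar_last.
      apply @is_derive_plus.
      apply @is_derive_minus. apply is_derive_sawtooth.
      apply (is_derive_ext (fun u => 1/2 - u)); [reflexivity|]. auto_derive; [exact I|reflexivity].
      auto_derive; [|reflexivity]. apply Rgt_not_eq. apply Rmult_lt_0_compat; [nra|exact Hs].
      unfold plus, minus, opp; simpl. unfold plus, opp; simpl.
      assert (D := dirichlet_kernel N u). fold m in D.
      set (S := Rsum _ _) in *.
      replace (2 * S + - - (1)) with (sin (m * (PI * u)) / sin (PI * u))
        by (rewrite <- D; field; lra).
      field. repeat split; lra.
    - intros u Hu. assert (Hs := sin_PI_pos u ltac:(lra)).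
      auto_derive; [apply Rgt_not_eq, Rmult_lt_0_compat; [nra|exact Hs]|].
      field. repeat split; lra.
    - intros u Hu. assert (Hs := sin_PI_pos u ltac:(lra)).
      assert (Hc : 0 <= cos (PI * u)) by (apply cos_ge_0; nra).
      unfold Rdiv. rewrite Rabs_mult, Rabs_mult, Rabs_Ropp, (Rabs_pos_eq (cos (PI * u))) by exact Hc.
      rewrite (Rabs_pos_eq (/ _)) by (left; apply Rinv_0_lt_compat, Rmult_lt_0_compat; [exact Hm|apply pow_lt, Hs]).
      apply Rmult_le_compat_r; [left; apply Rinv_0_lt_compat, Rmult_lt_0_compat; [exact Hm|apply pow_lt, Hs]|].
      rewrite <- (Rmult_1_l (cos (PI * u))) at 2. apply Rmult_le_compat_r; [exact Hc|].
      apply Rabs_le, COS_bound. }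
  assert (Hs := sin_PI_pos t ltac:(lra)).
  assert (H0 : Phi (1 / 2) = 0).
  { unfold Phi. rewrite sawtooth_half.
    replace (m * (PI * (1 / 2))) with (PI / 2 + INR N * PI) by (unfold m; field).
    rewrite cos_plus, cos_PI2, sin_int_PI. unfold Rdiv; ring. }
  rewrite H0 in HPhi.
  replace (PI * (1 / 2)) with (PI / 2) in HPhi by field. rewrite sin_PI2 in HPhi.
  set (q := / (m * PI * sin (PI * t))) in *.
  assert (Hq : 0 < q) by (apply Rinv_0_lt_compat, Rmult_lt_0_compat; [nra|exact Hs]).
  assert (Hq1 : 0 < / (m * PI * 1)) by (apply Rinv_0_lt_compat; nra).
  replace (2 / (m * PI * sin (PI * t))) with (q + q) by (unfold q; field; repeat split; lra).
  replace (sawtooth N t - (1 / 2 - t)) with (Phi t + - (cos (m * (PI * t)) * q))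
    by (unfold Phi, q; unfold Rdiv; ring).
  eapply Rle_trans; [apply Rabs_triang|]. apply Rplus_le_compat.
  - rewrite <- Rabs_Ropp. replace (- Phi t) with (0 - Phi t) by ring. lra.
  - rewrite Rabs_Ropp, Rabs_mult, (Rabs_pos_eq q) by lra.
    rewrite <- (Rmult_1_l q) at 2. apply Rmult_le_compat_r; [lra|].
    apply Rabs_le, COS_bound.
Qed.

Lemma sawtooth_bound (N : nat) (t : R) : 0 < t < 1 ->
  Rabs (sawtooth N t - (1 / 2 - t)) <= 2 / ((2 * INR N + 1) * PI * sin (PI * t)).
Proof.
  intros Ht. destruct (Rle_dec t (1 / 2)) as [H|H]; [apply sawtooth_bound_left; lra|].
  assert (B := sawtooth_bound_left N (1 - t) ltac:(lra)).
  replace (PI * (1 - t)) with (PI - PI * t) in B by ring. rewrite sin_PI_x in B.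
  replace (1 - t) with (- t + 1) in B at 1 by ring.
  rewrite sawtooth_period, sawtooth_opp in B. rewrite <- Rabs_Ropp.
  replace (- (sawtooth N t - (1 / 2 - t))) with (- sawtooth N t - (1 / 2 - (1 - t))) by field.
  exact B.
Qed.

Lemma is_lim_sawtooth (t : R) : 0 < t < 1 -> is_lim_seq (fun N => sawtooth N t) (1 / 2 - t).
Proof.
  intros Ht. assert (Hs := sin_PI_pos t Ht). pose proof PI_RGT_0 as HPI.
  apply is_lim_seq_bound_inv with (2 / (PI * sin (PI * t))). intros N.
  eapply Rle_trans; [apply sawtooth_bound, Ht|].
  pose proof (pos_INR N) as HN.
  replace (2 / (PI * sin (PI * t)) / (INR N + 1)) with (2 / ((INR N + 1) * PI * sin (PI * t)))
    by (field; repeat split; lra).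
  apply Rmult_le_compat_l; [lra|]. apply Rinv_le_contravar.
  - apply Rmult_lt_0_compat; [nra|exact Hs].
  - apply Rmult_le_compat_r; [lra|]. nra.
Qed.

(** The Bernoulli polynomial divided by [n!], so that differentiating lowers [n] by one without a factor. *)
Definition bern_poly (n : nat) (t : R) : R :=
  Rsum (fun j => bernoulli j / INR (fact j) * (t ^ (n - j) / INR (fact (n - j)))) (S n).

Lemma is_derive_monomial (c : R) (m : nat) (t : R) :
  is_derive (fun t => c * (t ^ S m / INR (fact (S m)))) t (c * (t ^ m / INR (fact m))).
Proof.
  pose proof (INR_fact_neq_0 m) as Hq.
  assert (Hp : INR (S m) <> 0) by (apply not_0_INR; lia).
  assert (E : INR (fact (S m)) = INR (S m) * INR (fact m)) by (rewrite <- mult_INR; reflexivity).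
  rewrite E.
  auto_derive; [exact I|]. cbn [Nat.pred].
  change (match m with 0%nat => 1 | S _ => INR m + 1 end) with (INR (S m)).
  field. split; assumption.
Qed.

Lemma is_derive_bern_poly (n : nat) (t : R) : is_derive (bern_poly (S n)) t (bern_poly n t).
Proof.
  unfold bern_poly. change (Rsum ?f (S (S n))) with (Rsum f (S n) + f (S n)).
  rewrite <- (Rplus_0_r (Rsum _ (S n))).
  apply (is_derive_ext (fun t => Rsum (fun j => bernoulli j / INR (fact j) * (t ^ (S n - j) / INR (fact (S n - j)))) (S n)
     + bernoulli (S n) / INR (fact (S n)))).
  { intros u. cbn [Rsum]. rewrite Nat.sub_diag.
    eq_in_R.
    replace (u ^ 0 / INR (fact 0)) with 1 by (simpl; field). ring. }
  apply @is_derive_plus; [|apply @is_derive_const].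
  apply (is_derive_Rsum (fun j t => bernoulli j / INR (fact j) * (t ^ (S n - j) / INR (fact (S n - j))))
   (fun j t => bernoulli j / INR (fact j) * (t ^ (n - j) / INR (fact (n - j))))).
  intros j Hj. replace (S n - j)%nat with (S (n - j)) by lia. apply is_derive_monomial.
Qed.

Lemma bern_poly_0 (n : nat) : bern_poly n 0 = bernoulli n / INR (fact n).
Proof.
  unfold bern_poly. cbn [Rsum]. rewrite Nat.sub_diag.
  replace (Rsum _ n) with 0.
  { replace (0 ^ 0 / INR (fact 0)) with 1 by (simpl; field). ring. }
  transitivity (Rsum (fun _ => 0) n); [symmetry; apply Rsum_0|]. apply Rsum_ext; intros j Hj.
  rewrite pow_ne_zero by lia. unfold Rdiv; ring.
Qed.

(** This is the recursion that defines the Bernoulli numbers. *)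
Lemma bern_poly_1 (n : nat) : (2 <= n)%nat -> bern_poly n 1 = bern_poly n 0.
Proof.
  intros Hn. rewrite bern_poly_0. unfold bern_poly. cbn [Rsum]. rewrite Nat.sub_diag.
  replace (Rsum _ n) with 0.
  { replace (1 ^ 0 / INR (fact 0)) with 1 by (simpl; field). ring. }
  destruct n as [|m]; [lia|].
  assert (H := bernoulli_rec m ltac:(lia)). rewrite Rsum_sum_f_R0 in H.
  replace 0 with (/ INR (fact (S m)) * 0) by ring. rewrite <- H, <- Rsum_scal.
  apply Rsum_ext; intros j Hj. rewrite pow1. unfold Binomial.C.
  field. repeat split; apply INR_fact_neq_0.
Qed.

Lemma bern_poly_1E (t : R) : bern_poly 1 t = t - 1 / 2.
Proof.
  unfold bern_poly; simpl. unfold bernoulli; simpl. unfold Binomial.C; simpl. field.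
Qed.

(** The phase makes differentiation in [t] lower [n] by one, exactly as for [bern_poly]. *)
Definition bern_trig (n N : nat) (t : R) : R :=
  Rsum (fun k => - 2 * cos (2 * PI * INR (S k) * t - INR n * (PI / 2)) / (2 * PI * INR (S k)) ^ n) N.

Lemma INR_S_pos (k : nat) : 0 < INR (S k).
Proof. apply lt_0_INR; lia. Qed.

Lemma is_derive_bern_trig (n N : nat) (t : R) :
  is_derive (bern_trig (S n) N) t (bern_trig n N t).
Proof.
  apply (is_derive_Rsum (fun k t => - 2 * cos (2 * PI * INR (S k) * t - INR (S n) * (PI / 2)) / (2 * PI * INR (S k)) ^ S n)
   (fun k t => - 2 * cos (2 * PI * INR (S k) * t - INR n * (PI / 2)) / (2 * PI * INR (S k)) ^ n)).
  intros k _. assert (Hk := INR_S_pos k). rewrite (S_INR n).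
  revert Hk; generalize (INR (S k)); intros m Hm. generalize (INR n); intros z.
  assert (0 < 2 * PI * m) by (pose proof PI_RGT_0; nra).
  assert ((2 * PI * m) ^ n <> 0) by (apply pow_nonzero; lra).
  replace (2 * PI * m * t - z * (PI / 2)) with (PI / 2 + (2 * PI * m * t - (z + 1) * (PI / 2))) by field.
  rewrite cos_plus, cos_PI2, sin_PI2. cbn [pow].
  revert H0; generalize ((2 * PI * m) ^ n); intros q Hq.
  pose proof PI_RGT_0.
  auto_derive; [exact I|]. 
  unfold Rminus. field. repeat split; try assumption; lra.
Qed.

Lemma bern_trig_1E (N : nat) (t : R) : bern_trig 1 N t = - sawtooth N t.
Proof.
  replace (- sawtooth N t) with (-1 * sawtooth N t) by ring.
  unfold sawtooth, bern_trig. rewrite <- Rsum_scal. apply Rsum_ext; intros k _.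
  assert (Hk := INR_S_pos k). revert Hk; generalize (INR (S k)); intros m Hm.
  simpl (INR 1). rewrite Rmult_1_l, cos_minus, cos_PI2, sin_PI2. pose proof PI_RGT_0. field; lra.
Qed.

Lemma cauchy_limit (u : nat -> R) :
  (forall N M, Rabs (u (N + M)%nat - u N) <= 1 / (INR N + 1)) ->
  exists l, forall N, Rabs (u N - l) <= 1 / (INR N + 1).
Proof.
  intros H.
  assert (C : ex_finite_lim_seq u).
  { apply ex_lim_seq_cauchy_corr. intros eps.
    assert (He : 0 < eps / 4) by (destruct eps; simpl; lra).
    destruct (is_lim_seq_elim _ _ (is_lim_seq_inv_S 1) _ He) as [N HN].
    exists N. intros n m Hn Hm. specialize (HN N (le_n N)).
    assert (Hn' := H N (n - N)%nat). assert (Hm' := H N (m - N)%nat).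
    replace (N + (n - N))%nat with n in Hn' by lia. replace (N + (m - N))%nat with m in Hm' by lia.
    rewrite Rminus_0_r, Rabs_pos_eq in HN.
    2:{ pose proof (pos_INR N); apply Rdiv_le_0_compat; lra. }
    replace (u n - u m) with ((u n - u N) - (u m - u N)) by ring.
    eapply Rle_lt_trans; [apply Rabs_triang|]. rewrite Rabs_Ropp. lra. }
  destruct C as [l Hl]. exists l. intros N.
  rewrite <- Rabs_Ropp, Ropp_minus_distr.
  apply (is_lim_seq_Rabs_le (fun M => u (N + M)%nat - u N)); [|intros M; apply H].
  apply is_lim_seq_minus'; [|apply is_lim_seq_const].
  apply is_lim_seq_ext with (fun M => u (M + N)%nat); [intros; f_equal; lia|].
  apply is_lim_seq_incr_n, Hl.
Qed.

Lemma bern_trig_cauchy (n N M : nat) (t : R) : (2 <= n)%nat ->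
  Rabs (bern_trig n (N + M) t - bern_trig n N t) <= 1 / (INR N + 1).
Proof.
  intros Hn. unfold bern_trig. rewrite Rsum_add.
  match goal with |- Rabs (?a + ?b - ?a) <= _ => replace (a + b - a) with b by ring end.
  eapply Rle_trans; [apply Rsum_Rabs|].
  apply Rle_trans with (Rsum (fun i => 1 / 2 * / (INR (N + i) + 1) ^ 2) M).
  2:{ rewrite Rsum_scal. pose proof (Rsum_inv_sqr_tail N M). lra. }
  apply Rsum_le. intros i _. rewrite <- S_INR.
  assert (Hk : 1 <= INR (S (N + i))) by (rewrite S_INR; pose proof (pos_INR (N + i)); lra).
  revert Hk; generalize (INR (S (N + i))); intros m Hm.
  assert (HPI : 1 < PI) by (pose proof PI2_1; lra).
  set (z := 2 * PI * m). assert (Hz : 2 * m <= z) by (unfold z; nra).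
  replace (- 2 * cos (z * t - INR n * (PI / 2)) / z ^ n) with (- cos (z * t - INR n * (PI / 2)) * (2 / z ^ n))
    by (unfold Rdiv; ring).
  assert (Hzn : 0 < z ^ n) by (apply pow_lt; lra).
  rewrite Rabs_mult, Rabs_Ropp, (Rabs_pos_eq (2 / _)) by (apply Rdiv_le_0_compat; lra).
  apply Rle_trans with (1 * (2 / z ^ n)).
  { apply Rmult_le_compat_r; [apply Rdiv_le_0_compat; lra|apply Rabs_le, COS_bound]. }
  assert (Hz2 : 4 * m ^ 2 <= z ^ n).
  { apply Rle_trans with (z ^ 2); [simpl; nra|]. apply Rle_pow; [lra|exact Hn]. }
  replace (1 / 2 * / m ^ 2) with (2 / (4 * m ^ 2)) by (field; lra).
  rewrite Rmult_1_l. apply Rmult_le_compat_l; [lra|]. apply Rinv_le_contravar; [|exact Hz2].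
  assert (0 < m ^ 2) by (apply pow_lt; lra). lra.
Qed.

Definition bern_err (n N : nat) (t : R) : R := bern_poly n t - bern_trig n N t.

Lemma is_derive_bern_err (n N : nat) (t : R) :
  is_derive (bern_err (S n) N) t (bern_err n N t).
Proof.
  unfold bern_err. apply @is_derive_minus; [apply is_derive_bern_poly|apply is_derive_bern_trig].
Qed.

Lemma bern_err_limit (n : nat) (t : R) : (2 <= n)%nat ->
  exists D, forall N, Rabs (bern_err n N t - D) <= 1 / (INR N + 1).
Proof.
  intros Hn. apply cauchy_limit. intros N M. unfold bern_err.
  rewrite <- Rabs_Ropp.
  match goal with |- Rabs ?a <= _ => replace a with (bern_trig n (N + M) t - bern_trig n N t) by ring end.
  apply bern_trig_cauchy, Hn.
Qed.

Lemma bern_trig_1 (n N : nat) : bern_trig n N 1 = bern_trig n N 0.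
Proof.
  apply Rsum_ext; intros k _. f_equal. f_equal.
  rewrite <- (cos_period (2 * PI * INR (S k) * 0 - INR n * (PI / 2)) (S k)). f_equal. ring.
Qed.

Lemma bern_err_1 (n N : nat) : (2 <= n)%nat -> bern_err n N 1 = bern_err n N 0.
Proof. intros Hn; unfold bern_err; rewrite bern_trig_1, bern_poly_1; auto. Qed.

Lemma bern_err_1E (N : nat) (t : R) : bern_err 1 N t = sawtooth N t - (1 / 2 - t).
Proof. unfold bern_err. rewrite bern_trig_1E, bern_poly_1E. ring. Qed.

(** Grows with [N]: only used to compare an endpoint with a point extremely close to it. *)
Lemma bern_err_1_crude (N : nat) (t : R) : 0 <= t <= 1 -> Rabs (bern_err 1 N t) <= INR N + 1.
Proof.
  intros Ht. rewrite bern_err_1E. eapply Rle_trans; [apply Rabs_triang|].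
  assert (Rabs (- (1 / 2 - t)) <= 1) by (apply Rabs_le; lra).
  assert (Rabs (sawtooth N t) <= INR N * 1); [|lra].
  eapply Rle_trans; [apply Rsum_Rabs|]. rewrite <- Rsum_const. apply Rsum_le; intros k _.
  assert (Hk : 1 <= INR (S k)) by (rewrite S_INR; pose proof (pos_INR k); lra).
  assert (HPI : 1 < PI) by (pose proof PI2_1; lra).
  unfold Rdiv. rewrite Rabs_mult, (Rabs_pos_eq (/ _)) by (left; apply Rinv_0_lt_compat; nra).
  rewrite <- (Rmult_1_r 1). apply Rmult_le_compat; [apply Rabs_pos|left; apply Rinv_0_lt_compat; nra| |].
  - apply Rabs_le, SIN_bound.
  - rewrite <- Rinv_1. apply Rinv_le_contravar; nra.
Qed.

(** Level 1 converges only inside the interval, with a bound that degenerates at the endpoints; integrating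
    it shows that the limit at level 2 is constant there. *)
Lemma bern_err_2_interior (t : R) : 0 < t < 1 ->
  is_lim_seq (fun N => bern_err 2 N t - bern_err 2 N (1 / 2)) 0.
Proof.
  intros Ht. pose proof PI_RGT_0 as HPI. assert (Hs := sin_PI_pos t Ht).
  apply is_lim_seq_bound_inv with (2 / (PI * sin (PI * t))). intros N. rewrite Rminus_0_r.
  assert (Hb : forall u, (t <= u <= 1 / 2 \/ 1 / 2 <= u <= t) ->
    Rabs (bern_err 1 N u) <= 2 / (PI * sin (PI * t)) / (INR N + 1)).
  { intros u Hu. rewrite bern_err_1E. eapply Rle_trans; [apply sawtooth_bound; lra|].
    assert (Hsu : sin (PI * t) <= sin (PI * u)).
    { destruct Hu as [Hu|Hu]; [apply sin_incr_1|apply sin_decr_1]; nra. }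
    pose proof (pos_INR N) as HN.
    replace (2 / (PI * sin (PI * t)) / (INR N + 1)) with (2 / ((INR N + 1) * PI * sin (PI * t)))
      by (field; repeat split; lra).
    apply Rmult_le_compat_l; [lra|]. apply Rinv_le_contravar.
    - apply Rmult_lt_0_compat; [nra|exact Hs].
    - apply Rmult_le_compat; nra. }
  assert (HC : 0 <= 2 / (PI * sin (PI * t)) / (INR N + 1)).
  { apply Rle_trans with (2 := Hb t (ltac:(lra))). apply Rabs_pos. }
  set (M := _ / (INR N + 1)) in *.
  destruct (Rle_dec t (1 / 2)) as [H|H].
  - rewrite <- Rabs_Ropp, Ropp_minus_distr.
    eapply Rle_trans; [apply (derive_bound (bern_err 2 N) (bern_err 1 N) t (1 / 2) M); [lra| |]|nra].
    + intros; apply is_derive_bern_err.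
    + intros u Hu; apply Hb; lra.
  - eapply Rle_trans; [apply (derive_bound (bern_err 2 N) (bern_err 1 N) (1 / 2) t M); [lra| |]|nra].
    + intros; apply is_derive_bern_err.
    + intros u Hu; apply Hb; lra.
Qed.

Lemma bern_err_2_limit : exists D, forall t N, 0 <= t <= 1 ->
  Rabs (bern_err 2 N t - D) <= 1 / (INR N + 1).
Proof.
  destruct (bern_err_limit 2 (1 / 2) (le_n 2)) as [D HD]. exists D.
  assert (HI : forall t, 0 < t < 1 -> forall N, Rabs (bern_err 2 N t - D) <= 1 / (INR N + 1)).
  { intros t Ht. destruct (bern_err_limit 2 t (le_n 2)) as [D' HD'].
    replace D with D'; [exact HD'|].
    assert (L := bern_err_2_interior t Ht).
    assert (L' : is_lim_seq (fun N => bern_err 2 N t - bern_err 2 N (1 / 2)) (D' - D)).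
    { apply is_lim_seq_minus'; apply is_lim_seq_bound_inv with 1; assumption. }
    apply is_lim_seq_unique in L. apply is_lim_seq_unique in L'. rewrite L in L'.
    injection L'; lra. }
  (* the endpoints: the partial sums are Lipschitz and the interior bound is uniform *)
  assert (H0 : forall N, Rabs (bern_err 2 N 0 - D) <= 1 / (INR N + 1)).
  { destruct (bern_err_limit 2 0 (le_n 2)) as [D' HD'].
    replace D with D'; [exact HD'|].
    apply eq_of_Rabs_small with 3. intros N. pose proof (pos_INR N) as HN.
    set (d := / (2 * (INR N + 1) ^ 2)).
    assert (Hd : 0 < d < 1).
    { split; [apply Rinv_0_lt_compat; simpl; nra|]. apply Rmult_lt_reg_r with (2 * (INR N + 1) ^ 2); [simpl; nra|].
      unfold d. rewrite Rinv_l; simpl; nra. }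
    assert (B : Rabs (bern_err 2 N d - bern_err 2 N 0) <= (INR N + 1) * (d - 0)).
    { apply (derive_bound (bern_err 2 N) (bern_err 1 N)); [lra| |].
      - intros; apply is_derive_bern_err.
      - intros u Hu; apply bern_err_1_crude; lra. }
    replace ((INR N + 1) * (d - 0)) with (1 / 2 * (1 / (INR N + 1))) in B by (unfold d; field; lra).
    assert (B1 := HD' N). assert (B2 := HI d Hd N).
    replace (3 / (INR N + 1)) with (3 * (1 / (INR N + 1))) by (field; lra).
    apply Rabs_le_between in B, B1, B2. apply Rabs_le. lra. }
  intros t N Ht. destruct (Req_dec t 0) as [->|N0]; [apply H0|].
  destruct (Req_dec t 1) as [->|N1]; [rewrite bern_err_1 by lia; apply H0|].
  apply HI; lra.
Qed.

(** The constant left over by integrating the level [n] must vanish, because at level [n + 1]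
    both sides take equal values at [0] and [1]. *)
Lemma bern_err_limit_0 (n : nat) (D : R) : (2 <= n)%nat ->
  (forall t N, 0 <= t <= 1 -> Rabs (bern_err n N t - D) <= 1 / (INR N + 1)) -> D = 0.
Proof.
  intros Hn HD. apply eq_of_Rabs_small with 1. intros N.
  assert (B := derive_bound (fun t => bern_err (S n) N t - D * t) (fun t => bern_err n N t - D) 0 1 (1 / (INR N + 1))).
  cbv beta in B. rewrite bern_err_1 in B by lia.
  replace (bern_err (S n) N 0 - D * 1 - (bern_err (S n) N 0 - D * 0)) with (- (D - 0)) in B by ring.
  rewrite Rabs_Ropp in B. replace (1 / (INR N + 1)) with (1 / (INR N + 1) * (1 - 0)) at 1 by ring.
  apply B; [lra| |intros; apply HD; lra].
  intros t _. apply @is_derive_minus; [apply is_derive_bern_err|].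
  auto_derive; [exact I|ring].
Qed.

Lemma bern_fourier (n N : nat) (t : R) : (2 <= n)%nat -> 0 <= t <= 1 ->
  Rabs (bern_err n N t) <= 1 / (INR N + 1).
Proof.
  intros Hn Ht.
  enough (H : exists D, forall t N, 0 <= t <= 1 -> Rabs (bern_err n N t - D) <= 1 / (INR N + 1)).
  { destruct H as [D HD]. assert (D = 0) by (apply (bern_err_limit_0 n); assumption). subst D.
    rewrite <- (Rminus_0_r (bern_err n N t)). apply HD, Ht. }
  clear t Ht N. induction Hn as [|n Hn IH]; [apply bern_err_2_limit|].
  destruct IH as [D HD]. assert (D = 0) by (apply (bern_err_limit_0 n); assumption). subst D.
  destruct (bern_err_limit (S n) 0 ltac:(lia)) as [E HE]. exists E.
  intros t N Ht. destruct (bern_err_limit (S n) t ltac:(lia)) as [E' HE'].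
  replace E with E'; [apply HE'|]. apply eq_of_Rabs_small with 3. intros M.
  assert (B : Rabs (bern_err (S n) M t - bern_err (S n) M 0) <= 1 / (INR M + 1) * (t - 0)).
  { apply (derive_bound (bern_err (S n) M) (bern_err n M)); [lra| |].
    - intros; apply is_derive_bern_err.
    - intros u Hu; specialize (HD u M ltac:(lra)); rewrite Rminus_0_r in HD; exact HD. }
  assert (B1 := HE M). assert (B2 := HE' M). pose proof (pos_INR M).
  replace (3 / (INR M + 1)) with (3 * (1 / (INR M + 1))) by (field; lra).
  set (q := 1 / (INR M + 1)) in *.
  assert (0 <= q) by (unfold q; apply Rdiv_le_0_compat; lra).
  assert (q * (t - 0) <= q) by nra.
  apply Rabs_le_between in B, B1, B2. apply Rabs_le. lra.
Qed.

(** Euler's formula for the zeta values, read off at [t = 0]. *)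
Lemma is_series_zeta (m : nat) : (1 <= m)%nat ->
  is_series (fun k => / INR (S k) ^ (2 * m))
    ((-1) ^ S m * bernoulli (2 * m) / (2 * INR (fact (2 * m))) * (2 * PI) ^ (2 * m)).
Proof.
  intros Hm. apply is_series_Rsum. pose proof PI_RGT_0 as HPI.
  set (K := (-1) ^ S m / 2 * (2 * PI) ^ (2 * m)).
  apply is_lim_seq_ext with (fun N => K * bern_trig (2 * m) N 0).
  { intros N. unfold bern_trig. rewrite <- Rsum_scal. apply Rsum_ext; intros k _.
    replace (2 * PI * INR (S k) * 0 - INR (2 * m) * (PI / 2)) with (- (INR m * PI))
      by (rewrite mult_INR; simpl (INR 2); field).
    rewrite cos_neg, cos_int_PI, Rpow_mult_distr. unfold K.
    assert (E : (-1) ^ S m * (-1) ^ m = -1).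
    { simpl. rewrite Rmult_assoc, <- Rpow_mult_distr. replace (-1 * -1) with 1 by ring. rewrite pow1; ring. }
    pose proof (INR_S_pos k).
    assert ((2 * PI) ^ (2 * m) <> 0) by (apply pow_nonzero; lra).
    assert (INR (S k) ^ (2 * m) <> 0) by (apply pow_nonzero; lra).
    transitivity (- ((-1) ^ S m * (-1) ^ m) / INR (S k) ^ (2 * m)); [field; auto|rewrite E; field; auto]. }
  replace (_ * _) with (K * (bernoulli (2 * m) / INR (fact (2 * m)))).
  2:{ unfold K. field. apply INR_fact_neq_0. }
  apply (is_lim_seq_scal_l _ K (Finite _)).
  apply is_lim_seq_bound_inv with 1. intros N. rewrite <- bern_poly_0, <- Rabs_Ropp, Ropp_minus_distr.
  apply (bern_fourier (2 * m) N 0); [lia|lra].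
Qed.

(** * The two expressions of f *)

Lemma is_series_Rmult (c : R) (a : nat -> R) (l : R) :
  is_series a l -> is_series (fun i => c * a i) (c * l).
Proof. apply (is_series_scal c a l). Qed.

Lemma is_series_Rext (a b : nat -> R) (l : R) :
  (forall n, a n = b n) -> is_series a l -> is_series b l.
Proof. apply is_series_ext. Qed.

Lemma is_series_Rsum_le (b : nat -> R) (L : R) (N : nat) :
  (forall i, 0 <= b i) -> is_series b L -> Rsum b N <= L.
Proof.
  intros Hb H. apply is_series_Rsum in H.
  apply (is_lim_seq_le_loc (fun _ => Rsum b N) (Rsum b) (Rsum b N) L).
  - exists N; intros n Hn. replace n with (N + (n - N))%nat by lia. rewrite Rsum_add.
    assert (0 <= Rsum (fun i => b (N + i)%nat) (n - N)); [|lra].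
    apply Rsum_pos; auto.
  - apply is_lim_seq_const.
  - exact H.
Qed.

Lemma is_series_Rabs_le (a b : nat -> R) (la lb : R) :
  (forall i, Rabs (a i) <= b i) -> is_series a la -> is_series b lb -> Rabs la <= lb.
Proof.
  intros H Ha Hb. apply is_series_Rsum in Ha.
  apply (is_lim_seq_Rabs_le _ _ _ Ha). intros n.
  apply Rle_trans with (1 := Rsum_Rabs a n).
  apply Rle_trans with (Rsum b n); [apply Rsum_le; auto|].
  apply is_series_Rsum_le; [|exact Hb]. intros i. apply Rle_trans with (2 := H i), Rabs_pos.
Qed.

Lemma is_series_Rsum_family (g : nat -> nat -> R) (z : nat -> R) (N : nat) :
  (forall i, is_series (g i) (z i)) -> is_series (fun a => Rsum (fun i => g i a) N) (Rsum z N).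
Proof.
  intros H. induction N as [|N IH]; cbn [Rsum].
  - apply is_series_Rsum. apply is_lim_seq_ext with (fun _ => 0); [intros; rewrite Rsum_0; reflexivity|apply is_lim_seq_const].
  - apply @is_series_plus; auto.
Qed.

(** Cutting the inner sums at [N] costs at most [w a] times the tail of [b], which is summable over [a]. *)
Lemma series_swap_dominated (g : nat -> nat -> R) (F z b w : nat -> R) (L W : R) :
  (forall a, is_series (fun i => g i a) (F a)) ->
  (forall i, is_series (g i) (z i)) ->
  (forall i a, Rabs (g i a) <= b i * w a) ->
  is_series b L -> is_series w W -> (forall i, 0 <= b i) -> (forall a, 0 <= w a) ->
  exists S : R, is_series F S /\ is_series z S.
Proof.
  intros HF Hz Hg Hb Hw Pb Pw.
  assert (Hscal : forall c, is_series (fun a => c * w a) (c * W)).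
  { intros c. apply is_series_Rmult, Hw. }
  assert (Htail : forall N a, Rabs (F a - Rsum (fun i => g i a) N) <= (L - Rsum b N) * w a).
  { intros N a. assert (HFa := HF a). apply is_series_Rsum in HFa.
    apply (is_lim_seq_Rabs_le (fun M => Rsum (fun i => g i a) (N + M) - Rsum (fun i => g i a) N)).
    - apply is_lim_seq_minus'; [|apply is_lim_seq_const].
      apply is_lim_seq_ext with (fun M => Rsum (fun i => g i a) (M + N)); [intros; f_equal; lia|].
      apply (is_lim_seq_incr_n (Rsum (fun i => g i a))), HFa.
    - intros M. rewrite Rsum_add. set (r := Rsum (fun i => g (N + i)%nat a) M).
      match goal with |- Rabs (?s + r - ?s) <= _ => replace (s + r - s) with r by ring end.
      unfold r. eapply Rle_trans; [apply Rsum_Rabs|].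
      apply Rle_trans with (Rsum (fun i => w a * b (N + i)%nat) M).
      { apply Rsum_le; intros i _. rewrite (Rmult_comm (w a)). apply Hg. }
      rewrite Rsum_scal, Rmult_comm. apply Rmult_le_compat_r; [apply Pw|].
      assert (B := is_series_Rsum_le b L (N + M) Pb Hb). rewrite Rsum_add in B. lra. }
  assert (EF : ex_series F).
  { apply (ex_series_le F (fun a => L * w a)).
    - intros a. specialize (Htail O a). cbn [Rsum] in Htail. rewrite !Rminus_0_r in Htail. exact Htail.
    - exists (L * W); apply Hscal. }
  exists (Series F). split; [apply Series_correct, EF|].
  apply is_series_Rsum.
  assert (B : forall N, Rabs (Rsum z N - Series F) <= (L - Rsum b N) * W).
  { intros N. rewrite <- Rabs_Ropp, Ropp_minus_distr.
    apply (is_series_Rabs_le (fun a => F a - Rsum (fun i => g i a) N) (fun a => (L - Rsum b N) * w a)).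
    - apply Htail.
    - apply @is_series_minus; [apply Series_correct, EF|apply is_series_Rsum_family, Hz].
    - apply Hscal. }
  apply is_lim_seq_ext with (fun N => Series F + (Rsum z N - Series F)); [intros; ring|].
  replace (Finite (Series F)) with (Finite (Series F + 0)) by (f_equal; ring).
  apply is_lim_seq_plus'; [apply is_lim_seq_const|].
  apply is_lim_seq_abs_0.
  apply is_lim_seq_le_le with (fun _ => 0) (fun N => (L - Rsum b N) * W).
  - intros N; split; [apply Rabs_pos|apply B].
  - apply is_lim_seq_const.
  - replace (Finite 0) with (Finite ((L - L) * W)) by (f_equal; ring).
    apply is_series_Rsum in Hb.
    apply is_lim_seq_mult'; [|apply is_lim_seq_const].
    apply is_lim_seq_minus'; [apply is_lim_seq_const|exact Hb].
Qed.

(** From [sin^2 v = (1 - cos (2 v)) / 2]: the coefficient of [v^(2 i + 2)]. *)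
Definition sin2_coef (i : nat) : R := (-1) ^ i * (4 ^ S i / (2 * INR (fact (2 * S i)))).

Lemma is_series_cos (x : R) : is_series (fun i => (-1) ^ i / INR (fact (2 * i)) * (x ^ 2) ^ i) (cos x).
Proof.
  apply is_series_Reals. unfold cos. destruct (exist_cos (Rsqr x)) as [l Hl].
  replace (x ^ 2) with (Rsqr x) by (unfold Rsqr; ring). exact Hl.
Qed.

Lemma is_series_sin2 (v : R) : is_series (fun i => sin2_coef i * v ^ (2 * S i)) (sin v ^ 2).
Proof.
  assert (H := is_series_cos (2 * v)).
  apply (is_series_Rmult (- / 2)) in H. apply is_series_Rsum in H.
  apply is_series_Rsum.
  apply (is_lim_seq_incr_1) in H.
  apply is_lim_seq_ext with (fun n => Rsum (fun i => - / 2 * ((-1) ^ i / INR (fact (2 * i)) * ((2 * v) ^ 2) ^ i)) (S n) + 1 / 2).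
  - intros n. rewrite Rsum_shift.
    match goal with |- ?c + ?s + 1 / 2 = _ => replace (c + s + 1 / 2) with s by (simpl; field) end.
    apply Rsum_ext; intros i _.
    unfold sin2_coef. rewrite Rpow_mult_distr, (Rpow_mult_distr _ _ (S i)), <- !pow_mult.
    replace 4 with (2 ^ 2) by ring. rewrite <- pow_mult.
    change ((-1) ^ S i) with (-1 * (-1) ^ i). field. apply INR_fact_neq_0.
  - replace (sin v ^ 2) with (- / 2 * cos (2 * v) + 1 / 2).
    + apply is_lim_seq_plus'; [exact H|apply is_lim_seq_const].
    + rewrite cos_2a_sin. field.
Qed.

Lemma ex_series_sin2_abs (y : R) : ex_series (fun i => Rabs (sin2_coef i) * Rabs y ^ (2 * S i)).
Proof.
  assert (H : ex_series (fun n => (4 * Rabs y ^ 2) ^ n / INR (fact n))).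
  { exists (exp (4 * Rabs y ^ 2)). assert (E := is_exp_Reals (4 * Rabs y ^ 2)).
    eapply is_series_ext; [|exact E]. intros n. cbn beta.
    rewrite pow_n_pow. unfold scal; simpl. unfold mult; simpl. reflexivity. }
  apply ex_series_incr_1 in H.
  apply (@ex_series_le R_AbsRing R_CompleteNormedModule _ (fun k => (4 * Rabs y ^ 2) ^ S k / INR (fact (S k))));
    [|exact H]. intros i.
  change (Rabs (Rabs (sin2_coef i) * Rabs y ^ (2 * S i)) <= (4 * Rabs y ^ 2) ^ S i / INR (fact (S i))).
  assert (P1 := INR_fact_lt_0 (2 * S i)). assert (P2 := INR_fact_lt_0 (S i)).
  rewrite Rabs_mult, Rabs_Rabsolu, (Rabs_pos_eq (Rabs y ^ _)) by apply pow_le, Rabs_pos.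
  unfold sin2_coef. rewrite Rabs_mult, pow_1_abs, Rmult_1_l.
  rewrite Rabs_pos_eq by (apply Rdiv_le_0_compat; [apply pow_le|]; lra).
  rewrite Rpow_mult_distr, <- pow_mult.
  replace (4 ^ S i / (2 * INR (fact (2 * S i))) * Rabs y ^ (2 * S i))
    with (4 ^ S i * Rabs y ^ (2 * S i) * / (2 * INR (fact (2 * S i)))) by (field; lra).
  apply Rmult_le_compat_l.
  { apply Rmult_le_pos; apply pow_le; [lra|apply Rabs_pos]. }
  apply Rinv_le_contravar; [exact P2|].
  assert (INR (fact (S i)) <= INR (fact (2 * S i))) by (apply le_INR, fact_le; lia). lra.
Qed.

(** Expand each [sin^2 (y / a)] in powers of [y / a] and sum over [a] first, which gives zeta values; the
    double series is dominated because [a^(-2 i - 2) <= a^(-2)]. *)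
Lemma f_term_sum (y : R) :
  ex_series (f_term y) /\ is_series (fun i => sin (y / INR (S i)) ^ 2) (f_sum y).
Proof.
  destruct (ex_series_sin2_abs y) as [L HL].
  assert (HW := is_series_zeta 1 (le_n 1)). set (W := _ * _) in HW. clearbody W.
  destruct (series_swap_dominated
    (fun i a => sin2_coef i * (y / INR (S a)) ^ (2 * S i))
    (fun a => sin (y / INR (S a)) ^ 2)
    (fun i => 1 / 4 * f_term y i)
    (fun i => Rabs (sin2_coef i) * Rabs y ^ (2 * S i))
    (fun a => / INR (S a) ^ (2 * 1)) L W) as [T [HT1 HT2]]; try assumption.
  - intros a; apply is_series_sin2.
  - intros i.
    assert (Z := is_series_zeta (S i) ltac:(lia)).
    apply (is_series_Rmult (sin2_coef i * y ^ (2 * S i))) in Z.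
    replace (1 / 4 * f_term y i) with
      (sin2_coef i * y ^ (2 * S i) *
       ((-1) ^ S (S i) * bernoulli (2 * S i) / (2 * INR (fact (2 * S i))) * (2 * PI) ^ (2 * S i))).
    + eapply is_series_Rext; [|exact Z]. intros a.
      unfold Rdiv. rewrite Rpow_mult_distr, pow_inv. ring.
    + unfold f_term, sin2_coef. cbv zeta.
      replace (4 * PI * y) with (2 * (2 * PI) * y) by ring.
      rewrite (Rpow_mult_distr (2 * (2 * PI)) y), (Rpow_mult_distr 2 (2 * PI)), (pow_mult 2 2).
      replace (2 ^ 2) with 4 by ring.
      assert (E : (-1) ^ S (S i) * (-1) ^ i = 1).
      { simpl. replace (-1 * (-1 * (-1) ^ i) * (-1) ^ i) with ((-1) ^ i * (-1) ^ i) by ring.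
        rewrite <- Rpow_mult_distr. replace (-1 * -1) with 1 by ring. apply pow1. }
      assert (P := INR_fact_neq_0 (2 * S i)).
      transitivity ((-1) ^ S (S i) * (-1) ^ i * (4 ^ S i * y ^ (2 * S i) * bernoulli (2 * S i) * (2 * PI) ^ (2 * S i)
         / (4 * INR (fact (2 * S i)) ^ 2))); [field; exact P|].
      rewrite E. field; exact P.
  - intros i a. rewrite Rabs_mult, Rmult_assoc. apply Rmult_le_compat_l; [apply Rabs_pos|].
    assert (Hk : 1 <= INR (S a)) by (rewrite S_INR; pose proof (pos_INR a); lra).
    rewrite <- RPow_abs. unfold Rdiv. rewrite Rabs_mult, (Rabs_pos_eq (/ _)) by (left; apply Rinv_0_lt_compat; lra).
    rewrite Rpow_mult_distr, pow_inv. apply Rmult_le_compat_l; [apply pow_le, Rabs_pos|].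
    apply Rinv_le_contravar; [apply pow_lt; lra|]. apply Rle_pow; [exact Hk|lia].
  - intros i; apply Rmult_le_pos; [apply Rabs_pos|apply pow_le, Rabs_pos].
  - intros a; left; apply Rinv_0_lt_compat, pow_lt, INR_S_pos.
  - assert (HT3 : is_series (f_term y) (4 * T)).
    { apply (is_series_Rmult 4) in HT2. eapply is_series_Rext; [|exact HT2].
      intros i. cbv beta. field. }
    split; [exists (4 * T); exact HT3|].
    unfold f_sum. rewrite (is_series_unique _ _ HT3). replace (1 / 4 * (4 * T)) with T by field. exact HT1.
Qed.

(** * The Bessel functions in the variable t = z^2/4 *)

(** [J_n(2 sqrt t) = t^(n/2) * bessel n t]; this entire function of [t] (a Bessel-Clifford function)
    avoids the branch point of the square root. *)
Definition bessel_coef (n k : nat) : R := (-1) ^ k / (INR (fact k) * INR (fact (k + n))).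
Definition bessel (n : nat) (t : R) : R := PSeries (bessel_coef n) t.

Lemma INR_fact_S (k : nat) : INR (fact (S k)) = INR (S k) * INR (fact k).
Proof. rewrite <- mult_INR; reflexivity. Qed.

Lemma bessel_coef_S (n k : nat) :
  bessel_coef n (S k) = - bessel_coef n k / (INR (S k) * INR (S (k + n))).
Proof.
  unfold bessel_coef. rewrite Nat.add_succ_l, !INR_fact_S. cbn [pow].
  pose proof (INR_fact_neq_0 k). pose proof (INR_fact_neq_0 (k + n)).
  pose proof (INR_S_pos k). pose proof (INR_S_pos (k + n)).
  field. repeat split; lra.
Qed.

Lemma bessel_coef_neq_0 (n k : nat) : bessel_coef n k <> 0.
Proof.
  unfold bessel_coef, Rdiv. apply Rmult_integral_contrapositive_currified.
  - apply pow_nonzero; lra.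
  - apply Rinv_neq_0_compat, Rmult_integral_contrapositive_currified; apply INR_fact_neq_0.
Qed.

Lemma CV_radius_bessel (n : nat) : CV_radius (bessel_coef n) = p_infty.
Proof.
  apply CV_radius_infinite_DAlembert; [apply bessel_coef_neq_0|].
  apply is_lim_seq_bound_inv with 1. intros k. rewrite Rminus_0_r, Rabs_Rabsolu, bessel_coef_S.
  pose proof (INR_S_pos k). pose proof (INR_S_pos (k + n)).
  replace (_ / bessel_coef n k) with (- / (INR (S k) * INR (S (k + n)))).
  2:{ field. repeat split; try lra. apply bessel_coef_neq_0. }
  rewrite Rabs_Ropp, Rabs_pos_eq by (left; apply Rinv_0_lt_compat; nra).
  unfold Rdiv; rewrite Rmult_1_l, <- S_INR. apply Rinv_le_contravar; [lra|].
  assert (1 <= INR (S (k + n))) by (rewrite S_INR; pose proof (pos_INR (k + n)); lra). nra.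
Qed.

Lemma is_derive_bessel (n : nat) (t : R) : is_derive (bessel n) t (- bessel (S n) t).
Proof.
  replace (- bessel (S n) t) with (PSeries (PS_derive (bessel_coef n)) t).
  { apply is_derive_PSeries. rewrite CV_radius_bessel. exact I. }
  unfold bessel. rewrite <- PSeries_opp. apply PSeries_ext; intros k.
  unfold PS_derive, PS_opp. rewrite bessel_coef_S. unfold bessel_coef, opp; simpl opp.
  rewrite Nat.add_succ_r, INR_fact_S.
  pose proof (INR_fact_neq_0 k). pose proof (INR_fact_neq_0 (k + n)).
  pose proof (INR_S_pos k). pose proof (INR_S_pos (k + n)).
  change (@eq R (INR (S k) * (- ((-1) ^ k / (INR (fact k) * INR (fact (k + n)))) / (INR (S k) * INR (S (k + n)))))
    (- ((-1) ^ k / (INR (fact k) * (INR (S (k + n)) * INR (fact (k + n))))))).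
  field. repeat split; lra.
Qed.

Lemma Derive_bessel (n : nat) (t : R) : Derive (fun u => bessel n u) t = - bessel (S n) t.
Proof. apply is_derive_unique, is_derive_bessel. Qed.

Lemma ex_derive_bessel (n : nat) (t : R) : ex_derive (fun u => bessel n u) t.
Proof. eexists; apply is_derive_bessel. Qed.

Lemma bessel_0 (n : nat) : bessel n 0 = / INR (fact n).
Proof.
  unfold bessel. rewrite PSeries_0. unfold bessel_coef. simpl. field. apply INR_fact_neq_0.
Qed.

Lemma ex_pseries_bessel (n : nat) (t : R) : ex_pseries (bessel_coef n) t.
Proof. apply CV_radius_inside. rewrite CV_radius_bessel. exact I. Qed.

Lemma bessel_rec (n : nat) (t : R) :
  t * bessel (S (S n)) t = INR (S n) * bessel (S n) t - bessel n t.
Proof.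
  unfold bessel. rewrite <- PSeries_incr_1, <- PSeries_scal, <- PSeries_minus.
  2:{ apply ex_pseries_scal; [apply Rmult_comm|apply ex_pseries_bessel]. }
  2:{ apply ex_pseries_bessel. }
  apply PSeries_ext; intros k. unfold PS_incr_1, PS_minus, PS_scal, PS_plus, PS_opp.
  destruct k as [|k].
  - change (0 = INR (S n) * bessel_coef (S n) 0 + - bessel_coef n 0).
    unfold bessel_coef. rewrite !Nat.add_0_l, INR_fact_S. simpl (fact 0). simpl ((-1) ^ 0). simpl (INR 1).
    pose proof (INR_fact_neq_0 n). pose proof (INR_S_pos n). field. split; lra.
  - change (bessel_coef (S (S n)) k = INR (S n) * bessel_coef (S n) (S k) + - bessel_coef n (S k)).
    unfold bessel_coef. replace (k + S (S n))%nat with (S (S (k + n))) by lia.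
    replace (S k + S n)%nat with (S (S (k + n))) by lia. rewrite Nat.add_succ_l, !INR_fact_S. cbn [pow].
    pose proof (INR_fact_neq_0 k). pose proof (INR_fact_neq_0 (k + n)).
    pose proof (INR_S_pos k). pose proof (INR_S_pos (k + n)). pose proof (INR_S_pos (S (k + n))).
    replace (INR (S n)) with (INR (S (S (k + n))) - INR (S k)).
    2:{ rewrite !S_INR, plus_INR. ring. }
    field. repeat split; lra.
Qed.

(** The left-hand side is an energy for the equation [t y'' + (n + 1) y' + y = 0]; its derivative is
    [- (2 n + 1) y'^2]. *)
Lemma bessel_energy (n : nat) (t : R) : 0 <= t ->
  bessel n t ^ 2 + t * bessel (S n) t ^ 2 <= (/ INR (fact n)) ^ 2.
Proof.
  intros Ht.
  assert (H := incr_of_derive (fun t => - (bessel n t ^ 2 + t * bessel (S n) t ^ 2))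
     (fun t => (2 * INR n + 1) * bessel (S n) t ^ 2) 0 t Ht).
  cbv beta in H. rewrite bessel_0 in H.
  enough (- ((/ INR (fact n)) ^ 2 + 0 * bessel (S n) 0 ^ 2) <= - (bessel n t ^ 2 + t * bessel (S n) t ^ 2)) by lra.
  apply H; clear H.
  - intros u _.
    auto_derive; [repeat split; apply ex_derive_bessel|].
    rewrite !Derive_bessel.
    assert (Hrec := bessel_rec n u). rewrite S_INR in Hrec.
    replace (bessel n u) with ((INR n + 1) * bessel (S n) u - u * bessel (S (S n)) u) by lra. ring.
  - intros u _. pose proof (pos_INR n). pose proof (pow2_ge_0 (bessel (S n) u)). nra.
Qed.

Lemma bessel_bound_fact (n : nat) (t : R) : 0 <= t -> Rabs (bessel n t) <= / INR (fact n).
Proof.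
  intros Ht. assert (H := bessel_energy n t Ht). pose proof (pow2_ge_0 (bessel (S n) t)).
  assert (0 < / INR (fact n)) by apply Rinv_0_lt_compat, INR_fact_lt_0.
  rewrite <- (Rabs_pos_eq (/ INR (fact n))) by lra.
  apply Rsqr_le_abs_0. unfold Rsqr. nra.
Qed.

Lemma bessel_bound_1 (n : nat) (t : R) : 0 <= t -> Rabs (bessel n t) <= 1.
Proof.
  intros Ht. apply Rle_trans with (1 := bessel_bound_fact n t Ht).
  rewrite <- Rinv_1. apply Rinv_le_contravar; [lra|]. rewrite <- INR_1. apply le_INR.
  pose proof (lt_O_fact n); lia.
Qed.

(** Partial sum of Neumann's series [J_0^2 + 2 (J_1^2 + J_2^2 + ...)]. *)
Definition neumann_sum (N : nat) (t : R) : R :=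
  bessel 0 t ^ 2 + 2 * Rsum (fun i => t ^ S i * bessel (S i) t ^ 2) N.

Lemma is_derive_neumann_sum (N : nat) (t : R) :
  is_derive (neumann_sum N) t (- 2 * t ^ N * bessel N t * bessel (S N) t).
Proof.
  induction N as [|N IH].
  - apply (is_derive_ext (fun t => bessel 0 t ^ 2)).
    { intros u; unfold neumann_sum; cbn [Rsum]; rewrite Rmult_0_r, Rplus_0_r; reflexivity. }

    auto_derive; [apply ex_derive_bessel|]. rewrite !Derive_bessel. ring.
  - apply (is_derive_ext (fun t => neumann_sum N t + 2 * t ^ S N * bessel (S N) t ^ 2)).
    { intros u; unfold neumann_sum; cbn [Rsum]. eq_in_R. ring. }
    replace (- 2 * t ^ S N * bessel (S N) t * bessel (S (S N)) t) with
      (- 2 * t ^ N * bessel N t * bessel (S N) t +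
       (2 * (INR (S N) * t ^ N) * bessel (S N) t ^ 2 - 4 * t ^ S N * bessel (S N) t * bessel (S (S N)) t)).
    2:{ cbn [pow]. assert (Hrec := bessel_rec N t).
        replace (bessel N t) with (INR (S N) * bessel (S N) t - t * bessel (S (S N)) t) by lra. ring. }
    apply @is_derive_plus; [exact IH|].

    auto_derive; [apply ex_derive_bessel|]. rewrite !Derive_bessel.
    change (match N with 0%nat => 1 | S _ => INR N + 1 end) with (INR (S N)). cbn [Nat.pred pow]. ring.
Qed.

(** In terms of [J_n] this is [J_0^2 + 2 (J_1^2 + J_2^2 + ...) = 1], whence [|J_n| <= 1] for all [n] at once.
    The derivative of the partial sum telescopes to a single product, which is tiny for large [N]. *)
Lemma is_lim_neumann_sum (t : R) : 0 <= t -> is_lim_seq (fun N => neumann_sum N t) 1.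
Proof.
  intros Ht.
  assert (B : forall N, Rabs (neumann_sum N t - 1) <= 2 * (t ^ S N / INR (fact (S N)))).
  { intros N. assert (E0 : neumann_sum N 0 = 1).
    { unfold neumann_sum. rewrite bessel_0. replace (Rsum _ N) with 0; [simpl; field|].
      transitivity (Rsum (fun _ => 0) N); [symmetry; apply Rsum_0|]. apply Rsum_ext; intros; simpl; ring. }
    rewrite <- E0.
    replace (2 * (t ^ S N / INR (fact (S N)))) with (2 * (t ^ S N / INR (fact (S N))) - 2 * (0 ^ S N / INR (fact (S N)))).
    2:{ rewrite (pow_i (S N)) by lia. unfold Rdiv; ring. }
    apply (derive_compare (neumann_sum N) (fun t => - 2 * t ^ N * bessel N t * bessel (S N) t)
      (fun t => 2 * (t ^ S N / INR (fact (S N)))) (fun t => 2 * (t ^ N / INR (fact N)))); [exact Ht| | |].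
    - intros; apply is_derive_neumann_sum.
    - intros; apply is_derive_monomial.
    - intros u Hu. assert (0 <= u ^ N) by (apply pow_le; lra).
      rewrite !Rabs_mult, (Rabs_pos_eq (u ^ N)) by assumption.
      replace (Rabs (-2)) with 2 by (rewrite Rabs_left; lra).
      assert (B1 := bessel_bound_fact N u ltac:(lra)). assert (B2 := bessel_bound_1 (S N) u ltac:(lra)).
      pose proof (Rabs_pos (bessel N u)). pose proof (Rabs_pos (bessel (S N) u)).
      unfold Rdiv. rewrite <- Rmult_assoc, <- (Rmult_1_r (2 * u ^ N * / _)).
      apply Rmult_le_compat; try assumption; [nra|]. apply Rmult_le_compat_l; [nra|assumption]. }
  apply is_lim_seq_ext with (fun N => 1 + (neumann_sum N t - 1)); [intros; ring|].
  replace (Finite 1) with (Finite (1 + 0)) by (f_equal; ring).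
  apply is_lim_seq_plus'; [apply is_lim_seq_const|]. apply is_lim_seq_abs_0.
  apply is_lim_seq_le_le with (fun _ => 0) (fun N => 2 * (t ^ S N / INR (fact (S N)))).
  - intros N; split; [apply Rabs_pos|apply B].
  - apply is_lim_seq_const.
  - replace (Finite 0) with (Finite (2 * 0)) by (f_equal; ring).
    apply (is_lim_seq_scal_l _ 2 (Finite 0)).
    apply (is_lim_seq_incr_1 (fun N => t ^ N / INR (fact N))).
    apply is_lim_seq_Reals, cv_speed_pow_fact.
Qed.

Lemma bessel_bound_pow (n : nat) (t : R) : 0 <= t -> t ^ S n * bessel (S n) t ^ 2 <= 1.
Proof.
  intros Ht.
  assert (P : forall i, 0 <= t ^ S i * bessel (S i) t ^ 2).
  { intros i; apply Rmult_le_pos; [apply pow_le, Ht|apply pow2_ge_0]. }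
  apply (is_lim_seq_le_loc (fun _ => t ^ S n * bessel (S n) t ^ 2) (fun N => neumann_sum N t) (t ^ S n * bessel (S n) t ^ 2) 1).
  - exists (S n). intros N HN. unfold neumann_sum.
    replace N with (S n + (N - S n))%nat by lia. rewrite Rsum_add. cbn [Rsum].
    assert (0 <= Rsum (fun i => t ^ S i * bessel (S i) t ^ 2) n) by (apply Rsum_pos; auto).
    assert (0 <= Rsum (fun i => t ^ S (S n + i) * bessel (S (S n + i)) t ^ 2) (N - S n)) by (apply Rsum_pos; auto).
    pose proof (pow2_ge_0 (bessel 0 t)). specialize (P n). lra.
  - apply is_lim_seq_const.
  - apply is_lim_neumann_sum, Ht.
Qed.

Lemma bessel_S_bound_sqr (n : nat) (t : R) : 1 <= t -> bessel (S n) t ^ 2 <= / t.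
Proof.
  intros Ht. assert (H := bessel_bound_pow n t ltac:(lra)).
  apply Rmult_le_reg_l with t; [lra|]. rewrite Rinv_r by lra.
  apply Rle_trans with (2 := H). apply Rmult_le_compat_r; [apply pow2_ge_0|].
  rewrite <- (pow_1 t) at 1. apply Rle_pow; [lra|lia].
Qed.

(** Multiply the energy by [sqrt t]: subtracting half of [sqrt t * bessel 0 t * bessel 1 t] leaves a derivative
    of size [1 / t], hence logarithmic growth, of which the bound [t^(1/4)] suffices.  Powers of [t] are
    written with [exp] and [ln] to keep derivatives simple. *)
Lemma bessel_decay (t : R) : 1 <= t ->
  bessel 0 t ^ 2 + t * bessel 1 t ^ 2 <= 2 * exp (- (ln t / 4)).
Proof.
  intros Ht.
  set (W := fun t => exp (ln t / 2) * (bessel 0 t ^ 2 + t * bessel 1 t ^ 2) - / 2 * exp (ln t / 2) * (bessel 0 t * bessel 1 t)).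
  assert (Hs : forall u, 1 <= u -> exp (ln u / 2) ^ 2 = u).
  { intros u Hu. simpl. rewrite Rmult_1_r, <- exp_plus. replace (ln u / 2 + ln u / 2) with (ln u) by field.
    apply exp_ln; lra. }
  assert (Hprod : forall u, 1 <= u -> Rabs (exp (ln u / 2) * (bessel 0 u * bessel 1 u)) <= 1).
  { intros u Hu. assert (B0 := bessel_bound_1 0 u ltac:(lra)).
    assert (B1 : Rabs (exp (ln u / 2) * bessel 1 u) <= 1).
    { rewrite <- (Rabs_pos_eq 1) by lra. apply Rsqr_le_abs_0. unfold Rsqr.
      assert (B := bessel_energy 0 u ltac:(lra)). simpl (/ INR (fact 0)) in B. rewrite Rinv_1 in B.
      specialize (Hs u Hu). pose proof (pow2_ge_0 (bessel 0 u)).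
      replace (exp (ln u / 2) * bessel 1 u * (exp (ln u / 2) * bessel 1 u)) with (exp (ln u / 2) ^ 2 * bessel 1 u ^ 2) by ring.
      rewrite Hs. lra. }
    replace (exp (ln u / 2) * (bessel 0 u * bessel 1 u)) with (bessel 0 u * (exp (ln u / 2) * bessel 1 u)) by ring.
    rewrite Rabs_mult. pose proof (Rabs_pos (bessel 0 u)). pose proof (Rabs_pos (exp (ln u / 2) * bessel 1 u)). nra. }
  assert (HW : Rabs (W t - W 1) <= exp (ln t / 4) - exp (ln 1 / 4)).
  { apply (derive_compare W (fun u => exp (ln u / 2) * (bessel 0 u * bessel 1 u) / (4 * u))
      (fun u => exp (ln u / 4)) (fun u => exp (ln u / 4) / (4 * u))); [exact Ht| | |].
    - intros u Hu.
      unfold W. auto_derive; [repeat split; try lra; apply ex_derive_bessel|].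
      rewrite !Derive_bessel.
      assert (Hrec := bessel_rec 0 u). rewrite INR_1 in Hrec.
      replace (bessel 2 u) with ((bessel 1 u - bessel 0 u) / u).
      2:{ apply Rmult_eq_reg_l with u; [|lra]. rewrite Hrec. field; lra. }
      change (ln u * / 2) with (ln u / 2). field; lra.
    - intros u Hu. auto_derive; [lra|]. change (ln u * / 4) with (ln u / 4). field; lra.
    - intros u Hu. unfold Rdiv. rewrite Rabs_mult, (Rabs_pos_eq (/ _)) by (left; apply Rinv_0_lt_compat; lra).
      apply Rmult_le_compat_r; [left; apply Rinv_0_lt_compat; lra|].
      apply Rle_trans with (1 := Hprod u ltac:(lra)). rewrite <- exp_0.
      assert (0 <= ln u) by (rewrite <- ln_1; apply ln_le; lra).
      destruct (Req_dec (ln u) 0) as [->|Hn]; [right; f_equal; ring|left; apply exp_increasing; lra]. }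
  set (q := exp (ln t / 4)) in *.
  rewrite ln_1 in HW. replace (0 / 4) with 0 in HW by field. rewrite exp_0 in HW.
  assert (Eq : exp (ln t / 2) = q ^ 2).
  { unfold q. simpl. rewrite Rmult_1_r, <- exp_plus. f_equal; field. }
  assert (Hq : 0 < q) by apply exp_pos.
  rewrite exp_Ropp. fold q.
  assert (W1 : W 1 <= 3 / 2).
  { assert (B := bessel_energy 0 1 ltac:(lra)). simpl (/ INR (fact 0)) in B. rewrite Rinv_1 in B.
    assert (P := Hprod 1 ltac:(lra)). unfold W. rewrite ln_1 in *. replace (0 / 2) with 0 in * by field. rewrite exp_0 in *.
    apply Rabs_le_between in P. lra. }
  assert (P := Hprod t Ht). apply Rabs_le_between in P. apply Rabs_le_between in HW.
  set (V := bessel 0 t ^ 2 + t * bessel 1 t ^ 2) in *.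
  assert (HV : q ^ 2 * V <= 1 + q).
  { rewrite <- Eq. unfold W in HW. fold V in HW. unfold W in W1.
    set (w1 := exp (ln 1 / 2) * _ - _) in *. lra. }
  assert (H1 : 1 <= q).
  { unfold q. rewrite <- exp_0. assert (0 <= ln t) by (rewrite <- ln_1; apply ln_le; lra).
    destruct (Req_dec (ln t) 0) as [->|Hn]; [right; f_equal; field|left; apply exp_increasing; lra]. }
  apply Rmult_le_reg_l with (q ^ 2); [apply pow_lt; lra|].
  replace (q ^ 2 * (2 * / q)) with (2 * q) by (field; lra). lra.
Qed.

(** Through [t * bessel 2 t = bessel 1 t - bessel 0 t]; the exponent exceeds 1, so this is integrable. *)
Lemma bessel_2_decay (t : R) : 1 <= t -> Rabs (bessel 2 t) <= 2 * exp (- (ln t / 8)) / t.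
Proof.
  intros Ht. assert (H := bessel_decay t Ht).
  assert (E : exp (- (ln t / 4)) = exp (- (ln t / 8)) ^ 2).
  { simpl. rewrite Rmult_1_r, <- exp_plus. f_equal; field. }
  rewrite E in H. assert (Hp := exp_pos (- (ln t / 8))). set (p := exp (- (ln t / 8))) in *.
  assert (Hrec := bessel_rec 0 t). rewrite INR_1, Rmult_1_l in Hrec.
  apply Rmult_le_reg_l with t; [lra|]. replace (t * (2 * p / t)) with (2 * p) by (field; lra).
  rewrite <- (Rabs_pos_eq t) at 1 by lra. rewrite <- Rabs_mult, Hrec.
  rewrite <- (Rabs_pos_eq (2 * p)) by lra. apply Rsqr_le_abs_0. unfold Rsqr.
  pose proof (pow2_ge_0 (bessel 0 t + bessel 1 t)). pose proof (pow2_ge_0 (bessel 1 t)). nra.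
Qed.

(** * Bessel's series with Euler's integral *)

(** [exp t] times the incomplete gamma function [Gamma (m + 1, t)]. *)
Fixpoint gamma_poly (m : nat) (t : R) : R :=
  match m with O => 1 | S p => t ^ S p + INR (S p) * gamma_poly p t end.

Lemma is_derive_gamma_poly (m : nat) (t : R) :
  is_derive (gamma_poly m) t (gamma_poly m t - t ^ m).
Proof.
  induction m as [|m IH].
  - replace (gamma_poly 0 t - t ^ 0) with 0 by (simpl; ring). apply @is_derive_const.
  - replace (gamma_poly (S m) t - t ^ S m) with (INR (S m) * t ^ m + INR (S m) * (gamma_poly m t - t ^ m))
      by (cbn [gamma_poly]; ring).
    apply (is_derive_plus (fun t => t ^ S m) (fun t => INR (S m) * gamma_poly m t)).
    + replace (INR (S m) * t ^ m) with (INR (S m) * 1 * t ^ Nat.pred (S m)) by (cbn [Nat.pred]; ring).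
      apply (is_derive_pow (fun t => t)). apply @is_derive_id.
    + apply is_derive_scal, IH.
Qed.

Lemma gamma_poly_0 (m : nat) : gamma_poly m 0 = INR (fact m).
Proof.
  induction m as [|m IH]; [simpl; ring|].
  cbn [gamma_poly]. rewrite IH, INR_fact_S, pow_i by lia. ring.
Qed.

Lemma is_lim_pow_exp (m : nat) : is_lim (fun t => exp (- t) * t ^ m) p_infty 0.
Proof.
  apply (is_lim_le_le_loc (fun _ => 0) (fun t => INR (fact (S m)) * / t)).
  - exists 0; intros t Ht.
    assert (0 < t ^ m) by (apply pow_lt, Ht). assert (P := exp_pos (- t)). split; [nra|].
    assert (H1 : t ^ S m / INR (fact (S m)) <= exp t).
    { apply Rle_trans with (2 := exp_ge_taylor t (S m) (Rlt_le _ _ Ht)).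
      rewrite Rsum_sum_f_R0. cbn [Rsum].
      match goal with |- ?b <= ?a + ?c + ?b => assert (0 <= a); [|assert (0 <= c)] end.
      - apply Rsum_pos; intros; apply Rdiv_le_0_compat; [apply pow_le; lra|apply INR_fact_lt_0].
      - apply Rdiv_le_0_compat; [apply pow_le; lra|apply INR_fact_lt_0].
      - lra. }
    pose proof (INR_fact_lt_0 (S m)).
    apply Rmult_le_reg_l with (exp t * t); [apply Rmult_lt_0_compat; [apply exp_pos|exact Ht]|].
    rewrite exp_Ropp. pose proof (exp_pos t).
    replace (exp t * t * (/ exp t * t ^ m)) with (t ^ S m) by (cbn [pow]; field; lra).
    replace (exp t * t * (INR (fact (S m)) * / t)) with (INR (fact (S m)) * exp t) by (field; lra).
    apply Rmult_le_reg_l with (/ INR (fact (S m))); [apply Rinv_0_lt_compat; assumption|].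
    replace (/ INR (fact (S m)) * (INR (fact (S m)) * exp t)) with (exp t) by (field; lra).
    rewrite Rmult_comm. exact H1.
  - apply is_lim_const.
  - replace (Finite 0) with (Rbar_mult (INR (fact (S m))) (Rbar_inv p_infty)) by (simpl; f_equal; ring).
    apply is_lim_scal_l. apply is_lim_inv; [apply is_lim_id|discriminate].
Qed.

Lemma is_lim_exp_gamma_poly (m : nat) : is_lim (fun t => - (exp (- t) * gamma_poly m t)) p_infty 0.
Proof.
  replace (Finite 0) with (Rbar_opp 0) by (simpl; f_equal; ring).
  apply is_lim_opp. induction m as [|m IH].
  - apply (is_lim_pow_exp 0).
  - apply is_lim_ext with (fun t => exp (- t) * t ^ S m + INR (S m) * (exp (- t) * gamma_poly m t)).
    { intros t; cbn [gamma_poly]; ring. }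
    replace (Finite 0) with (Finite (0 + INR (S m) * 0)) by (f_equal; ring).
    apply (is_lim_plus _ _ _ 0 (INR (S m) * 0)); [apply is_lim_pow_exp| |reflexivity].
    apply (is_lim_scal_l _ (INR (S m)) _ 0), IH.
Qed.

Lemma Gamma_nat (k : nat) : Gamma (INR k + 2) = INR (fact (S k)).
Proof.
  unfold Gamma. apply is_RInt_gen_unique; try typeclasses eauto.
  set (F := fun t => - (exp (- t) * gamma_poly (S k) t)).
  assert (HF : forall t, is_derive F t (exp (- t) * t ^ S k)).
  { intros t. assert (D := is_derive_gamma_poly (S k) t).
    assert (D' : is_derive (fun t => exp (- t)) t (- exp (- t))) by (auto_derive; [exact I|ring]).
    unfold F. assert (M := is_derive_mult _ _ t _ _ D' D Rmult_comm). apply @is_derive_opp in M.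
    evar_last; [exact M|]. unfold opp, plus, mult; simpl.
    eq_in_R. ring. }
  assert (HD : forall t, Derive F t = exp (- t) * t ^ S k) by (intros; apply is_derive_unique, HF).
  apply (is_RInt_gen_ext (Derive F)).
  - apply Filter_prod with (fun a => 0 < a) (fun b => 0 < b).
    + exists (mkposreal 1 Rlt_0_1). intros y _ Hy; exact Hy.
    + exists 0; auto.
    + intros a b Ha Hb x Hx. simpl in Hx. rewrite HD.
      assert (0 < x) by (unfold Rmin, Rmax in Hx; destruct (Rle_dec a b); lra).
      replace (INR k + 2 - 1) with (INR (S k)) by (rewrite S_INR; ring).
      rewrite Rpower_pow by assumption. eq_in_R. ring.
  - replace (INR (fact (S k))) with (0 - (- INR (fact (S k)))) by ring.
    apply is_RInt_gen_Derive.
    + apply filter_forall. intros [a b] x _. eexists; apply HF.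
    + apply filter_forall. intros [a b] x _.
      apply continuous_ext with (fun t => exp (- t) * t ^ S k); [intros; symmetry; apply HD|].
      apply (@ex_derive_continuous R_AbsRing R_NormedModule). auto_derive; exact I.
    + eapply filterlim_filter_le_1; [apply filter_le_within|].
      replace (- INR (fact (S k))) with (F 0).
      2:{ unfold F. rewrite gamma_poly_0, Ropp_0, exp_0. ring. }
      apply (@ex_derive_continuous R_AbsRing R_NormedModule). eexists; apply HF.
    + apply (is_lim_exp_gamma_poly (S k)).
Qed.

Lemma BesselJ1_bessel (z : R) : BesselJ1 z = z / 2 * bessel 1 (z ^ 2 / 4).
Proof.
  unfold BesselJ1, bessel, PSeries. rewrite <- Series_scal_l. apply Series_ext; intros k.
  rewrite Gamma_nat, pow_add, pow_1, pow_mult. unfold bessel_coef.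
  rewrite Nat.add_comm. change (1 + k)%nat with (S k).
  replace ((z / 2) ^ 2) with (z ^ 2 / 4) by field. field.
  split; apply INR_fact_neq_0.
Qed.

(** * A Fourier integral of a Bessel function *)

Lemma is_lim_bessel_S (n : nat) : is_lim (bessel (S n)) p_infty 0.
Proof.
  apply is_lim_spec. intros eps. simpl. exists (1 + / eps ^ 2). intros t Ht.
  assert (He := cond_pos eps). assert (0 < / eps ^ 2) by (apply Rinv_0_lt_compat, pow_lt, He).
  rewrite Rminus_0_r. rewrite <- (Rabs_pos_eq eps) by lra. apply Rsqr_lt_abs_0.
  assert (B := bessel_S_bound_sqr n t ltac:(lra)). unfold Rsqr.
  apply Rle_lt_trans with (/ t); [lra|]. rewrite <- (Rinv_inv (eps * eps)).
  replace (eps * eps) with (eps ^ 2) by ring. apply Rinv_lt_contravar; [|lra].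
  apply Rmult_lt_0_compat; lra.
Qed.

(** An integrable majorant with an explicit primitive.  For [t <= rho] it comes from the bound [1 / n!], for
    [t >= rho] from [|J_n| <= 1]; its size [rho^(-J)] compensates a factor [b^(-2 J)] once [rho > 1 / b^2]. *)
Lemma bessel_majorant (J : nat) (rho t : R) : 0 < rho -> 0 <= t ->
  Rabs (bessel (2 * J + 3) t) <=
  3 * (/ rho ^ J + rho * sqrt rho / INR (fact (2 * J + 3))) / ((rho + t) * sqrt (rho + t)).
Proof.
  intros Hr Ht. set (s := sqrt (rho + t)). set (r := sqrt rho).
  assert (Hs : 0 < s) by (apply sqrt_lt_R0; lra). assert (Hr' : 0 < r) by (apply sqrt_lt_R0; lra).
  assert (Es : s ^ 2 = rho + t) by (unfold s; rewrite pow2_sqrt; lra).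
  assert (Er : r ^ 2 = rho) by (unfold r; rewrite pow2_sqrt; lra).
  assert (HF := INR_fact_lt_0 (2 * J + 3)). assert (HJ : 0 < / rho ^ J) by (apply Rinv_0_lt_compat, pow_lt, Hr).
  apply Rmult_le_reg_r with ((rho + t) * s); [apply Rmult_lt_0_compat; lra|].
  unfold Rdiv at 1. rewrite Rmult_assoc, Rinv_l, Rmult_1_r by (apply Rgt_not_eq, Rmult_lt_0_compat; lra).
  destruct (Rle_dec t rho) as [H|H].
  - apply Rle_trans with (/ INR (fact (2 * J + 3)) * (3 * (rho * r))).
    2:{ unfold Rdiv. assert (0 < rho * r * / INR (fact (2 * J + 3))); [|lra].
        apply Rmult_lt_0_compat; [nra|apply Rinv_0_lt_compat, HF]. }
    apply Rmult_le_compat; [apply Rabs_pos|nra|apply bessel_bound_fact, Ht|].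
    assert (Hsr : s <= 3 / 2 * r).
    { apply Rsqr_incr_0; unfold Rsqr; nra. }
    apply Rle_trans with (2 * rho * (3 / 2 * r)); [apply Rmult_le_compat; lra|lra].
  - apply Rle_trans with (3 * / rho ^ J).
    2:{ unfold Rdiv. assert (0 < rho * r * / INR (fact (2 * J + 3))); [|lra].
        apply Rmult_lt_0_compat; [nra|apply Rinv_0_lt_compat, HF]. }
    rewrite <- (Rabs_pos_eq ((rho + t) * s)), <- Rabs_mult by nra.
    rewrite <- (Rabs_pos_eq (3 * / rho ^ J)) by lra. apply Rsqr_le_abs_0. unfold Rsqr.
    assert (B := bessel_bound_pow (2 * J + 2) t Ht).
    replace (S (2 * J + 2)) with (2 * J + 3)%nat in B by lia.
    set (x := bessel (2 * J + 3) t) in *.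
    replace (x * ((rho + t) * s) * (x * ((rho + t) * s))) with (x ^ 2 * (rho + t) ^ 2 * s ^ 2) by ring.
    rewrite Es. replace (x ^ 2 * (rho + t) ^ 2 * (rho + t)) with (x ^ 2 * (rho + t) ^ 3) by ring.
    apply Rle_trans with (x ^ 2 * (8 * t ^ 3)).
    { apply Rmult_le_compat_l; [apply pow2_ge_0|].
      replace (8 * t ^ 3) with ((2 * t) ^ 3) by ring. apply pow_incr; lra. }
    replace (3 * / rho ^ J * (3 * / rho ^ J)) with (9 * / (rho ^ J * rho ^ J)).
    2:{ field. apply pow_nonzero; lra. }
    assert (Hrr : 0 < rho ^ J * rho ^ J) by (apply Rmult_lt_0_compat; apply pow_lt, Hr).
    apply Rmult_le_reg_l with (rho ^ J * rho ^ J); [exact Hrr|].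
    replace (rho ^ J * rho ^ J * (9 * / (rho ^ J * rho ^ J))) with 9 by (field; apply pow_nonzero; lra).
    assert (Ht3 : 0 <= x ^ 2 * t ^ 3) by (apply Rmult_le_pos; [apply pow2_ge_0|apply pow_le; lra]).
    assert (HrJ : rho ^ J * rho ^ J <= t ^ J * t ^ J).
    { apply Rmult_le_compat; try (apply pow_le; lra); apply pow_incr; lra. }
    rewrite pow_add in B. replace (2 * J)%nat with (J + J)%nat in B by lia. rewrite pow_add in B.
    assert (rho ^ J * rho ^ J * (x ^ 2 * t ^ 3) <= t ^ J * t ^ J * (x ^ 2 * t ^ 3)) by (apply Rmult_le_compat_r; assumption).
    lra.
Qed.

Lemma is_derive_inv_sqrt (K rho t : R) : 0 < rho -> 0 <= t ->
  is_derive (fun t => - (2 * K) / sqrt (rho + t)) t (K / ((rho + t) * sqrt (rho + t))).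
Proof.
  intros Hr Ht. assert (0 < sqrt (rho + t)) by (apply sqrt_lt_R0; lra).
  auto_derive; [split; [lra|]; split; [lra|exact I]|].
  assert (E : sqrt (rho + t) ^ 2 = rho + t) by (rewrite pow2_sqrt; lra).
  transitivity (K / (sqrt (rho + t) ^ 2 * sqrt (rho + t))); [field; lra|rewrite E; reflexivity].
Qed.

Definition bessel_cos (n : nat) (b T : R) : R := RInt (fun t => bessel n t * cos (b * t)) 0 T.

Lemma continuous_bessel_cos (n : nat) (b t : R) : continuous (fun t => bessel n t * cos (b * t)) t.
Proof.
  apply (@ex_derive_continuous R_AbsRing R_NormedModule).
  auto_derive; repeat split; apply ex_derive_bessel.
Qed.

Lemma is_derive_bessel_cos (n : nat) (b T : R) :
  is_derive (bessel_cos n b) T (bessel n T * cos (b * T)).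
Proof.
  apply (is_derive_RInt (fun t => bessel n t * cos (b * t)) (bessel_cos n b) 0).
  - apply filter_forall. intros x. apply (@RInt_correct R_CompleteNormedModule), ex_RInt_continuous. intros; apply continuous_bessel_cos.
  - apply continuous_bessel_cos.
Qed.

Lemma bessel_cos_0 (n : nat) (b : R) : bessel_cos n b 0 = 0.
Proof. apply @RInt_point. Qed.

(** Two integrations by parts. *)
Lemma bessel_cos_rec (n : nat) (b T : R) : b <> 0 -> 0 <= T ->
  bessel_cos n b T = bessel n T * (sin (b * T) / b) - bessel (S n) T * (cos (b * T) / b ^ 2)
    + / INR (fact (S n)) / b ^ 2 - bessel_cos (S (S n)) b T / b ^ 2.
Proof.
  intros Hb HT.
  set (h := fun T => bessel_cos n b T + bessel_cos (S (S n)) b T / b ^ 2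
     - (bessel n T * (sin (b * T) / b) - bessel (S n) T * (cos (b * T) / b ^ 2))).
  assert (Hh : Rabs (h T - h 0) <= 0 * (T - 0)).
  { apply (derive_bound h (fun _ => 0)); [exact HT| |intros; rewrite Rabs_R0; lra].
    intros t _. unfold h.
    assert (D1 : ex_derive (fun x => bessel_cos n b x) t) by (eexists; apply is_derive_bessel_cos).
    assert (D2 : ex_derive (fun x => bessel_cos (S (S n)) b x) t) by (eexists; apply is_derive_bessel_cos).
    auto_derive.
    - repeat split; try assumption; apply ex_derive_bessel.
    - rewrite !Derive_bessel.
      replace (Derive (fun x => bessel_cos n b x) t) with (bessel n t * cos (b * t))
        by (symmetry; apply is_derive_unique, is_derive_bessel_cos).
      replace (Derive (fun x => bessel_cos (S (S n)) b x) t) with (bessel (S (S n)) t * cos (b * t))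
        by (symmetry; apply is_derive_unique, is_derive_bessel_cos).
      field. exact Hb. }
  rewrite Rmult_0_l in Hh. assert (E : h T - h 0 = 0).
  { apply Rabs_eq_0, Rle_antisym; [exact Hh|apply Rabs_pos]. }
  unfold h in E. rewrite !bessel_cos_0, !bessel_0, !Rmult_0_r, sin_0, cos_0 in E.
  pose proof (INR_fact_neq_0 (S n)).
  replace (0 + 0 / b ^ 2 - (/ INR (fact n) * (0 / b) - / INR (fact (S n)) * (1 / b ^ 2))) with (/ INR (fact (S n)) / b ^ 2) in E.
  2:{ pose proof (INR_fact_neq_0 n). field. auto. }
  lra.
Qed.

Lemma bessel_cos_diff (J : nat) (rho b T0 T : R) : 0 < rho -> 0 <= T0 <= T ->
  Rabs (bessel_cos (2 * J + 3) b T - bessel_cos (2 * J + 3) b T0) <=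
  2 * (3 * (/ rho ^ J + rho * sqrt rho / INR (fact (2 * J + 3)))) / sqrt (rho + T0).
Proof.
  intros Hr HT. set (K := 3 * _).
  assert (H0T : 0 < sqrt (rho + T)) by (apply sqrt_lt_R0; lra).
  assert (HK : 0 <= K).
  { unfold K. assert (0 < / rho ^ J) by (apply Rinv_0_lt_compat, pow_lt, Hr).
    assert (0 <= rho * sqrt rho / INR (fact (2 * J + 3))); [|lra].
    apply Rdiv_le_0_compat; [apply Rmult_le_pos; [lra|apply sqrt_pos]|apply INR_fact_lt_0]. }
  apply Rle_trans with (- (2 * K) / sqrt (rho + T) - - (2 * K) / sqrt (rho + T0)).
  - apply (derive_compare (bessel_cos (2 * J + 3) b) (fun t => bessel (2 * J + 3) t * cos (b * t))
      (fun t => - (2 * K) / sqrt (rho + t)) (fun t => K / ((rho + t) * sqrt (rho + t)))); [lra| | |].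
    + intros; apply is_derive_bessel_cos.
    + intros; apply is_derive_inv_sqrt; lra.
    + intros t Ht. rewrite Rabs_mult. rewrite <- (Rmult_1_r (K / _)).
      apply Rmult_le_compat; try apply Rabs_pos; [apply bessel_majorant; lra|apply Rabs_le, COS_bound].
  - assert (0 <= 2 * K / sqrt (rho + T)) by (apply Rdiv_le_0_compat; lra). unfold Rdiv in *. lra.
Qed.

(** The limit does not depend on [rho], which can therefore be chosen later according to [b]. *)
Lemma ex_lim_bessel_cos (J : nat) (b : R) : exists L : R,
  is_lim (bessel_cos (2 * J + 3) b) p_infty L /\
  forall rho, 0 < rho -> Rabs L <= 2 * (3 * (/ rho ^ J + rho * sqrt rho / INR (fact (2 * J + 3)))) / sqrt rho.
Proof.
  assert (EL : exists L : R, filterlim (bessel_cos (2 * J + 3) b) (Rbar_locally' p_infty) (locally L)).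
  { apply (filterlim_locally_cauchy (U := R_CompleteSpace)).
    intros eps. set (K := 2 * (3 * (/ 1 ^ J + 1 * sqrt 1 / INR (fact (2 * J + 3))))).
    assert (He := cond_pos eps).
    exists (fun T => 0 < T /\ (K / eps) ^ 2 < T). split.
    { exists (Rmax 0 ((K / eps) ^ 2)). intros T HT. split; (eapply Rle_lt_trans; [|exact HT]); [apply Rmax_l|apply Rmax_r]. }
    assert (W : forall u v, 0 < u -> (K / eps) ^ 2 < u -> u <= v ->
       Rabs (bessel_cos (2 * J + 3) b v - bessel_cos (2 * J + 3) b u) < eps).
    { intros u v Hu1 Hu2 Huv.
      eapply Rle_lt_trans; [apply (bessel_cos_diff J 1); lra|]. fold K.
      assert (Hs : 0 < sqrt (1 + u)) by (apply sqrt_lt_R0; lra).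
      assert (Hk : K / eps < sqrt (1 + u)).
      { apply Rsqr_incrst_0; [|unfold K; apply Rdiv_le_0_compat; [|exact He]|lra].
        - rewrite Rsqr_sqrt by lra. unfold Rsqr. simpl in Hu2. lra.
        - rewrite pow1, sqrt_1. assert (0 < / INR (fact (2 * J + 3))) by apply Rinv_0_lt_compat, INR_fact_lt_0.
          unfold Rdiv. lra. }
      apply Rmult_lt_reg_r with (sqrt (1 + u)); [exact Hs|].
      replace (K / sqrt (1 + u) * sqrt (1 + u)) with (K / eps * eps) by (field; lra).
      rewrite Rmult_comm. apply Rmult_lt_compat_l; assumption. }
    intros u v [Hu1 Hu2] [Hv1 Hv2].
    change (Rabs (bessel_cos (2 * J + 3) b v - bessel_cos (2 * J + 3) b u) < eps).
    destruct (Rle_dec u v) as [H|H]; [apply W; assumption|].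
    rewrite <- Rabs_Ropp, Ropp_minus_distr. apply W; try assumption; lra. }
  destruct EL as [L HL]. exists L. split; [exact HL|].
  intros rho Hr.
  apply (is_lim_seq_Rabs_le (fun N => bessel_cos (2 * J + 3) b (INR N))).
  - apply (is_lim_comp_seq _ _ p_infty L HL); [exists O; intros; discriminate|apply is_lim_seq_INR].
  - intros N. assert (D := bessel_cos_diff J rho b 0 (INR N) Hr (conj (Rle_refl 0) (pos_INR N))).
    rewrite bessel_cos_0, Rminus_0_r, Rplus_0_r in D. exact D.
Qed.

Lemma is_lim_mult_bounded (f g : R -> R) (M : R) :
  is_lim f p_infty 0 -> (forall t, Rabs (g t) <= M) -> is_lim (fun t => f t * g t) p_infty 0.
Proof.
  intros Hf Hg. apply is_lim_spec. intros eps. apply is_lim_spec in Hf.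
  assert (HM : 0 < Rabs M + 1) by (pose proof (Rabs_pos M); lra).
  assert (He : 0 < eps / (Rabs M + 1)) by (apply Rdiv_lt_0_compat; [apply cond_pos|exact HM]).
  destruct (Hf (mkposreal _ He)) as [A HA]. exists A. intros t Ht. specialize (HA t Ht). simpl in HA.
  rewrite Rminus_0_r in *. rewrite Rabs_mult.
  apply Rle_lt_trans with (Rabs (f t) * Rabs M).
  - apply Rmult_le_compat_l; [apply Rabs_pos|]. apply Rle_trans with (1 := Hg t). apply Rle_abs.
  - apply Rle_lt_trans with (Rabs (f t) * (Rabs M + 1)).
    + apply Rmult_le_compat_l; [apply Rabs_pos|lra].
    + apply Rmult_lt_reg_r with (/ (Rabs M + 1)); [apply Rinv_0_lt_compat, HM|].
      rewrite Rmult_assoc, Rinv_r, Rmult_1_r by lra. exact HA.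
Qed.

Lemma bessel_cos_limit_rec (n : nat) (b L L' : R) : 0 < b ->
  is_lim (bessel_cos (S n) b) p_infty L -> is_lim (bessel_cos (S (S (S n))) b) p_infty L' ->
  L = / INR (fact (S (S n))) / b ^ 2 - L' / b ^ 2.
Proof.
  intros Hb HL HL'.
  assert (H : is_lim (bessel_cos (S n) b) p_infty (0 - 0 + / INR (fact (S (S n))) / b ^ 2 - L' / b ^ 2)).
  { eapply is_lim_ext_loc.
    - exists 0. intros t Ht. symmetry. apply bessel_cos_rec; lra.
    - apply (is_lim_minus' _ _ _ (0 - 0 + / INR (fact (S (S n))) / b ^ 2) (L' / b ^ 2)).
      + apply (is_lim_plus' _ _ _ (0 - 0) (/ INR (fact (S (S n))) / b ^ 2)); [|apply is_lim_const].
        apply (is_lim_minus' _ _ _ 0 0).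
        * apply is_lim_mult_bounded with (/ b); [apply is_lim_bessel_S|]. intros t.
          unfold Rdiv. rewrite Rabs_mult, (Rabs_pos_eq (/ b)) by (left; apply Rinv_0_lt_compat, Hb).
          rewrite <- (Rmult_1_l (/ b)) at 2. apply Rmult_le_compat_r; [left; apply Rinv_0_lt_compat, Hb|].
          apply Rabs_le, SIN_bound.
        * apply is_lim_mult_bounded with (/ b ^ 2); [apply is_lim_bessel_S|]. intros t.
          assert (0 < / b ^ 2) by (apply Rinv_0_lt_compat, pow_lt, Hb).
          unfold Rdiv. rewrite Rabs_mult, (Rabs_pos_eq (/ b ^ 2)) by lra.
          rewrite <- (Rmult_1_l (/ b ^ 2)) at 2. apply Rmult_le_compat_r; [lra|].
          apply Rabs_le, COS_bound.
      + apply (is_lim_scal_r (bessel_cos (S (S (S n))) b) (/ b ^ 2) p_infty L'), HL'. }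
  apply is_lim_unique in HL. apply is_lim_unique in H. rewrite HL in H. apply Rbar_finite_eq in H. lra.
Qed.

(** Iterating the integrations by parts expands the integral in inverse powers of [b]; the remainder
    vanishes by [bessel_majorant] with [rho = 4 / b^2], and the expansion is a cosine series. *)
Lemma is_lim_bessel_cos_3 (b : R) : 0 < b ->
  is_lim (bessel_cos 3 b) p_infty (1 / 2 - b ^ 2 * (1 - cos (/ b))).
Proof.
  intros Hb.
  destruct (ex_lim_bessel_cos 0 b) as [L [HL _]]. simpl in HL.
  replace (1 / 2 - b ^ 2 * (1 - cos (/ b))) with L; [exact HL|].
  assert (Hexp : forall J (L' : R), is_lim (bessel_cos (2 * J + 3) b) p_infty L' ->
    L = Rsum (fun j => (-1) ^ j / INR (fact (2 * j + 4)) * (/ b ^ 2) ^ S j) J + (-1) ^ J * (/ b ^ 2) ^ J * L').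
  { induction J as [|J IH]; intros L' HL'.
    - simpl in HL'. apply is_lim_unique in HL. apply is_lim_unique in HL'. rewrite HL in HL'.
      apply Rbar_finite_eq in HL'. simpl. lra.
    - destruct (ex_lim_bessel_cos J b) as [L1 [HL1 _]]. rewrite (IH L1 HL1).
      replace (2 * S J + 3)%nat with (S (S (S (2 * J + 2)))) in HL' by lia.
      replace (2 * J + 3)%nat with (S (2 * J + 2)) in HL1 by lia.
      rewrite (bessel_cos_limit_rec (2 * J + 2) b L1 L' Hb HL1 HL'). cbn [Rsum].
      replace (S (S (2 * J + 2))) with (2 * J + 4)%nat by lia. cbn [pow].
      pose proof (INR_fact_neq_0 (2 * J + 4)). field. split; lra. }
  assert (Hlim : is_lim_seq (Rsum (fun j => (-1) ^ j / INR (fact (2 * j + 4)) * (/ b ^ 2) ^ S j)) L).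
  { set (a := Rsum _).
    apply is_lim_seq_ext with (fun J => L + (a J - L)); [intros; ring|].
    replace (Finite L) with (Finite (L + 0)) by (f_equal; ring).
    apply is_lim_seq_plus'; [apply is_lim_seq_const|]. apply is_lim_seq_abs_0.
    set (c := 4 / b ^ 2 * sqrt (4 / b ^ 2)). set (B := 6 / sqrt (4 / b ^ 2)).
    assert (Hb2 : 0 < / b ^ 2) by (apply Rinv_0_lt_compat, pow_lt, Hb).
    assert (Hrho : 0 < 4 / b ^ 2) by (unfold Rdiv; lra).
    assert (Hsq : 0 < sqrt (4 / b ^ 2)) by (apply sqrt_lt_R0, Hrho).
    apply is_lim_seq_le_le with (fun _ => 0) (fun J => B * ((/ 4) ^ J + c * ((/ b ^ 2) ^ J / INR (fact J)))).
    - intros J. split; [apply Rabs_pos|].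
      destruct (ex_lim_bessel_cos J b) as [L' [HL' HB]]. specialize (HB _ Hrho).
      replace (a J - L) with (- ((-1) ^ J * (/ b ^ 2) ^ J * L')) by (unfold a; rewrite (Hexp J L' HL'); ring).
      assert (P0 : 0 < (/ b ^ 2) ^ J) by (apply pow_lt, Hb2).
      rewrite Rabs_Ropp, !Rabs_mult, pow_1_abs, Rmult_1_l, (Rabs_pos_eq ((/ b ^ 2) ^ J)) by lra.
      eapply Rle_trans; [apply Rmult_le_compat_l; [lra|exact HB]|].
      assert (EJ : (/ b ^ 2) ^ J * / (4 / b ^ 2) ^ J = (/ 4) ^ J).
      { rewrite <- (pow_inv (4 / b ^ 2) J), <- Rpow_mult_distr. f_equal. field. lra. }
      assert (FJ : / INR (fact (2 * J + 3)) <= / INR (fact J)).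
      { apply Rinv_le_contravar; [apply INR_fact_lt_0|apply le_INR, fact_le; lia]. }
      fold c. assert (Hc : 0 <= c) by (unfold c; nra).
      replace ((/ b ^ 2) ^ J * (2 * (3 * (/ (4 / b ^ 2) ^ J + c / INR (fact (2 * J + 3)))) / sqrt (4 / b ^ 2)))
        with (B * ((/ b ^ 2) ^ J * / (4 / b ^ 2) ^ J + c * ((/ b ^ 2) ^ J * / INR (fact (2 * J + 3)))))
        by (unfold B, Rdiv; ring).
      rewrite EJ. apply Rmult_le_compat_l; [unfold B; apply Rdiv_le_0_compat; lra|].
      apply Rplus_le_compat_l, Rmult_le_compat_l; [exact Hc|].
      apply Rmult_le_compat_l; [lra|exact FJ].
    - apply is_lim_seq_const.
    - replace (Finite 0) with (Finite (B * (0 + c * 0))) by (f_equal; ring).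
      apply (is_lim_seq_scal_l _ B (Finite _)). apply is_lim_seq_plus'.
      + apply is_lim_seq_geom. rewrite Rabs_pos_eq; lra.
      + apply (is_lim_seq_scal_l _ c (Finite 0)). apply is_lim_seq_Reals, cv_speed_pow_fact. }
  assert (HC := is_series_cos (/ b)). apply is_series_Rsum in HC.
  apply (proj1 (is_lim_seq_incr_1 _ _)), (proj1 (is_lim_seq_incr_1 _ _)) in HC.
  assert (Hlim2 : is_lim_seq (Rsum (fun j => (-1) ^ j / INR (fact (2 * j + 4)) * (/ b ^ 2) ^ S j))
     (b ^ 2 * (cos (/ b) - 1 + / (2 * b ^ 2)))).
  { apply is_lim_seq_ext with (fun n => b ^ 2 * (Rsum (fun i => (-1) ^ i / INR (fact (2 * i)) * ((/ b) ^ 2) ^ i) (S (S n)) - 1 + / (2 * b ^ 2))).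
    - intros n. rewrite Rsum_shift, Rsum_shift. rewrite pow_inv.
      match goal with |- b ^ 2 * (?x + (?y + ?s) - 1 + ?z) = _ => replace (x + (y + s) - 1 + z) with s by (simpl; field; lra) end.
      rewrite <- Rsum_scal. apply Rsum_ext; intros i _.
      replace (2 * S (S i))%nat with (2 * i + 4)%nat by lia. cbn [pow].
      pose proof (INR_fact_neq_0 (2 * i + 4)). field. split; lra.
    - apply (is_lim_seq_scal_l _ (b ^ 2) (Finite _)).
      apply is_lim_seq_plus'; [|apply is_lim_seq_const]. apply is_lim_seq_minus'; [exact HC|apply is_lim_seq_const]. }
  apply is_lim_seq_unique in Hlim. apply is_lim_seq_unique in Hlim2. rewrite Hlim in Hlim2.
  apply Rbar_finite_eq in Hlim2. rewrite Hlim2. field. lra.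
Qed.

(** * Summation of the Bessel series *)

Lemma is_lim_bessel_0 : is_lim (bessel 0) p_infty 0.
Proof.
  apply is_lim_spec. intros eps. simpl. assert (He := cond_pos eps).
  set (d := eps ^ 2 / 2). assert (Hd : 0 < d) by (unfold d; apply Rdiv_lt_0_compat; [apply pow_lt|]; lra).
  exists (Rmax 1 (exp (- 4 * ln d))). intros t Ht.
  assert (H1 : 1 < t) by (eapply Rle_lt_trans; [apply Rmax_l|exact Ht]).
  assert (H2 : exp (- 4 * ln d) < t) by (eapply Rle_lt_trans; [apply Rmax_r|exact Ht]).
  rewrite Rminus_0_r. rewrite <- (Rabs_pos_eq eps) by lra. apply Rsqr_lt_abs_0. unfold Rsqr.
  assert (B := bessel_decay t ltac:(lra)).
  assert (L : - 4 * ln d < ln t).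
  { rewrite <- (ln_exp (- 4 * ln d)). apply ln_increasing; [apply exp_pos|exact H2]. }
  assert (X : exp (- (ln t / 4)) < d).
  { rewrite <- (exp_ln d) by exact Hd. apply exp_increasing. lra. }
  pose proof (pow2_ge_0 (bessel 1 t)). unfold d in X. nra.
Qed.

Lemma is_lim_bessel (n : nat) : is_lim (bessel n) p_infty 0.
Proof. destruct n; [apply is_lim_bessel_0|apply is_lim_bessel_S]. Qed.

Lemma is_lim_seq_scal_INR (f : R -> R) (u l : R) : 0 < u ->
  is_lim f p_infty l -> is_lim_seq (fun M => f (u * INR M)) l.
Proof.
  intros Hu Hf. apply (is_lim_comp_seq f (fun M => u * INR M) p_infty l Hf).
  - exists O; intros; discriminate.
  - replace p_infty with (Rbar_mult u p_infty).
    + apply is_lim_seq_scal_l, is_lim_seq_INR.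
    + simpl. destruct (Rle_dec 0 u) as [H|H]; [|lra].
      destruct (Rle_lt_or_eq_dec 0 u H); [reflexivity|lra].
Qed.

(** Contribution of the first [N] frequencies to the Euler-Maclaurin remainder on [[0, t]]. *)
Definition fourier_part (u : R) (N : nat) (t : R) : R :=
  Rsum (fun k => 2 / (2 * PI * INR (S k)) ^ 2 * (u * bessel_cos 3 (2 * PI * INR (S k) / u) (u * t))) N.

Lemma is_derive_fourier_part (u : R) (N m : nat) (t : R) : 0 < u ->
  is_derive (fourier_part u N) t (u ^ 2 * bessel 3 (u * t) * bern_trig 2 N (t - INR m)).
Proof.
  intros Hu. unfold bern_trig. rewrite <- Rsum_scal.
  apply (is_derive_Rsum (fun k t => 2 / (2 * PI * INR (S k)) ^ 2 * (u * bessel_cos 3 (2 * PI * INR (S k) / u) (u * t)))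
   (fun k t => u ^ 2 * bessel 3 (u * t) * (-2 * cos (2 * PI * INR (S k) * (t - INR m) - INR 2 * (PI / 2)) / (2 * PI * INR (S k)) ^ 2))).
  intros k _. pose proof PI_RGT_0. pose proof (INR_S_pos k).
  assert (D := is_derive_bessel_cos 3 (2 * PI * INR (S k) / u) (u * t)).
  replace (cos (2 * PI * INR (S k) * (t - INR m) - INR 2 * (PI / 2))) with (- cos (2 * PI * INR (S k) * t)).
  2:{ simpl (INR 2). replace (2 * PI * INR (S k) * (t - INR m) - (1 + 1) * (PI / 2))
        with (2 * PI * INR (S k) * t - (PI + 2 * INR (S k * m) * PI)) by (rewrite mult_INR; field).
      rewrite cos_minus, (sin_period PI), (cos_period PI), cos_PI, sin_PI. ring. }
  auto_derive; [eexists; exact D|].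
  replace (Derive _ _) with (bessel 3 (u * t) * cos (2 * PI * INR (S k) / u * (u * t))) by (symmetry; apply is_derive_unique, D).
  replace (2 * PI * INR (S k) / u * (u * t)) with (2 * PI * INR (S k) * t) by (field; lra).
  change (match k with 0%nat => 1 | S _ => INR k + 1 end) with (INR (S k)).
  field. split; lra.
Qed.

Lemma ex_derive_bern_poly (n : nat) (t : R) : ex_derive (fun x => bern_poly (S n) x) t.
Proof. eexists; apply is_derive_bern_poly. Qed.

Lemma Derive_bern_poly (n : nat) (t : R) : Derive (fun x => bern_poly (S n) x) t = bern_poly n t.
Proof. apply is_derive_unique, is_derive_bern_poly. Qed.

Lemma bern_poly_0E (t : R) : bern_poly 0 t = 1.
Proof. unfold bern_poly, bernoulli; simpl; field. Qed.

(* unification must not try to compute Bernoulli polynomials or power series *)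
Opaque bern_poly bessel.

(** With [phi t = bessel 1 (u t)]: on [[m, m + 1]] this is a primitive of [phi''] times the error of the [N]-th
    Fourier partial sum of the second Bernoulli polynomial.  The other three terms are the usual boundary
    terms and the primitive of [phi]. *)
Definition euler_maclaurin (u : R) (N m : nat) (t : R) : R :=
  - u * bessel 2 (u * t) * bern_poly 2 (t - INR m) - bessel 1 (u * t) * bern_poly 1 (t - INR m)
  - bessel 0 (u * t) / u - fourier_part u N t.

Lemma is_derive_euler_maclaurin (u : R) (N m : nat) (t : R) : 0 < u ->
  is_derive (euler_maclaurin u N m) t (u ^ 2 * bessel 3 (u * t) * bern_err 2 N (t - INR m)).
Proof.
  intros Hu. unfold euler_maclaurin. unfold bern_err. rewrite Rmult_minus_distr_l.
  apply @is_derive_minus; [|apply is_derive_fourier_part, Hu].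
  auto_derive.
  - exact (conj (ex_derive_bessel 2 _) (conj (ex_derive_bern_poly 1 _) (conj (ex_derive_bessel 1 _)
      (conj (ex_derive_bern_poly 0 _) (conj (ex_derive_bessel 0 _) I))))).
  - rewrite (Derive_bessel 2), (Derive_bessel 1), (Derive_bessel 0), (Derive_bern_poly 1), (Derive_bern_poly 0). fold (t - INR m).
    rewrite bern_poly_0E.
    unfold Rminus. field. lra.
Qed.

Lemma bern_poly_2_0 : bern_poly 2 0 = 1 / 12.
Proof. rewrite bern_poly_0, bernoulli_2. simpl. field. Qed.

Lemma euler_maclaurin_step (u : R) (N m : nat) :
  euler_maclaurin u N m (INR (S m)) - euler_maclaurin u N m (INR m) =
  (- u * bessel 2 (u * INR (S m)) - - u * bessel 2 (u * INR m)) / 12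
  - (bessel 1 (u * INR m) + bessel 1 (u * INR (S m))) / 2
  - (bessel 0 (u * INR (S m)) - bessel 0 (u * INR m)) / u
  - (fourier_part u N (INR (S m)) - fourier_part u N (INR m)).
Proof.
  unfold euler_maclaurin. rewrite (Rminus_diag_eq (INR m) (INR m)) by reflexivity.
  replace (INR (S m) - INR m) with 1 by (rewrite S_INR; ring).
  rewrite bern_poly_1, bern_poly_2_0, !bern_poly_1E by lia. unfold Rdiv. generalize (/ u); intros v. field.
Qed.

(** Euler-Maclaurin summation of [bessel 1 (u m)], with the periodic Bernoulli function replaced by a
    partial sum of its Fourier series; the error is uniform in [M]. *)
Lemma euler_maclaurin_bessel (u : R) : 0 < u -> exists C, forall N M,
  Rabs (Rsum (fun i => bessel 1 (u * INR (S i))) M -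
    ((- u * bessel 2 (u * INR M) + u / 2) / 12 - (1 - bessel 1 (u * INR M)) / 2
     - (bessel 0 (u * INR M) - 1) / u - fourier_part u N (INR M))) <= C / (INR N + 1).
Proof.
  intros Hu. set (K := 3 * (/ 1 ^ 0 + 1 * sqrt 1 / INR (fact (2 * 0 + 3)))).
  assert (HK : 0 < K).
  { unfold K. rewrite sqrt_1. assert (0 < / INR (fact (2 * 0 + 3))) by apply Rinv_0_lt_compat, INR_fact_lt_0.
    simpl (1 ^ 0). unfold Rdiv. lra. }
  exists (u * (2 * K)). intros N M.
  pose proof (pos_INR N) as HN. set (q := / (INR N + 1)). assert (Hq : 0 < q) by (apply Rinv_0_lt_compat; lra).
  set (g := fun t => q * u * (- (2 * K) / sqrt (1 + u * t))).
  assert (Hstep : forall m, Rabs (euler_maclaurin u N m (INR (S m)) - euler_maclaurin u N m (INR m)) <= g (INR (S m)) - g (INR m)).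
  { intros m. pose proof (pos_INR m) as Hm.
    apply (derive_compare (euler_maclaurin u N m) (fun t => u ^ 2 * bessel 3 (u * t) * bern_err 2 N (t - INR m))
      g (fun t => q * u ^ 2 * (K / ((1 + u * t) * sqrt (1 + u * t))))).
    - rewrite S_INR; lra.
    - intros; apply is_derive_euler_maclaurin, Hu.
    - intros t Ht. assert (Hut : 0 <= u * t) by (apply Rmult_le_pos; lra).
      assert (D := is_derive_inv_sqrt K 1 (u * t) Rlt_0_1 Hut).
      unfold g. replace (q * u ^ 2 * (K / ((1 + u * t) * sqrt (1 + u * t))))
        with (q * u * (u * (K / ((1 + u * t) * sqrt (1 + u * t))))) by ring.
      apply is_derive_scal.
      apply (is_derive_comp (fun t => - (2 * K) / sqrt (1 + t)) (fun t => u * t)); [exact D|].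
      auto_derive; [exact I|ring].
    - intros t Ht. rewrite S_INR in Ht. assert (Hut : 0 <= u * t) by (apply Rmult_le_pos; lra).
      assert (B1 := bessel_majorant 0 1 (u * t) Rlt_0_1 Hut). fold K in B1. simpl (2 * 0 + 3)%nat in B1.
      assert (B2 := bern_fourier 2 N (t - INR m) (le_n 2) ltac:(lra)).
      rewrite !Rabs_mult, (Rabs_pos_eq (u ^ 2)) by (apply pow_le; lra).
      replace (q * u ^ 2 * (K / ((1 + u * t) * sqrt (1 + u * t)))) with (u ^ 2 * (K / ((1 + u * t) * sqrt (1 + u * t))) * (1 / (INR N + 1)))
        by (unfold q; unfold Rdiv; ring).
      apply Rmult_le_compat; [|apply Rabs_pos| |exact B2].
      + apply Rmult_le_pos; [apply pow_le; lra|apply Rabs_pos].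
      + apply Rmult_le_compat_l; [apply pow_le; lra|exact B1]. }
  assert (Hsum : Rabs (Rsum (fun i => bessel 1 (u * INR (S i))) M -
    ((- u * bessel 2 (u * INR M) + u / 2) / 12 - (1 - bessel 1 (u * INR M)) / 2
     - (bessel 0 (u * INR M) - 1) / u - fourier_part u N (INR M))) <= g (INR M) - g (INR 0)).
  { induction M as [|M IH].
    - simpl INR. rewrite !Rmult_0_r, !bessel_0. cbn [Rsum].
      replace (fourier_part u N 0) with 0.
      + match goal with |- Rabs ?x <= _ => replace x with 0 by (simpl; field; lra) end. rewrite Rabs_R0. lra.
      + transitivity (Rsum (fun _ => 0) N); [symmetry; apply Rsum_0|]. apply Rsum_ext; intros k _.
        rewrite Rmult_0_r, bessel_cos_0. ring.
    - cbn [Rsum]. assert (HS := Hstep M). rewrite euler_maclaurin_step in HS.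
      rewrite <- Rabs_Ropp in HS.
      replace (g (INR (S M)) - g (INR 0)) with ((g (INR M) - g (INR 0)) + (g (INR (S M)) - g (INR M))) by ring.
      eapply Rle_trans; [|apply Rplus_le_compat; [exact IH|exact HS]].
      eapply Rle_trans; [|apply Rabs_triang]. right. f_equal. field. lra. }
  apply Rle_trans with (1 := Hsum).
  unfold g. simpl (INR 0). rewrite Rmult_0_r, Rplus_0_r, sqrt_1.
  pose proof (pos_INR M) as HM.
  assert (0 < / sqrt (1 + u * INR M)).
  { apply Rinv_0_lt_compat, sqrt_lt_R0. assert (0 <= u * INR M) by (apply Rmult_le_pos; lra). lra. }
  replace (u * (2 * K) / (INR N + 1)) with (q * u * (2 * K)) by (unfold q; field; lra).
  assert (0 < q * u * (2 * K)) by (apply Rmult_lt_0_compat; [apply Rmult_lt_0_compat|]; lra).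
  replace (q * u * (- (2 * K) / sqrt (1 + u * INR M)) - q * u * (- (2 * K) / 1))
    with (q * u * (2 * K) - q * u * (2 * K) * / sqrt (1 + u * INR M)) by (unfold Rdiv; field; apply Rgt_not_eq, sqrt_lt_R0; nra).
  assert (0 < q * u * (2 * K) * / sqrt (1 + u * INR M)) by (apply Rmult_lt_0_compat; assumption). lra.
Qed.

(** The constants [1/2] of [is_lim_bessel_cos_3] reassemble into the Fourier series of the second Bernoulli
    polynomial at [0]. *)
Lemma is_lim_fourier_part (u : R) (N : nat) : 0 < u ->
  is_lim_seq (fun M => fourier_part u N (INR M))
    (u / 2 * bern_trig 2 N 0 - 4 / u * Rsum (fun k => sin (u / (4 * PI) / INR (S k)) ^ 2) N).
Proof.
  intros Hu. unfold bern_trig. rewrite <- !Rsum_scal, <- Rsum_minus. unfold fourier_part.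
  pose proof PI_RGT_0.
  apply (is_lim_seq_Rsum (fun M k => 2 / (2 * PI * INR (S k)) ^ 2 * (u * bessel_cos 3 (2 * PI * INR (S k) / u) (u * INR M)))).
  intros k _. pose proof (INR_S_pos k). set (b := 2 * PI * INR (S k) / u).
  assert (Hb : 0 < b) by (unfold b; apply Rdiv_lt_0_compat; [apply Rmult_lt_0_compat|]; lra).
  replace (_ - _) with (2 / (2 * PI * INR (S k)) ^ 2 * (u * (1 / 2 - b ^ 2 * (1 - cos (/ b))))).
  - apply (is_lim_seq_scal_l _ (2 / (2 * PI * INR (S k)) ^ 2) (Finite _)). apply (is_lim_seq_scal_l _ u (Finite _)).
    apply is_lim_seq_scal_INR; [exact Hu|]. apply is_lim_bessel_cos_3, Hb.
  - simpl (INR 2). replace (2 * PI * INR (S k) * 0 - (1 + 1) * (PI / 2)) with (- PI) by field.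
    rewrite cos_neg, cos_PI.
    replace (/ b) with (2 * (u / (4 * PI) / INR (S k))) by (unfold b; field; lra).
    rewrite cos_2a_sin. unfold b. field. lra.
Qed.

(** Let first [M] and then [N] tend to infinity in [euler_maclaurin_bessel]. *)
Lemma is_series_bessel (u : R) : 0 < u ->
  is_series (fun i => bessel 1 (u * INR (S i))) (1 / u - 1 / 2 + 4 / u * f_sum (u / (4 * PI))).
Proof.
  intros Hu. apply is_series_Rsum. set (V := 1 / u - 1 / 2 + _).
  destruct (euler_maclaurin_bessel u Hu) as [C HC].
  set (RN := fun N => (0 + u / 2) / 12 - (1 - 0) / 2 - (0 - 1) / u
    - (u / 2 * bern_trig 2 N 0 - 4 / u * Rsum (fun k => sin (u / (4 * PI) / INR (S k)) ^ 2) N)).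
  assert (HRN : forall N, is_lim_seq (fun M => (- u * bessel 2 (u * INR M) + u / 2) / 12 - (1 - bessel 1 (u * INR M)) / 2
     - (bessel 0 (u * INR M) - 1) / u - fourier_part u N (INR M)) (RN N)).
  { intros N.
    assert (L : forall n, is_lim_seq (fun M => bessel n (u * INR M)) 0)
      by (intros n; apply is_lim_seq_scal_INR; [exact Hu|apply is_lim_bessel]).
    apply is_lim_seq_minus'; [|apply is_lim_fourier_part, Hu].
    apply is_lim_seq_minus'; [apply is_lim_seq_minus'|].
    - apply is_lim_seq_mult'; [|apply is_lim_seq_const]. apply is_lim_seq_plus'; [|apply is_lim_seq_const].
      replace 0 with (- u * 0) by ring. apply (is_lim_seq_scal_l _ (- u) (Finite 0)), L.
    - apply is_lim_seq_mult'; [|apply is_lim_seq_const]. apply is_lim_seq_minus'; [apply is_lim_seq_const|apply L].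
    - apply is_lim_seq_mult'; [|apply is_lim_seq_const]. apply is_lim_seq_minus'; [apply L|apply is_lim_seq_const]. }
  assert (HV : is_lim_seq RN V).
  { replace (Finite V) with (Finite ((0 + u / 2) / 12 - (1 - 0) / 2 - (0 - 1) / u - (u / 2 * (1 / 12) - 4 / u * f_sum (u / (4 * PI))))).
    2:{ f_equal. unfold V. field. lra. }
    apply is_lim_seq_minus'; [apply is_lim_seq_const|]. apply is_lim_seq_minus'.
    - apply (is_lim_seq_scal_l _ (u / 2) (Finite _)). apply is_lim_seq_bound_inv with 1. intros N.
      rewrite <- bern_poly_2_0, <- Rabs_Ropp, Ropp_minus_distr. apply (bern_fourier 2 N 0); [lia|lra].
    - apply (is_lim_seq_scal_l _ (4 / u) (Finite _)). apply is_series_Rsum, f_term_sum. }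
  apply is_lim_seq_eps. intros eps He.
  destruct (is_lim_seq_elim _ _ HV (eps / 3)) as [N1 HN1]; [lra|].
  destruct (is_lim_seq_elim _ _ (is_lim_seq_inv_S C) (eps / 3)) as [N2 HN2]; [lra|].
  set (N := Nat.max N1 N2). specialize (HN1 N ltac:(lia)). specialize (HN2 N ltac:(lia)).
  destruct (is_lim_seq_elim _ _ (HRN N) (eps / 3)) as [M0 HM0]; [lra|].
  exists M0. intros M HM. specialize (HM0 M HM). specialize (HC N M).
  rewrite Rminus_0_r in HN2. assert (HN3 := Rle_abs (C / (INR N + 1))).
  apply Rabs_le_between in HN1, HM0, HC. apply Rabs_le. lra.
Qed.

Lemma is_series_BesselJ1 (theta x : R) (n : nat) : 0 < theta < 1 -> 0 < x ->
  is_series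
    (fun i => BesselJ1 (4 * PI * sqrt (INR (S i) * (INR n + theta) * x)) / sqrt (INR (S i) * (INR n + theta)))
    (sqrt x * (- PI + 1 / (2 * Y_arg theta x n) + 2 * (f_sum (Y_arg theta x n) / Y_arg theta x n))).
Proof.
  intros Hth Hx. pose proof PI_RGT_0 as HPI. pose proof (pos_INR n) as Hn.
  set (Y := Y_arg theta x n).
  assert (HY : 0 < Y) by (unfold Y, Y_arg; apply Rmult_lt_0_compat; [apply Rmult_lt_0_compat|]; lra).
  assert (H := is_series_bessel (4 * PI * Y) ltac:(apply Rmult_lt_0_compat; lra)).
  replace (4 * PI * Y / (4 * PI)) with Y in H by (field; lra).
  apply (is_series_Rmult (2 * PI * sqrt x)) in H.
  replace (sqrt x * (- PI + 1 / (2 * Y) + 2 * (f_sum Y / Y)))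
    with (2 * PI * sqrt x * (1 / (4 * PI * Y) - 1 / 2 + 4 / (4 * PI * Y) * f_sum Y)) by (field; lra).
  eapply is_series_Rext; [|exact H]. intros i. cbv beta.
  pose proof (INR_S_pos i) as Hi. set (c := INR (S i) * (INR n + theta)).
  assert (Hc : 0 < c) by (unfold c; apply Rmult_lt_0_compat; lra).
  rewrite BesselJ1_bessel.
  replace ((4 * PI * sqrt (c * x)) ^ 2 / 4) with (4 * PI * Y * INR (S i)).
  2:{ rewrite Rpow_mult_distr, pow2_sqrt by nra. unfold Y, Y_arg, c. field. }
  rewrite sqrt_mult by lra. assert (0 < sqrt c) by (apply sqrt_lt_R0, Hc). field. lra.
Qed.

(** * The growth of f *)

(** First order Euler-Maclaurin; the right-hand side integrates the bound of [bessel_2_decay] for the derivative. *)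
Lemma bessel_trapezoid_step (u : R) (m : nat) : 1 <= u ->
  Rabs ((bessel 1 (u * INR (S m)) + bessel 1 (u * INR (S (S m)))) / 2
        + (bessel 0 (u * INR (S (S m))) - bessel 0 (u * INR (S m))) / u) <=
  8 * exp (- (ln (u * INR (S m)) / 8)) - 8 * exp (- (ln (u * INR (S (S m))) / 8)).
Proof.
  intros Hu. set (a := INR (S m)). assert (Ha : 1 <= a) by (unfold a; rewrite S_INR; pose proof (pos_INR m); lra).
  replace (INR (S (S m))) with (a + 1) by (unfold a; rewrite !S_INR; ring).
  set (h := fun t => bessel 1 (u * t) * (t - a - 1 / 2) + bessel 0 (u * t) / u).
  replace (_ + _) with (h (a + 1) - h a) by (unfold h; field; lra).
  replace (_ - _ * exp _) with (- 8 * exp (- (ln (u * (a + 1)) / 8)) - - 8 * exp (- (ln (u * a) / 8))) by ring.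
  apply (derive_compare h (fun t => - u * bessel 2 (u * t) * (t - a - 1 / 2))
    (fun t => - 8 * exp (- (ln (u * t) / 8))) (fun t => exp (- (ln (u * t) / 8)) / t)); [lra| | |].
  - intros t Ht. unfold h. auto_derive.
    + exact (conj (ex_derive_bessel 1 _) (conj (ex_derive_bessel 0 _) I)).
    + rewrite (Derive_bessel 1), (Derive_bessel 0). field. lra.
  - intros t Ht. auto_derive; [apply Rmult_lt_0_compat; lra|].
    change (ln (u * t) * / 8) with (ln (u * t) / 8). field. lra.
  - intros t Ht. assert (B := bessel_2_decay (u * t) ltac:(nra)).
    rewrite !Rabs_mult, Rabs_Ropp, (Rabs_pos_eq u) by lra.
    assert (Hc : Rabs (t - a - 1 / 2) <= 1 / 2) by (apply Rabs_le; lra).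
    apply Rle_trans with (u * (2 * exp (- (ln (u * t) / 8)) / (u * t)) * (1 / 2)).
    + apply Rmult_le_compat; [apply Rmult_le_pos; [lra|apply Rabs_pos]|apply Rabs_pos| |exact Hc].
      apply Rmult_le_compat_l; lra.
    + right. field. split; lra.
Qed.

Lemma bessel_series_bound (u V : R) : 1 <= u -> is_series (fun i => bessel 1 (u * INR (S i))) V ->
  Rabs (V - bessel 1 u / 2 - bessel 0 u / u) <= 8 * exp (- (ln u / 8)).
Proof.
  intros Hu HS. apply is_series_Rsum in HS. apply is_lim_seq_incr_1 in HS.
  set (T := Rsum (fun i => bessel 1 (u * INR (S i)))) in *.
  assert (HM : forall M, Rabs (T (S M) - (bessel 1 u + bessel 1 (u * INR (S M))) / 2
      + (bessel 0 (u * INR (S M)) - bessel 0 u) / u)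
      <= 8 * exp (- (ln u / 8)) - 8 * exp (- (ln (u * INR (S M)) / 8))).
  { induction M as [|M IH].
    - unfold T. cbn [Rsum]. rewrite INR_1, Rmult_1_r.
      match goal with |- Rabs ?x <= _ => replace x with 0 by (field; lra) end. rewrite Rabs_R0. lra.
    - assert (B := bessel_trapezoid_step u M Hu).
      replace (T (S (S M))) with (T (S M) + bessel 1 (u * INR (S (S M)))) by reflexivity.
      match type of B with Rabs ?b <= _ => match type of IH with Rabs ?a <= _ => match goal with |- Rabs ?c <= _ =>
        replace c with (a + b) by (field; lra) end end end.
      eapply Rle_trans; [apply Rabs_triang|]. lra. }
  apply (is_lim_seq_Rabs_le (fun M => T (S M) - (bessel 1 u + bessel 1 (u * INR (S M))) / 2
      + (bessel 0 (u * INR (S M)) - bessel 0 u) / u)).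
  - replace (V - bessel 1 u / 2 - bessel 0 u / u) with (V - (bessel 1 u + 0) / 2 + (0 - bessel 0 u) / u) by (field; lra).
    assert (L : forall n, is_lim_seq (fun M => bessel n (u * INR (S M))) 0).
    { intros n. apply (is_lim_seq_incr_1 (fun M => bessel n (u * INR M))).
      apply is_lim_seq_scal_INR; [lra|apply is_lim_bessel]. }
    apply is_lim_seq_plus'.
    + apply is_lim_seq_minus'; [exact HS|].
      apply is_lim_seq_mult'; [|apply is_lim_seq_const]. apply is_lim_seq_plus'; [apply is_lim_seq_const|apply L].
    + apply is_lim_seq_mult'; [|apply is_lim_seq_const]. apply is_lim_seq_minus'; [apply L|apply is_lim_seq_const].
  - intros M. apply Rle_trans with (1 := HM M).
    pose proof (exp_pos (- (ln (u * INR (S M)) / 8))). lra.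
Qed.

(** By [is_series_bessel], [f(y) / (pi y)] differs from [1/2 - 1/u] by the Bessel series at [u = 4 pi y], which
    is small by comparison with its integral. *)
Lemma is_lim_f_sum : is_lim (fun y => f_sum y / y) p_infty (PI / 2).
Proof.
  pose proof PI_RGT_0 as HPI.
  set (g := fun u => 1 / u - 1 / 2 + 4 / u * f_sum (u / (4 * PI))).
  assert (Hg : is_lim g p_infty 0).
  { assert (Hb : is_lim (fun u => Rabs (bessel 1 u) * / 2 + Rabs (bessel 0 u) + 8 * exp (- (ln u * / 8))) p_infty (Rabs 0 * / 2 + Rabs 0 + 8 * 0)).
    { apply is_lim_plus'; [apply is_lim_plus'|].
      - apply (is_lim_scal_r (fun u => Rabs (bessel 1 u)) (/ 2) p_infty (Rabs 0)).
        apply (is_lim_Rabs _ _ 0), is_lim_bessel.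
      - apply (is_lim_Rabs _ _ 0), is_lim_bessel.
      - apply (is_lim_scal_l _ 8 p_infty 0).
        apply (is_lim_comp exp (fun u => - (ln u * / 8)) p_infty 0 m_infty); [apply is_lim_exp_m| |exists 0; discriminate].
        replace m_infty with (Rbar_opp p_infty) by reflexivity. apply is_lim_opp.
        replace p_infty with (Rbar_mult p_infty (/ 8)) at 2.
        + apply is_lim_scal_r, is_lim_ln_p.
        + simpl. destruct (Rle_dec 0 (/ 8)) as [H|H]; [|lra].
          destruct (Rle_lt_or_eq_dec 0 (/ 8) H); [reflexivity|lra]. }
    rewrite Rabs_R0 in Hb. replace (0 * / 2 + 0 + 8 * 0) with 0 in Hb by ring.
    assert (Hle : forall u, 1 < u -> Rabs (g u) <= Rabs (bessel 1 u) * / 2 + Rabs (bessel 0 u) + 8 * exp (- (ln u * / 8))).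
    { intros u Hu.
      assert (B := bessel_series_bound u (g u) ltac:(lra) (is_series_bessel u ltac:(lra))).
      replace (g u) with ((g u - bessel 1 u / 2 - bessel 0 u / u) + (bessel 1 u / 2 + bessel 0 u / u)) by ring.
      eapply Rle_trans; [apply Rabs_triang|]. eapply Rle_trans; [apply Rplus_le_compat; [exact B|apply Rabs_triang]|].
      unfold Rdiv. rewrite !Rabs_mult, (Rabs_pos_eq (/ 2)), (Rabs_pos_eq (/ u)) by (try left; try apply Rinv_0_lt_compat; lra).
      assert (Rabs (bessel 0 u) * / u <= Rabs (bessel 0 u)); [|lra].
      rewrite <- (Rmult_1_r (Rabs (bessel 0 u))) at 2. apply Rmult_le_compat_l; [apply Rabs_pos|].
      rewrite <- Rinv_1. apply Rinv_le_contravar; lra. }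
    apply (is_lim_le_le_loc (fun u => - (Rabs (bessel 1 u) * / 2 + Rabs (bessel 0 u) + 8 * exp (- (ln u * / 8))))
      (fun u => Rabs (bessel 1 u) * / 2 + Rabs (bessel 0 u) + 8 * exp (- (ln u * / 8)))).
    - exists 1. intros u Hu. apply Rabs_le_between, Hle, Hu.
    - replace (Finite 0) with (Rbar_opp 0) by (simpl; f_equal; ring). apply is_lim_opp, Hb.
    - exact Hb. }
  apply is_lim_ext_loc with (fun y => PI * (g (4 * PI * y) - / (4 * PI) * / y + 1 / 2)).
  { exists 0. intros y Hy. unfold g. replace (4 * PI * y / (4 * PI)) with y by (field; lra). field. lra. }
  replace (Finite (PI / 2)) with (Rbar_mult PI (0 - / (4 * PI) * 0 + 1 / 2)) by (simpl; f_equal; field; lra).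
  apply is_lim_scal_l. apply is_lim_plus'; [|apply is_lim_const]. apply is_lim_minus'.
  - apply (is_lim_comp g (fun y => 4 * PI * y) p_infty 0 p_infty); [exact Hg| |exists 0; discriminate].
    replace p_infty with (Rbar_mult (4 * PI) p_infty) at 2.
    + apply is_lim_scal_l, is_lim_id.
    + simpl. destruct (Rle_dec 0 (4 * PI)) as [H|H]; [|lra].
      destruct (Rle_lt_or_eq_dec 0 (4 * PI) H); [reflexivity|lra].
  - apply (is_lim_scal_l _ (/ (4 * PI)) p_infty 0).
    replace (Finite 0) with (Rbar_inv p_infty) by reflexivity.
    apply is_lim_inv; [apply is_lim_id|discriminate].
Qed.

(** * The square wave and its partial sums *)

(** The Dirichlet character modulo 4. *)
Definition chi4 (n : nat) : R :=
  match (n mod 4)%nat with 1%nat => 1 | 3%nat => -1 | _ => 0 end.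

Lemma chi4_add4 (n r : nat) : chi4 (4 * n + r) = chi4 r.
Proof.
  unfold chi4. replace ((4 * n + r) mod 4)%nat with (r mod 4)%nat; [reflexivity|].
  rewrite (Nat.mul_comm 4), Nat.add_comm, Nat.Div0.mod_add. reflexivity.
Qed.

Lemma Rsum_by_4 (g : nat -> R) (N : nat) :
  Rsum g (4 * N) = Rsum (fun n => g (4 * n)%nat + g (4 * n + 1)%nat + g (4 * n + 2)%nat + g (4 * n + 3)%nat) N.
Proof.
  induction N as [|N IH]; [reflexivity|].
  replace (4 * S N)%nat with (4 * N + 4)%nat by lia. rewrite Rsum_add. cbn [Rsum]. rewrite IH.
  rewrite Nat.add_0_r. ring.
Qed.

Lemma Rsum_chi4 (g : nat -> R) (N : nat) :
  Rsum (fun k => chi4 (S k) * g (S k)) (4 * N) = Rsum (fun n => g (4 * n + 1)%nat - g (4 * n + 3)%nat) N.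
Proof.
  rewrite Rsum_by_4. apply Rsum_ext; intros n _.
  replace (S (4 * n)) with (4 * n + 1)%nat by lia. replace (S (4 * n + 1)) with (4 * n + 2)%nat by lia.
  replace (S (4 * n + 2)) with (4 * n + 3)%nat by lia. replace (S (4 * n + 3)) with (4 * n + 4)%nat by lia.
  rewrite !chi4_add4. unfold chi4; simpl. ring.
Qed.

Lemma INR_4 (n r : nat) : INR (4 * n + r) = 4 * INR n + INR r.
Proof. rewrite plus_INR, mult_INR. simpl (INR 4). ring. Qed.

Lemma sin_half_PI (k : nat) : sin (INR k * (PI / 2)) = chi4 k.
Proof.
  assert (E : (k = 4 * (k / 4) + k mod 4)%nat) by (apply Nat.div_mod; lia).
  assert (H := Nat.mod_upper_bound k 4 ltac:(lia)).
  rewrite E, chi4_add4, INR_4. revert H; generalize (k mod 4)%nat as r; intros r Hr.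
  replace ((4 * INR (k / 4) + INR r) * (PI / 2)) with (INR r * (PI / 2) + INR (k / 4) * (2 * PI)) by field.
  rewrite sin_period_nat. unfold chi4.
  destruct r as [|[|[|[|r]]]]; [| | | |lia]; simpl.
  - rewrite Rmult_0_l. apply sin_0.
  - rewrite Rmult_1_l. apply sin_PI2.
  - replace ((1 + 1) * (PI / 2)) with PI by field. apply sin_PI.
  - replace ((1 + 1 + 1) * (PI / 2)) with (3 * (PI / 2)) by ring. apply sin_3PI2.
Qed.

(** Fourier partial sum of [PI / 2] times the sum of [chi4] up to [v]: a square wave of period 4, shifted so
    that it vanishes near [0]. *)
Definition wave (N : nat) (v : R) : R :=
  Rsum (fun k => chi4 (S k) * ((1 - cos (INR (S k) * (PI * v / 2))) / INR (S k))) (4 * N).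

(** [chi4 k = sin (k pi / 2)] and the product formula for [cos a * sin b]. *)
Lemma wave_sawtooth (N : nat) (v : R) :
  wave N v = PI * sawtooth (4 * N) (1 / 4) - PI / 2 * (sawtooth (4 * N) ((v + 1) / 4) - sawtooth (4 * N) ((v + 3) / 4)).
Proof.
  replace ((v + 3) / 4) with ((v - 1) / 4 + 1) by field. rewrite sawtooth_period.
  unfold wave, sawtooth. rewrite <- Rsum_minus, <- !Rsum_scal, <- Rsum_minus.
  apply Rsum_ext; intros k _. rewrite <- sin_half_PI. pose proof (INR_S_pos k). pose proof PI_RGT_0.
  replace (2 * PI * INR (S k) * (1 / 4)) with (INR (S k) * (PI / 2)) by field.
  replace (2 * PI * INR (S k) * ((v + 1) / 4)) with (INR (S k) * (PI * v / 2) + INR (S k) * (PI / 2)) by field.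
  replace (2 * PI * INR (S k) * ((v - 1) / 4)) with (INR (S k) * (PI * v / 2) - INR (S k) * (PI / 2)) by field.
  rewrite sin_plus, sin_minus. field. split; lra.
Qed.

(** Weight of [a] in a sum over [a <= t] whose last term is halved. *)
Definition half_weight (a t : R) : R :=
  if Rlt_dec a t then 1 else if Req_EM_T a t then 1 / 2 else 0.

Lemma half_weight_lt (a t : R) : a < t -> half_weight a t = 1.
Proof. intros H; unfold half_weight; destruct (Rlt_dec a t); [reflexivity|lra]. Qed.

Lemma half_weight_eq (a t : R) : a = t -> half_weight a t = 1 / 2.
Proof.
  intros H; unfold half_weight; destruct (Rlt_dec a t); [lra|].
  destruct (Req_EM_T a t); [reflexivity|lra].
Qed.

Lemma half_weight_gt (a t : R) : t < a -> half_weight a t = 0.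
Proof.
  intros H; unfold half_weight; destruct (Rlt_dec a t); [lra|].
  destruct (Req_EM_T a t); [lra|reflexivity].
Qed.

Lemma half_weight_scal (c a b t : R) : 0 < c -> half_weight a t = half_weight (c * a + b) (c * t + b).
Proof.
  intros Hc. destruct (Rtotal_order a t) as [H|[H|H]].
  - rewrite !half_weight_lt; [reflexivity|nra|exact H].
  - rewrite !half_weight_eq; [reflexivity|subst; reflexivity|exact H].
  - rewrite !half_weight_gt; [reflexivity|nra|exact H].
Qed.

(** By periodicity from the interval [(0, 1]]; the halved weights appear at the integers, where the Fourier
    series takes the mean value of the jump. *)
Lemma is_lim_sawtooth_pos (L : nat) (t : R) : 0 < t <= INR L ->
  is_lim_seq (fun N => sawtooth N t) (1 / 2 - t + Rsum (fun n => half_weight (INR (S n)) t) L).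
Proof.
  revert t. induction L as [|L IH]; intros t Ht; [simpl in Ht; lra|].
  destruct (Rle_dec t 1) as [H1|H1].
  - assert (E : Rsum (fun n => half_weight (INR (S n)) t) (S L) = half_weight 1 t).
    { rewrite Rsum_shift, INR_1. replace (Rsum _ L) with 0; [ring|].
      transitivity (Rsum (fun _ => 0) L); [symmetry; apply Rsum_0|]. apply Rsum_ext; intros i _.
      rewrite half_weight_gt; [reflexivity|]. rewrite !S_INR. pose proof (pos_INR i); lra. }
    rewrite E. destruct (Req_dec t 1) as [->|H2].
    + rewrite half_weight_eq by reflexivity. replace (1 / 2 - 1 + 1 / 2) with 0 by field.
      apply is_lim_seq_ext with (fun _ => 0); [|apply is_lim_seq_const].
      intros N. replace 1 with (0 + 1) by ring. rewrite sawtooth_period.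
      assert (H := sawtooth_opp N 0). rewrite Ropp_0 in H. lra.
    + rewrite half_weight_gt, Rplus_0_r by lra. apply is_lim_sawtooth; lra.
  - replace (1 / 2 - t + Rsum (fun n => half_weight (INR (S n)) t) (S L))
      with (1 / 2 - (t - 1) + Rsum (fun n => half_weight (INR (S n)) (t - 1)) L).
    + apply is_lim_seq_ext with (fun N => sawtooth N (t - 1)).
      * intros N. rewrite <- sawtooth_period. f_equal; ring.
      * apply IH. rewrite S_INR in Ht. lra.
    + rewrite Rsum_shift, INR_1, half_weight_lt by lra.
      rewrite (Rsum_ext (fun i => half_weight (INR (S (S i))) t) (fun i => half_weight (INR (S i)) (t - 1))); [ring|].
      intros i _. rewrite (half_weight_scal 1 (INR (S i)) 1 (t - 1)) by lra. f_equal; [|ring].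
      rewrite (S_INR (S i)). ring.
Qed.

Lemma is_lim_wave (L : nat) (v : R) : 0 < v -> v + 3 <= 4 * INR L ->
  is_lim_seq (fun N => wave N v) (PI / 2 * Rsum (fun k => chi4 (S k) * half_weight (INR (S k)) v) (4 * L)).
Proof.
  intros Hv HL.
  assert (H4 : forall t l, is_lim_seq (fun N => sawtooth N t) l -> is_lim_seq (fun N => sawtooth (4 * N) t) l).
  { intros t l H. apply (is_lim_seq_subseq (fun N => sawtooth N t) l (fun N => (4 * N)%nat)); [|exact H].
    apply eventually_subseq. intros n; lia. }
  apply is_lim_seq_ext with (1 := fun N => eq_sym (wave_sawtooth N v)).
  rewrite (Rsum_chi4 (fun k => half_weight (INR k) v)).
  replace (PI / 2 * _) with (PI * (1 / 2 - 1 / 4) - PI / 2 *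
    ((1 / 2 - (v + 1) / 4 + Rsum (fun n => half_weight (INR (S n)) ((v + 1) / 4)) L)
     - (1 / 2 - (v + 3) / 4 + Rsum (fun n => half_weight (INR (S n)) ((v + 3) / 4)) L))).
  - apply is_lim_seq_minus'.
    + apply (is_lim_seq_scal_l _ PI (Finite _)), H4, is_lim_sawtooth; lra.
    + apply (is_lim_seq_scal_l _ (PI / 2) (Finite _)).
      apply is_lim_seq_minus'; apply H4, is_lim_sawtooth_pos; lra.
  - rewrite Rsum_minus.
    rewrite (Rsum_ext (fun n => half_weight (INR (S n)) ((v + 1) / 4)) (fun n => half_weight (INR (4 * n + 3)) v)).
    2:{ intros n _. rewrite (half_weight_scal 4 _ (-1) ((v + 1) / 4)) by lra. f_equal; [|field].
        rewrite INR_4, (S_INR n). simpl (INR 3). ring. }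
    rewrite (Rsum_ext (fun n => half_weight (INR (S n)) ((v + 3) / 4)) (fun n => half_weight (INR (4 * n + 1)) v)).
    2:{ intros n _. rewrite (half_weight_scal 4 _ (-3) ((v + 3) / 4)) by lra. f_equal; [|field].
        rewrite INR_4, (S_INR n), INR_1. ring. }
    field.
Qed.

Definition wave_deriv (N : nat) (v : R) : R :=
  PI / 2 * Rsum (fun k => chi4 (S k) * sin (INR (S k) * (PI * v / 2))) (4 * N).

Lemma is_derive_wave (N : nat) (v : R) : is_derive (wave N) v (wave_deriv N v).
Proof.
  unfold wave_deriv. rewrite <- Rsum_scal.
  apply (is_derive_Rsum (fun k v => chi4 (S k) * ((1 - cos (INR (S k) * (PI * v / 2))) / INR (S k)))
    (fun k v => PI / 2 * (chi4 (S k) * sin (INR (S k) * (PI * v / 2))))).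
  intros k _. pose proof (INR_S_pos k) as H. revert H; generalize (INR (S k)); intros m Hm.
  auto_derive; [exact I|]. change (PI * v * / 2) with (PI * v / 2). field. lra.
Qed.

(** The sum of sines telescopes after multiplication by the cosine. *)
Lemma wave_deriv_closed (N : nat) (v : R) :
  cos (PI * v / 2) * wave_deriv N v = - (PI / 4) * sin (2 * PI * INR N * v).
Proof.
  unfold wave_deriv. rewrite (Rsum_chi4 (fun k => sin (INR k * (PI * v / 2)))).
  set (p := PI * v / 2).
  assert (H : cos p * Rsum (fun n => sin (INR (4 * n + 1) * p) - sin (INR (4 * n + 3) * p)) N = - / 2 * sin (4 * INR N * p)).
  { induction N as [|N IH].
    - simpl. rewrite Rmult_0_r, Rmult_0_r, Rmult_0_l, sin_0. ring.
    - cbn [Rsum]. rewrite Rmult_plus_distr_l, IH, !INR_4, (S_INR N), INR_1. simpl (INR 3).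
      set (q := 4 * INR N * p + 2 * p).
      replace ((4 * INR N + 1) * p) with (q - p) by (unfold q; ring).
      replace ((4 * INR N + (1 + 1 + 1)) * p) with (q + p) by (unfold q; ring).
      replace (4 * INR N * p) with (q - 2 * p) by (unfold q; ring).
      replace (4 * (INR N + 1) * p) with (q + 2 * p) by (unfold q; ring).
      rewrite (sin_plus q (2 * p)), (sin_minus q (2 * p)), sin_plus, sin_minus, sin_2a. field. }
  replace (2 * PI * INR N * v) with (4 * INR N * p) by (unfold p; field).
  replace (cos p * (PI / 2 * _)) with (PI / 2 * (cos p * Rsum (fun n => sin (INR (4 * n + 1) * p) - sin (INR (4 * n + 3) * p)) N)) by ring.
  rewrite H. field.
Qed.

Lemma wave_0 (N : nat) : wave N 0 = 0.
Proof.
  unfold wave. transitivity (Rsum (fun _ => 0) (4 * N)); [|apply Rsum_0].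
  apply Rsum_ext; intros k _. replace (INR (S k) * (PI * 0 / 2)) with 0 by field. rewrite cos_0. unfold Rdiv; ring.
Qed.

(** Near [0] the partial sums are of size [1 / N] although their limit vanishes there.  Summed over all
    [v = x / a] this defect produces the main term of the circle problem. *)
Lemma wave_near_0 (N : nat) (v : R) : 0 <= v <= 1 / 2 ->
  Rabs (wave (S N) v + sin (PI * INR (S N) * v) ^ 2 / (4 * INR (S N))) <= v ^ 2 / INR (S N).
Proof.
  intros Hv. pose proof PI_RGT_0 as HPI. set (M := INR (S N)). assert (HM : 0 < M) by apply INR_S_pos.
  assert (Hcos : forall t, 0 <= t <= 1 / 2 -> 1 / 2 <= cos (PI * t / 2)).
  { intros t Ht. rewrite <- cos_PI3. apply cos_decr_1; lra || nra. }
  set (D := fun v => wave (S N) v + sin (PI * M * v) ^ 2 / (4 * M)).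
  (* one integration by parts against the increasing function [1 / cos - 1] *)
  set (K := fun v => D v - cos (2 * PI * M * v) * (/ cos (PI * v / 2) - 1) / (8 * M)).
  assert (HK : Rabs (K v - K 0) <= (/ cos (PI * v / 2) - 1) / (8 * M) - (/ cos (PI * 0 / 2) - 1) / (8 * M)).
  { apply (derive_compare K (fun v => - cos (2 * PI * M * v) * (PI / 2 * sin (PI * v / 2) / cos (PI * v / 2) ^ 2 / (8 * M)))
      (fun v => (/ cos (PI * v / 2) - 1) / (8 * M)) (fun v => PI / 2 * sin (PI * v / 2) / cos (PI * v / 2) ^ 2 / (8 * M))); [lra| | |].
    - intros t Ht. specialize (Hcos t ltac:(lra)).
      assert (Dw := is_derive_wave (S N) t). assert (Cl := wave_deriv_closed (S N) t). fold M in Cl.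
      unfold K, D. auto_derive.
      + repeat apply conj; try exact I; [eexists; exact Dw|]. change (PI * t * / 2) with (PI * t / 2). lra.
      + replace (Derive _ _) with (wave_deriv (S N) t) by (symmetry; apply is_derive_unique, Dw).
        change (PI * t * / 2) with (PI * t / 2).
        replace (wave_deriv (S N) t) with (- (PI / 4) * sin (2 * PI * M * t) / cos (PI * t / 2)) by (rewrite <- Cl; field; lra).
        replace (2 * PI * M * t) with (2 * (PI * M * t)) by ring. rewrite sin_2a, cos_2a_sin. field. split; lra.
    - intros t Ht. specialize (Hcos t ltac:(lra)). auto_derive; change (PI * t * / 2) with (PI * t / 2); [lra|].
      field. split; lra.
    - intros t Ht. specialize (Hcos t ltac:(lra)).
      assert (Hp : 0 <= PI / 2 * sin (PI * t / 2) / cos (PI * t / 2) ^ 2 / (8 * M)).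
      { apply Rdiv_le_0_compat; [|lra]. apply Rdiv_le_0_compat; [|apply pow_lt; lra].
        apply Rmult_le_pos; [lra|]. apply sin_ge_0; nra. }
      rewrite Rabs_mult, Rabs_Ropp, (Rabs_pos_eq (_ / _)) by exact Hp.
      match goal with |- _ * ?e <= _ => rewrite <- (Rmult_1_l e) at 2 end. apply Rmult_le_compat_r; [exact Hp|]. apply Rabs_le, COS_bound. }
  assert (K0 : K 0 = 0).
  { unfold K, D. rewrite wave_0. replace (PI * 0 / 2) with 0 by field. rewrite !Rmult_0_r, sin_0, cos_0. field. lra. }
  rewrite K0, Rminus_0_r in HK. replace (PI * 0 / 2) with 0 in HK by field.
  rewrite cos_0 in HK. replace ((/ 1 - 1) / (8 * M)) with 0 in HK by (field; lra). rewrite Rminus_0_r in HK.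
  specialize (Hcos v Hv). set (c := cos (PI * v / 2)) in *.
  assert (Hc1 : c <= 1) by apply COS_bound.
  assert (Hsec : 0 <= / c - 1 <= 4 * v ^ 2).
  { split.
    - assert (1 <= / c); [|lra]. rewrite <- Rinv_1. apply Rinv_le_contravar; lra.
    - assert (E : 1 - c = 2 * sin (PI * v / 4) ^ 2).
      { unfold c. replace (PI * v / 2) with (2 * (PI * v / 4)) by field. rewrite cos_2a_sin. ring. }
      assert (Hs : 0 <= sin (PI * v / 4) <= v).
      { split; [apply sin_ge_0; nra|]. apply Rle_trans with (PI * v / 4).
        - destruct (Req_dec v 0) as [->|Hv0]; [replace (PI * 0 / 4) with 0 by field; rewrite sin_0; lra|].
          left; apply sin_lt_x. nra.
        - pose proof PI_4. nra. }
      assert (Hsq : sin (PI * v / 4) ^ 2 <= v ^ 2) by (apply pow_incr; exact Hs).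
      apply Rmult_le_reg_l with c; [lra|]. replace (c * (/ c - 1)) with (1 - c) by (field; lra).
      rewrite E. pose proof (pow2_ge_0 v). nra. }
  change (Rabs (D v) <= v ^ 2 / M).
  replace (D v) with (K v + cos (2 * PI * M * v) * (/ c - 1) / (8 * M)) by (unfold K; fold c; ring).
  eapply Rle_trans; [apply Rabs_triang|].
  assert (Hq : 0 <= (/ c - 1) / (8 * M)) by (apply Rdiv_le_0_compat; lra).
  assert (H2 : Rabs (cos (2 * PI * M * v) * (/ c - 1) / (8 * M)) <= (/ c - 1) / (8 * M)).
  { unfold Rdiv. rewrite Rmult_assoc, Rabs_mult, (Rabs_pos_eq (_ * _)) by exact Hq.
    match goal with |- _ * ?e <= _ => rewrite <- (Rmult_1_l e) at 2 end. apply Rmult_le_compat_r; [exact Hq|]. apply Rabs_le, COS_bound. }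
  replace (v ^ 2 / M) with (4 * v ^ 2 / (8 * M) + 4 * v ^ 2 / (8 * M)) by (field; lra).
  assert ((/ c - 1) / (8 * M) <= 4 * v ^ 2 / (8 * M)).
  { unfold Rdiv. apply Rmult_le_compat_r; [left; apply Rinv_0_lt_compat; lra|lra]. }
  lra.
Qed.

(** * Jacobi's two-square theorem *)

Lemma prime_mathcomp (p : nat) : prime (Z.of_nat p) -> is_true (prime.prime p).
Proof.
  intros Hp. pose proof (prime_ge_2 _ Hp) as H2.
  apply (@ssrbool.introT _ _ (prime.primeP (p := p))). split.
  - apply (@ssrbool.introT _ _ (ssrnat.ltP)). lia.
  - intros d Hd. apply (@ssrbool.elimT _ _ (div.dvdnP)) in Hd. destruct Hd as [k Hk].
    assert (D : (Z.of_nat d | Z.of_nat p)%Z) by (exists (Z.of_nat k); rewrite Hk; unfold ssrnat.muln; lia).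
    destruct (prime_divisors _ Hp _ D) as [H|[H|[H|H]]]; try lia; simpl.
    + replace d with 1%nat by lia. reflexivity.
    + replace d with p by lia. apply (@ssrbool.introT _ _ ssrbool.orP). right. apply eqtype.eqxx.
Qed.

Lemma factorial_fact (n : nat) : ssrnat.factorial n = fact n.
Proof. induction n as [|n IH]; [reflexivity|]. rewrite ssrnat.factS, IH. reflexivity. Qed.

Open Scope Z_scope.

Lemma wilson (p : nat) : prime (Z.of_nat p) -> (Z.of_nat p | Z.of_nat (fact (p - 1)) + 1).
Proof.
  intros Hp. assert (Hp' := prime_mathcomp p Hp). pose proof (prime_ge_2 _ Hp).
  rewrite binomial.Wilson in Hp' by (apply (@ssrbool.introT _ _ (ssrnat.ltP)); lia).
  apply (@ssrbool.elimT _ _ (div.dvdnP)) in Hp'. destruct Hp' as [k Hk].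
  rewrite factorial_fact in Hk. exists (Z.of_nat k).
  replace (p - 1)%nat with (Nat.pred p) by lia. unfold ssrnat.muln in Hk. lia.
Qed.

(** Pairs the factor [p - j] of [(p - 1)!] with [- j] modulo [p]; two factors at a time, to avoid signs. *)
Lemma fact_reflect (p i : nat) : (2 * i <= p - 1)%nat -> exists z,
  Z.of_nat (fact (p - 1)) = Z.of_nat (fact (p - 1 - 2 * i)) * (Z.of_nat (fact (2 * i)) + Z.of_nat p * z).
Proof.
  induction i as [|i IH]; intros Hi.
  - exists 0. replace (p - 1 - 2 * 0)%nat with (p - 1)%nat by lia. simpl (fact (2 * 0)). lia.
  - destruct IH as [z Hz]; [lia|]. rewrite Hz.
    replace (p - 1 - 2 * i)%nat with (S (S (p - 1 - 2 * S i))) by lia.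
    replace (fact (2 * S i)) with (fact (S (S (2 * i)))) by (f_equal; lia).
    set (m := (p - 1 - 2 * S i)%nat).
    change (fact (S (S m))) with (S (S m) * (S m * fact m))%nat.
    change (fact (S (S (2 * i)))) with (S (S (2 * i)) * (S (2 * i) * fact (2 * i)))%nat.
    assert (E1 : Z.of_nat (S (S m)) = Z.of_nat p - Z.of_nat (S (2 * i))) by (unfold m; lia).
    assert (E2 : Z.of_nat (S m) = Z.of_nat p - Z.of_nat (S (S (2 * i)))) by (unfold m; lia).
    rewrite !Nat2Z.inj_mul, E1, E2.
    set (P := Z.of_nat p). set (F := Z.of_nat (fact (2 * i))). set (u := Z.of_nat (S (2 * i))). set (v := Z.of_nat (S (S (2 * i)))).
    exists ((P - u) * (P - v) * z + (P - u - v) * F). ring.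
Qed.

Lemma sqrt_minus_one (p : nat) : prime (Z.of_nat p) -> (p mod 4 = 1)%nat ->
  exists q, (Z.of_nat p | q * q + 1).
Proof.
  intros Hp H4. assert (W := wilson p Hp).
  assert (E := Nat.div_mod p 4 ltac:(lia)). set (k := (p / 4)%nat) in *.
  destruct (fact_reflect p k ltac:(lia)) as [z Hz].
  replace (p - 1 - 2 * k)%nat with (2 * k)%nat in Hz by lia.
  exists (Z.of_nat (fact (2 * k))). set (q := Z.of_nat (fact (2 * k))) in *.
  replace (q * q + 1) with ((Z.of_nat (fact (p - 1)) + 1) - Z.of_nat p * (q * z)) by (rewrite Hz; ring).
  apply Z.divide_sub_r; [exact W|apply Z.divide_factor_l].
Qed.

Lemma centered_residue (a k : Z) : 0 < k -> exists a' s, a = a' + k * s /\ - k <= 2 * a' <= k.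
Proof.
  intros Hk. assert (D := Z.div_mod a k ltac:(lia)). assert (M := Z.mod_pos_bound a k Hk).
  destruct (Z_le_gt_dec (2 * (a mod k)) k).
  - exists (a mod k), (a / k). lia.
  - exists (a mod k - k), (a / k + 1). lia.
Qed.

(** Fermat's descent: multiply by the centered residues of [a] and [b] modulo [k], then divide by [k^2]. *)
Lemma two_squares_descent (P : Z) : prime P -> forall k, 0 < k < P ->
  forall a b, k * P = a * a + b * b -> exists c d, P = c * c + d * d.
Proof.
  intros HP k. induction k as [k IH] using (well_founded_induction (Z.lt_wf 0)).
  intros Hk a b E. destruct (Z.eq_dec k 1) as [->|Hk1]; [exists a, b; lia|].
  destruct (centered_residue a k ltac:(lia)) as [a' [s [Ea Ba]]].
  destruct (centered_residue b k ltac:(lia)) as [b' [t [Eb Bb]]].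
  set (l := P - 2 * (a' * s + b' * t) - k * (s * s + t * t)).
  assert (El : k * l = a' * a' + b' * b') by (unfold l; rewrite Ea, Eb in E; lia).
  assert (Hl0 : 0 <= l) by nia.
  assert (Hlk : l < k) by nia.
  destruct (Z.eq_dec l 0) as [Hl|Hl].
  - exfalso. assert (a' = 0) by nia. assert (b' = 0) by nia. subst a' b'.
    assert (D : (k | P)) by (exists (s * s + t * t); unfold l in Hl; lia).
    destruct (prime_divisors _ HP _ D) as [H|[H|[H|H]]]; lia.
  - apply (IH l ltac:(lia) ltac:(lia) (l + (a' * s + b' * t)) (s * b' - t * a')).
    apply Z.mul_reg_l with (k * k); [nia|].
    transitivity ((k * P) * (k * l)); [ring|]. rewrite E, El.
    transitivity ((k * l + k * (a' * s + b' * t)) * (k * l + k * (a' * s + b' * t)) + (k * (s * b' - t * a')) * (k * (s * b' - t * a'))); [|ring].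
    rewrite El, Ea, Eb. ring.
Qed.

(** Reducing modulo [P] starts the descent with a quotient smaller than [P]. *)
Lemma prime_sum_two_squares_of_dvd (P c d : Z) : prime P -> ~ (P | c) -> (P | c * c + d * d) ->
  exists a b, P = a * a + b * b.
Proof.
  intros HP Hc D. pose proof (prime_ge_2 _ HP).
  destruct (centered_residue c P ltac:(lia)) as [c' [s [Ec Bc]]].
  destruct (centered_residue d P ltac:(lia)) as [d' [t [Ed Bd]]].
  assert (D' : (P | c' * c' + d' * d')).
  { replace (c' * c' + d' * d') with (c * c + d * d - P * (s * (2 * c' + P * s) + t * (2 * d' + P * t)))
      by (rewrite Ec, Ed; ring).
    apply Z.divide_sub_r; [exact D|apply Z.divide_factor_l]. }
  destruct D' as [k Hk].
  assert (c' <> 0) by (intros ->; apply Hc; exists s; lia).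
  assert (0 < c' * c') by nia.
  apply (two_squares_descent P HP k) with c' d'; [|lia].
  assert (0 < k) by nia. assert (4 * (c' * c') <= P * P) by nia. assert (4 * (d' * d') <= P * P) by nia. nia.
Qed.

Lemma prime_1_mod_4 (p : nat) : prime (Z.of_nat p) -> (p mod 4 = 1)%nat ->
  exists a b, Z.of_nat p = a * a + b * b.
Proof.
  intros Hp H4. destruct (sqrt_minus_one p Hp H4) as [q Hq]. pose proof (prime_ge_2 _ Hp).
  apply (prime_sum_two_squares_of_dvd _ 1 q Hp).
  - intros D. apply Z.divide_1_r_nonneg in D; lia.
  - replace (1 * 1 + q * q) with (q * q + 1) by ring. exact Hq.
Qed.

(** Otherwise [p] would be a sum of two squares, which are [0] or [1] modulo 4. *)
Lemma prime_3_mod_4 (p : nat) (c d : Z) : prime (Z.of_nat p) -> (p mod 4 = 3)%nat ->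
  (Z.of_nat p | c * c + d * d) -> (Z.of_nat p | c).
Proof.
  intros Hp H4 D. destruct (Zdivide_dec (Z.of_nat p) c) as [H|H]; [exact H|exfalso].
  destruct (prime_sum_two_squares_of_dvd _ c d Hp H D) as [a [b E]].
  assert (H4' : Z.of_nat p mod 4 = 3) by (change 4 with (Z.of_nat 4); rewrite <- Nat2Z.inj_mod, H4; reflexivity).
  rewrite E in H4'.
  assert (Sq : forall z, z * z mod 4 = 0 \/ z * z mod 4 = 1).
  { intros z. rewrite Z.mul_mod by lia. assert (B := Z.mod_pos_bound z 4 ltac:(lia)).
    assert (z mod 4 = 0 \/ z mod 4 = 1 \/ z mod 4 = 2 \/ z mod 4 = 3) as [R|[R|[R|R]]] by lia; rewrite R; auto. }
  rewrite Z.add_mod in H4' by lia.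
  destruct (Sq a) as [A|A], (Sq b) as [B|B]; rewrite A, B in H4'; discriminate.
Qed.

Lemma dvd_of_dvd_sqr (P c : Z) : prime P -> (P | c * c) -> (P | c).
Proof. intros HP D. destruct (prime_mult P HP c c D); assumption. Qed.

Lemma same_length (A : Type) (l l' : list A) : NoDup l -> NoDup l' ->
  (forall x, In x l <-> In x l') -> length l = length l'.
Proof.
  intros N N' H. apply Nat.le_antisymm; apply NoDup_incl_length; try assumption; intros x; apply H.
Qed.

Lemma pair_Z_dec (x y : Z * Z) : {x = y} + {x <> y}.
Proof. decide equality; apply Z.eq_dec. Qed.

Lemma inclusion_exclusion (l1 l2 u i : list (Z * Z)) : NoDup l1 -> NoDup l2 -> NoDup u -> NoDup i ->
  (forall x, In x u <-> In x l1 \/ In x l2) -> (forall x, In x i <-> In x l1 /\ In x l2) ->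
  (length l1 + length l2 = length u + length i)%nat.
Proof.
  intros N1 N2 Nu Ni Hu Hi.
  set (f := fun x => if in_dec pair_Z_dec x l1 then true else false).
  assert (Hf : forall x, f x = true <-> In x l1) by (intros x; unfold f; destruct (in_dec pair_Z_dec x l1); split; congruence || tauto).
  assert (E1 : length u = (length l1 + length (filter (fun x => negb (f x)) l2))%nat).
  { rewrite <- length_app. apply same_length; [exact Nu| |].
    - apply NoDup_app; [exact N1|apply NoDup_filter, N2|].
      intros x Hx Hx'. apply filter_In in Hx' as [_ Hx']. apply Hf in Hx. rewrite Hx in Hx'. discriminate.
    - intros x. rewrite Hu, in_app_iff, filter_In. specialize (Hf x). destruct (f x); simpl; intuition congruence. }
  assert (E2 : length i = length (filter f l2)).
  { apply same_length; [exact Ni|apply NoDup_filter, N2|]. intros x. rewrite Hi, filter_In, Hf. tauto. }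
  assert (E3 := filter_length f l2). lia.
Qed.

Definition gmul (w z : Z * Z) : Z * Z :=
  (fst w * fst z - snd w * snd z, fst w * snd z + snd w * fst z).

(** Divisibility of [z = c + d i] by [a + b i] means that [p] divides [(a - b i) z]; when the norm of [z] is
    [p m], divisibility of the real part forces that of the imaginary part. *)
Lemma in_gmul_two_squares (p m : nat) (a b c d : Z) : prime (Z.of_nat p) -> Z.of_nat p = a * a + b * b ->
  In (c, d) (map (gmul (a, b)) (two_squares m)) <->
  c * c + d * d = Z.of_nat (p * m) /\ (Z.of_nat p | a * c + b * d).
Proof.
  intros Hp E. rewrite Nat2Z.inj_mul. set (P := Z.of_nat p) in *. pose proof (prime_ge_2 _ Hp).
  rewrite in_map_iff. split.
  - intros [[x y] [G H1]]. apply two_squares_spec in H1. unfold gmul in G; simpl in G.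
    injection G as Gc Gd. subst c d. rewrite <- H1, E. split; [ring|]. exists x. ring.
  - intros [N [x Hx]].
    assert (Hy : (P | a * d - b * c)).
    { apply (dvd_of_dvd_sqr P _ Hp).
      exists (P * Z.of_nat m - x * x * P).
      transitivity ((a * a + b * b) * (c * c + d * d) - (a * c + b * d) * (a * c + b * d)); [ring|].
      rewrite <- E, N, Hx. ring. }
    destruct Hy as [y Hy]. exists (x, y). split.
    + unfold gmul; simpl. f_equal; apply Z.mul_reg_l with P; try lia.
      * transitivity (a * (x * P) - b * (y * P)); [ring|]. rewrite <- Hx, <- Hy, E. ring.
      * transitivity (a * (y * P) + b * (x * P)); [ring|]. rewrite <- Hx, <- Hy, E. ring.
    + apply two_squares_spec. apply Z.mul_reg_l with (P * P); [nia|].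
      transitivity ((x * P) * (x * P) + (y * P) * (y * P)); [ring|]. rewrite <- Hx, <- Hy.
      transitivity ((a * a + b * b) * (c * c + d * d)); [ring|]. rewrite N, <- E. ring.
Qed.

Lemma NoDup_gmul (p m : nat) (a b : Z) : prime (Z.of_nat p) -> Z.of_nat p = a * a + b * b ->
  NoDup (map (gmul (a, b)) (two_squares m)).
Proof.
  intros Hp E. pose proof (prime_ge_2 _ Hp). apply Injective_map_NoDup; [|apply two_squares_NoDup].
  intros [x y] [x' y'] G. unfold gmul in G; simpl in G. injection G as G1 G2.
  f_equal; apply Z.mul_reg_l with (Z.of_nat p); try lia; rewrite E.
  - transitivity (a * (a * x - b * y) + b * (a * y + b * x)); [ring|]. rewrite G1, G2. ring.
  - transitivity (a * (a * y + b * x) - b * (a * x - b * y)); [ring|]. rewrite G1, G2. ring.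
Qed.

(** The representations of [p m] with both entries divisible by [p]. *)
Definition scaled_two_squares (p m : nat) : list (Z * Z) :=
  if (m mod p =? 0)%nat then map (fun z => (Z.of_nat p * fst z, Z.of_nat p * snd z)) (two_squares (m / p)) else nil.

Lemma in_scaled_two_squares (p m : nat) (c d : Z) : prime (Z.of_nat p) ->
  In (c, d) (scaled_two_squares p m) <->
  c * c + d * d = Z.of_nat (p * m) /\ (Z.of_nat p | c) /\ (Z.of_nat p | d).
Proof.
  intros Hp. pose proof (prime_ge_2 _ Hp). unfold scaled_two_squares.
  assert (Em := Nat.div_mod m p ltac:(lia)).
  destruct (m mod p =? 0)%nat eqn:Er.
  - apply Nat.eqb_eq in Er. set (m' := (m / p)%nat) in *. assert (Em' : (m = p * m')%nat) by lia. clearbody m'. subst m.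
    rewrite in_map_iff. split.
    + intros [[x y] [G H1]]. apply two_squares_spec in H1. simpl in G. injection G as <- <-.
      split; [|split; apply Z.divide_factor_l]. rewrite !Nat2Z.inj_mul, <- H1. ring.
    + intros [N [[x ->] [y ->]]]. exists (x, y). simpl. split; [f_equal; ring|].
      apply two_squares_spec. rewrite !Nat2Z.inj_mul in N.
      apply Z.mul_reg_l with (Z.of_nat p * Z.of_nat p); [nia|]. lia.
  - split; [intros []|]. intros [N [[x ->] [y ->]]]. exfalso. apply Nat.eqb_neq in Er. apply Er.
    rewrite Nat2Z.inj_mul in N.
    assert (Em2 : Z.of_nat m = Z.of_nat p * (x * x + y * y)).
    { apply Z.mul_reg_l with (Z.of_nat p); [lia|]. rewrite <- N. ring. }
    apply Nat.Lcm0.mod_divide. exists (Z.to_nat (x * x + y * y)). apply Nat2Z.inj.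
    rewrite Nat2Z.inj_mul, Z2Nat.id by nia. rewrite Em2. ring.
Qed.

Lemma NoDup_scaled (p m : nat) : prime (Z.of_nat p) -> NoDup (scaled_two_squares p m).
Proof.
  intros Hp. pose proof (prime_ge_2 _ Hp). unfold scaled_two_squares.
  destruct (m mod p =? 0)%nat; [|constructor].
  apply Injective_map_NoDup; [|apply two_squares_NoDup].
  intros [x y] [x' y'] G. simpl in G. injection G as G1 G2. f_equal; apply Z.mul_reg_l with (Z.of_nat p); lia.
Qed.

(** [r2 (m / p)], read as [0] when [p] does not divide [m]. *)
Definition r2_div (p m : nat) : nat := if (m mod p =? 0)%nat then r2 (m / p) else 0%nat.

Lemma length_scaled (p m : nat) : length (scaled_two_squares p m) = r2_div p m.
Proof. unfold scaled_two_squares, r2_div. destruct (m mod p =? 0)%nat; [apply length_map|reflexivity]. Qed.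

(** Multiplication by [1 + i]. *)
Lemma r2_mul_2 (m : nat) : r2 (2 * m) = r2 m.
Proof.
  assert (H2 : prime (Z.of_nat 2)) by apply prime_2.
  unfold r2. rewrite <- (length_map (gmul (1, 1)) (two_squares m)).
  apply same_length; [apply two_squares_NoDup|apply (NoDup_gmul 2); [exact H2|reflexivity]|].
  intros [c d]. rewrite (in_gmul_two_squares 2) by (exact H2 || reflexivity). rewrite two_squares_spec.
  split; [|tauto]. intros N. split; [exact N|]. apply (dvd_of_dvd_sqr _ _ H2).
  exists (Z.of_nat m + c * d). rewrite Nat2Z.inj_mul in N.
  transitivity ((c * c + d * d) + 2 * (c * d)); [ring|]. rewrite N. simpl (Z.of_nat 2). ring.
Qed.

Lemma r2_mul_3_mod_4 (p m : nat) : prime (Z.of_nat p) -> (p mod 4 = 3)%nat -> r2 (p * m) = r2_div p m.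
Proof.
  intros Hp H4. rewrite <- length_scaled. unfold r2.
  apply same_length; [apply two_squares_NoDup|apply NoDup_scaled, Hp|].
  intros [c d]. rewrite in_scaled_two_squares, two_squares_spec by exact Hp.
  split; [|tauto]. intros N. split; [exact N|].
  assert (D : (Z.of_nat p | c * c + d * d)) by (rewrite N, Nat2Z.inj_mul; apply Z.divide_factor_l).
  split; [exact (prime_3_mod_4 p c d Hp H4 D)|].
  rewrite Z.add_comm in D. exact (prime_3_mod_4 p d c Hp H4 D).
Qed.

(** With [p = pi * conj pi], a Gaussian integer of norm [p m] is a multiple of [pi] or of [conj pi], and of both
    exactly when it is a multiple of [p]. *)
Lemma r2_mul_1_mod_4 (p m : nat) : prime (Z.of_nat p) -> (p mod 4 = 1)%nat ->
  (r2 m + r2 m = r2 (p * m) + r2_div p m)%nat.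
Proof.
  intros Hp H4. destruct (prime_1_mod_4 p Hp H4) as [a [b E]]. set (P := Z.of_nat p) in *.
  assert (E' : Z.of_nat p = a * a + (- b) * (- b)) by (fold P; lia).
  pose proof (prime_ge_2 _ Hp) as HP2.
  assert (Ha : forall x y, P = x * x + y * y -> ~ (P | x)).
  { intros x y Exy [z ->].
    assert (D : (P | y)).
    { apply (dvd_of_dvd_sqr P _ Hp). exists (1 - z * z * P). lia. }
    destruct D as [t ->].
    assert (1 = P * (z * z + t * t)).
    { apply Z.mul_reg_l with P; [lia|]. transitivity P; [ring|]. transitivity (z * P * (z * P) + t * P * (t * P)); [exact Exy|ring]. }
    assert (D1 : (P | 1)) by (exists (z * z + t * t); lia).
    apply Z.divide_1_r_nonneg in D1; lia. }
  assert (P2 : P <> 2) by (intros Q; assert (Q2 : p = 2%nat) by (apply Nat2Z.inj; exact Q); rewrite Q2 in H4; discriminate H4).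
  rewrite <- length_scaled. unfold r2.
  rewrite <- (length_map (gmul (a, b)) (two_squares m)) at 1.
  rewrite <- (length_map (gmul (a, - b)) (two_squares m)).
  apply inclusion_exclusion.
  - apply (NoDup_gmul p); assumption.
  - apply (NoDup_gmul p); assumption.
  - apply two_squares_NoDup.
  - apply NoDup_scaled, Hp.
  - intros [c d]. rewrite !(in_gmul_two_squares p) by assumption. rewrite two_squares_spec.
    split; [|tauto]. intros N.
    assert (D : (P | (a * c + b * d) * (a * c + - b * d))).
    { replace (_ * _) with (a * a * (c * c + d * d) - d * d * (a * a + b * b)) by ring.
      rewrite N, <- E, Nat2Z.inj_mul. fold P. exists (a * a * Z.of_nat m - d * d). ring. }
    destruct (prime_mult P Hp _ _ D); [left|right]; split; assumption.
  - intros [c d]. rewrite !(in_gmul_two_squares p) by assumption. rewrite in_scaled_two_squares by exact Hp. fold P.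
    split.
    + intros [N [[x ->] [y ->]]]. split; (split; [exact N|]).
      * exists (a * x + b * y). ring.
      * exists (a * x + - b * y). ring.
    + intros [[N D1] [_ D2]]. split; [exact N|].
      assert (H2 : ~ (P | 2)) by (intros D; apply Z.divide_pos_le in D; lia).
      assert (Dc : (P | 2 * (a * c))).
      { replace (2 * (a * c)) with ((a * c + b * d) + (a * c + - b * d)) by ring. apply Z.divide_add_r; assumption. }
      assert (Dd : (P | 2 * (b * d))).
      { replace (2 * (b * d)) with ((a * c + b * d) - (a * c + - b * d)) by ring. apply Z.divide_sub_r; assumption. }
      destruct (prime_mult P Hp _ _ Dc) as [X|X]; [contradiction|].
      destruct (prime_mult P Hp _ _ Dd) as [Y|Y]; [contradiction|].
      destruct (prime_mult P Hp _ _ X) as [X'|X']; [exfalso; apply (Ha a b); [exact E|exact X']|].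
      destruct (prime_mult P Hp _ _ Y) as [Y'|Y']; [exfalso; apply (Ha b a); [lia|exact Y']|].
      split; assumption.
Qed.

Lemma exists_prime_factor (n : nat) : (2 <= n)%nat ->
  exists p m, prime (Z.of_nat p) /\ n = (p * m)%nat.
Proof.
  induction n as [n IH] using (well_founded_induction lt_wf). intros Hn.
  destruct (prime_dec (Z.of_nat n)) as [H|H]; [exists n, 1%nat; split; [exact H|lia]|].
  destruct (not_prime_divide (Z.of_nat n) ltac:(lia) H) as [d [Hd [k Hk]]].
  destruct (IH (Z.to_nat d) ltac:(lia) ltac:(lia)) as [p [m [Hp Hm]]].
  exists p, (m * Z.to_nat k)%nat. split; [exact Hp|].
  rewrite Nat.mul_assoc, <- Hm. apply Nat2Z.inj. rewrite Nat2Z.inj_mul, !Z2Nat.id by nia. lia.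
Qed.

Close Scope Z_scope.

Definition dvd_ind (d n : nat) : R := if (n mod d =? 0)%nat then 1 else 0.

Lemma dvd_ind_iff (d n d' n' : nat) : (Nat.divide d n <-> Nat.divide d' n') -> dvd_ind d n = dvd_ind d' n'.
Proof.
  intros H. unfold dvd_ind. rewrite <- !Nat.Lcm0.mod_divide in H.
  destruct (n mod d =? 0)%nat eqn:E, (n' mod d' =? 0)%nat eqn:E'; try reflexivity; exfalso.
  - apply Nat.eqb_eq in E. apply Nat.eqb_neq in E'. tauto.
  - apply Nat.eqb_neq in E. apply Nat.eqb_eq in E'. tauto.
Qed.

Lemma dvd_ind_true (d n : nat) : Nat.divide d n -> dvd_ind d n = 1.
Proof. intros H. unfold dvd_ind. apply Nat.Lcm0.mod_divide in H. rewrite H. reflexivity. Qed.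

Lemma dvd_ind_false (d n : nat) : ~ Nat.divide d n -> dvd_ind d n = 0.
Proof.
  intros H. unfold dvd_ind. rewrite <- Nat.Lcm0.mod_divide in H. apply Nat.eqb_neq in H. rewrite H. reflexivity.
Qed.

Lemma Rsum_multiples (g : nat -> R) (k A : nat) : (1 <= k)%nat ->
  Rsum (fun n => dvd_ind k (S n) * g (S n)) (A * k) = Rsum (fun i => g (S i * k)%nat) A.
Proof.
  intros Hk. induction A as [|A IH]; [reflexivity|].
  replace (S A * k)%nat with (A * k + S (k - 1))%nat by lia. rewrite Rsum_add, IH. cbn [Rsum]. f_equal.
  replace (Rsum _ (k - 1)) with 0.
  - rewrite dvd_ind_true by (exists (S A); lia).
    replace (S (A * k + (k - 1))) with (S A * k)%nat by lia. ring.
  - transitivity (Rsum (fun _ => 0) (k - 1)); [symmetry; apply Rsum_0|]. apply Rsum_ext; intros i Hi.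
    rewrite dvd_ind_false; [ring|]. intros [q Hq].
    assert (q <= A \/ A < q)%nat as [H|H] by lia; nia.
Qed.

(** Once [D >= n] this is the sum of [chi4 d] over all divisors [d] of [n]. *)
Definition chi4_divsum (D n : nat) : R := Rsum (fun d => chi4 (S d) * dvd_ind (S d) n) D.

Lemma chi4_divsum_stable (D n : nat) : (1 <= n <= D)%nat -> chi4_divsum D n = chi4_divsum n n.
Proof.
  intros H. unfold chi4_divsum. replace D with (n + (D - n))%nat by lia. rewrite Rsum_add.
  replace (Rsum _ (D - n)) with 0; [ring|].
  transitivity (Rsum (fun _ => 0) (D - n)); [symmetry; apply Rsum_0|]. apply Rsum_ext; intros i Hi.
  rewrite dvd_ind_false; [ring|]. intros Hd. apply Nat.divide_pos_le in Hd; lia.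
Qed.

Lemma chi4_mul (a b : nat) : chi4 (a * b) = chi4 a * chi4 b.
Proof.
  unfold chi4. rewrite Nat.Div0.mul_mod.
  assert (Ha := Nat.mod_upper_bound a 4 ltac:(lia)). assert (Hb := Nat.mod_upper_bound b 4 ltac:(lia)).
  destruct (a mod 4)%nat as [|[|[|[|?]]]]; try lia; destruct (b mod 4)%nat as [|[|[|[|?]]]]; try lia; simpl; ring.
Qed.

Lemma dvd_prime_mul (p m d : nat) : prime (Z.of_nat p) -> ~ Nat.divide p d ->
  Nat.divide d (p * m) -> Nat.divide d m.
Proof.
  intros Hp Hd [q Hq].
  assert (G : (Z.of_nat d | Z.of_nat m)%Z).
  { apply Gauss with (Z.of_nat p).
    - exists (Z.of_nat q). rewrite <- !Nat2Z.inj_mul. f_equal. exact Hq.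
    - apply rel_prime_sym, prime_rel_prime; [exact Hp|]. intros [z Hz]. apply Hd.
      pose proof (prime_ge_2 _ Hp). exists (Z.to_nat z). apply Nat2Z.inj. rewrite Nat2Z.inj_mul, Z2Nat.id by nia. exact Hz. }
  destruct G as [z Hz]. destruct d as [|d].
  - exists O. lia.
  - exists (Z.to_nat z). apply Nat2Z.inj. rewrite Nat2Z.inj_mul, Z2Nat.id by nia. exact Hz.
Qed.

(** The divisors of [p m] are those of [m] and [p] times those of [m]; the two families share [p] times the
    divisors of [m / p]. *)
Lemma chi4_divsum_prime_mul (p m : nat) : prime (Z.of_nat p) -> (1 <= m)%nat ->
  chi4_divsum (p * m) (p * m) = (1 + chi4 p) * chi4_divsum m m
    - chi4 p * (if (m mod p =? 0)%nat then chi4_divsum (m / p) (m / p) else 0).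
Proof.
  intros Hp Hm. pose proof (prime_ge_2 _ Hp) as HP2.
  set (g := fun k => chi4 k * (dvd_ind (k / p) m - dvd_ind k m)).
  assert (E1 : chi4_divsum (p * m) (p * m) = chi4_divsum (p * m) m + Rsum (fun n => dvd_ind p (S n) * g (S n)) (m * p)).
  { rewrite (Nat.mul_comm m p). unfold chi4_divsum at 1 2. rewrite <- Rsum_plus. apply Rsum_ext; intros d _.
    unfold g. set (k := S d). destruct (Nat.eq_dec (k mod p) 0) as [H|H].
    - apply Nat.Lcm0.mod_divide in H. rewrite (dvd_ind_true p k H). destruct H as [q Hq].
      replace (k / p)%nat with q by (rewrite Hq, Nat.div_mul; lia).
      rewrite (dvd_ind_iff k (p * m) q m); [ring|]. rewrite Hq, (Nat.mul_comm p m).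
      apply Nat.mul_divide_cancel_r. lia.
    - rewrite Nat.Lcm0.mod_divide in H. rewrite (dvd_ind_false p k H).
      rewrite (dvd_ind_iff k (p * m) k m); [ring|]. split.
      + apply dvd_prime_mul; assumption.
      + intros D. apply Nat.divide_mul_r, D. }
  rewrite E1, (chi4_divsum_stable (p * m) m) by nia. rewrite Rsum_multiples by lia.
  assert (E2 : Rsum (fun i => g (S i * p)%nat) m = chi4 p * (chi4_divsum m m - Rsum (fun e => chi4 (S e) * dvd_ind (S e * p) m) m)).
  { unfold chi4_divsum. rewrite <- Rsum_minus, <- Rsum_scal. apply Rsum_ext; intros e _.
    unfold g. rewrite chi4_mul, Nat.div_mul by lia. ring. }
  rewrite E2.
  replace (Rsum (fun e => chi4 (S e) * dvd_ind (S e * p) m) m) with (if (m mod p =? 0)%nat then chi4_divsum (m / p) (m / p) else 0); [ring|].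
  destruct (m mod p =? 0)%nat eqn:Er.
  - apply Nat.eqb_eq in Er. assert (Em := Nat.div_mod m p ltac:(lia)). set (m' := (m / p)%nat) in *.
    assert (Em' : (m = m' * p)%nat) by lia.
    assert (H1 : (1 <= m' <= m)%nat) by nia.
    rewrite <- (chi4_divsum_stable m m' H1). apply Rsum_ext; intros e _. f_equal.
    apply dvd_ind_iff. rewrite Em' at 1. symmetry. apply Nat.mul_divide_cancel_r. lia.
  - apply Nat.eqb_neq in Er. rewrite Nat.Lcm0.mod_divide in Er.
    transitivity (Rsum (fun _ => 0) m); [symmetry; apply Rsum_0|]. apply Rsum_ext; intros e _.
    rewrite dvd_ind_false; [ring|]. intros [q Hq]. apply Er. exists (q * S e)%nat. lia.
Qed.

(** Both sides satisfy [F (p m) = (1 + chi4 p) F m - chi4 p * F (m / p)] for every prime [p]; for [r2] this is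
    the arithmetic of Gaussian primes over [p]. *)
Lemma jacobi_two_squares (n : nat) : (1 <= n)%nat -> INR (r2 n) = 4 * chi4_divsum n n.
Proof.
  induction n as [n IH] using (well_founded_induction lt_wf). intros Hn.
  destruct (Nat.eq_dec n 1) as [->|H1].
  { replace (r2 1) with 4%nat by (vm_compute; reflexivity). unfold chi4_divsum, chi4, dvd_ind. simpl. ring. }
  destruct (exists_prime_factor n ltac:(lia)) as [p [m [Hp Em]]]. pose proof (prime_ge_2 _ Hp) as HP2.
  assert (Hm : (1 <= m < n)%nat) by nia. subst n.
  assert (IHm := IH m ltac:(lia) ltac:(lia)).
  assert (IHd : INR (r2_div p m) = 4 * (if (m mod p =? 0)%nat then chi4_divsum (m / p) (m / p) else 0)).
  { unfold r2_div. destruct (m mod p =? 0)%nat eqn:Er; [|simpl; ring].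
    apply Nat.eqb_eq in Er. assert (Ed := Nat.div_mod m p ltac:(lia)). apply IH; nia. }
  rewrite chi4_divsum_prime_mul by (exact Hp || lia).
  set (e := if (m mod p =? 0)%nat then _ else _) in *.
  assert (H4 := Nat.mod_upper_bound p 4 ltac:(lia)).
  unfold chi4. destruct (p mod 4)%nat as [|[|[|[|?]]]] eqn:E4; [| | | |lia].
  - exfalso. assert (D : Nat.divide 4 p) by (apply Nat.Lcm0.mod_divide, E4). destruct D as [q Hq].
    assert (D : (2 | Z.of_nat p)%Z) by (exists (Z.of_nat (2 * q)); lia).
    destruct (prime_divisors _ Hp _ D) as [H|[H|[H|H]]]; lia.
  - assert (R := r2_mul_1_mod_4 p m Hp E4). apply (f_equal INR) in R. rewrite !plus_INR in R. lra.
  - assert (p = 2)%nat.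
    { assert (Ep := Nat.div_mod p 4 ltac:(lia)).
      assert (D : (2 | Z.of_nat p)%Z) by (exists (Z.of_nat (2 * (p / 4) + 1)); lia).
      destruct (prime_divisors _ Hp _ D) as [H|[H|[H|H]]]; lia. }
    subst p. rewrite r2_mul_2. lra.
  - rewrite (r2_mul_3_mod_4 p m Hp E4). lra.
Qed.

Lemma hyperbola (w : nat -> R) (X A D : nat) : (forall n, (X < n)%nat -> w n = 0) -> (X <= A)%nat -> (X <= D)%nat ->
  Rsum (fun i => Rsum (fun d => chi4 (S d) * w (S i * S d)%nat) D) A = Rsum (fun n => w (S n) * chi4_divsum (S n) (S n)) X.
Proof.
  intros Hw HA HD. rewrite Rsum_swap.
  transitivity (Rsum (fun d => Rsum (fun n => chi4 (S d) * (dvd_ind (S d) (S n) * w (S n))) X) D).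
  - apply Rsum_ext; intros d _. rewrite !Rsum_scal. f_equal. rewrite <- (Rsum_multiples w (S d) A) by lia.
    replace (A * S d)%nat with (X + (A * S d - X))%nat by nia. rewrite Rsum_add.
    replace (Rsum _ (A * S d - X)) with 0; [ring|].
    transitivity (Rsum (fun _ => 0) (A * S d - X)); [symmetry; apply Rsum_0|]. apply Rsum_ext; intros i _.
    rewrite Hw by lia. ring.
  - rewrite Rsum_swap. apply Rsum_ext; intros n Hn.
    rewrite <- (chi4_divsum_stable D (S n)) by lia. unfold chi4_divsum. rewrite <- Rsum_scal.
    apply Rsum_ext; intros d _. ring.
Qed.

(** * The circle problem *)

Lemma starred_sum_r2 (x : R) (X : nat) : 0 < x -> INR X <= x < INR X + 1 ->
  starred_sum (fun n => INR (r2 n)) x = 1 + 4 * Rsum (fun n => half_weight (INR (S n)) x * chi4_divsum (S n) (S n)) X.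
Proof.
  intros Hx HX. unfold starred_sum.
  replace (Z.to_nat (Int_part x)) with X.
  2:{ destruct (base_Int_part x) as [B1 B2].
      assert (E : (Int_part x = Z.of_nat X)%Z).
      { rewrite INR_IZR_INZ in HX.
        assert (H1 : (Int_part x < Z.of_nat X + 1)%Z) by (apply lt_IZR; rewrite plus_IZR; lra).
        assert (H2 : (Z.of_nat X < Int_part x + 1)%Z) by (apply lt_IZR; rewrite plus_IZR; lra). lia. }
      rewrite E, Nat2Z.id. reflexivity. }
  rewrite Rsum_sum_f_R0, Rsum_shift. f_equal.
  - destruct (Req_EM_T (INR 0) x) as [E|_]; [simpl in E; lra|].
    replace (r2 0) with 1%nat by (vm_compute; reflexivity). simpl. ring.
  - rewrite <- Rsum_scal. apply Rsum_ext; intros n Hn. rewrite jacobi_two_squares by lia.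
    assert (Hle : INR (S n) <= x) by (apply Rle_trans with (INR X); [apply le_INR; lia|lra]).
    destruct (Req_EM_T (INR (S n)) x) as [E|E].
    + rewrite half_weight_eq by exact E. ring.
    + rewrite half_weight_lt by lra. ring.
Qed.

Lemma is_series_square_wave_term (k : nat) (x : R) : (1 <= k)%nat -> 0 < x ->
  is_series (fun i => (1 - cos (INR k * (PI * (x / INR (S i)) / 2))) / INR k)
    (PI * x / 2 * (f_sum (PI * INR k * x / 4) / (PI * INR k * x / 4))).
Proof.
  intros Hk Hx. pose proof PI_RGT_0 as HPI. assert (Hk' : 0 < INR k) by (apply lt_0_INR; lia).
  destruct (f_term_sum (PI * INR k * x / 4)) as [_ H].
  apply (is_series_Rmult (2 / INR k)) in H.
  replace (PI * x / 2 * (f_sum (PI * INR k * x / 4) / (PI * INR k * x / 4))) with (2 / INR k * f_sum (PI * INR k * x / 4))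
    by (field; lra).
  eapply is_series_Rext; [|exact H]. intros i. cbv beta. pose proof (INR_S_pos i).
  replace (INR k * (PI * (x / INR (S i)) / 2)) with (2 * (PI * INR k * x / 4 / INR (S i))) by (field; lra).
  rewrite cos_2a_sin. field. lra.
Qed.

Definition f_pair (x : R) (n : nat) : R :=
  f_sum (Y_arg (1 / 4) x n) / Y_arg (1 / 4) x n - f_sum (Y_arg (3 / 4) x n) / Y_arg (3 / 4) x n.

Lemma is_series_wave (x : R) (N : nat) : 0 < x ->
  is_series (fun i => wave N (x / INR (S i))) (PI * x / 2 * Rsum (f_pair x) N).
Proof.
  intros Hx. rewrite <- Rsum_scal.
  apply is_series_Rext with (fun i => Rsum (fun n =>
     (1 - cos (INR (4 * n + 1) * (PI * (x / INR (S i)) / 2))) / INR (4 * n + 1)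
     - (1 - cos (INR (4 * n + 3) * (PI * (x / INR (S i)) / 2))) / INR (4 * n + 3)) N).
  { intros i. unfold wave. symmetry.
    apply (Rsum_chi4 (fun k => (1 - cos (INR k * (PI * (x / INR (S i)) / 2))) / INR k)). }
  apply (is_series_Rsum_family (fun n i =>
     (1 - cos (INR (4 * n + 1) * (PI * (x / INR (S i)) / 2))) / INR (4 * n + 1)
     - (1 - cos (INR (4 * n + 3) * (PI * (x / INR (S i)) / 2))) / INR (4 * n + 3))).
  intros n. unfold f_pair.
  replace (Y_arg (1 / 4) x n) with (PI * INR (4 * n + 1) * x / 4) by (rewrite INR_4, INR_1; unfold Y_arg; field).
  replace (Y_arg (3 / 4) x n) with (PI * INR (4 * n + 3) * x / 4) by (rewrite INR_4; simpl (INR 3); unfold Y_arg; field).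
  rewrite Rmult_minus_distr_l.
  apply @is_series_minus; apply is_series_square_wave_term; (lia || exact Hx).
Qed.

Lemma is_series_tail_bound (a b : nat -> R) (l B : R) (A : nat) :
  is_series a l -> is_series b B -> (forall i, 0 <= b i) ->
  (forall i, (A <= i)%nat -> Rabs (a i) <= b i) -> Rabs (l - Rsum a A) <= B.
Proof.
  intros Ha Hb Pb Hab. apply is_series_Rsum in Ha.
  apply (is_lim_seq_Rabs_le (fun M => Rsum a (M + A) - Rsum a A)).
  - apply is_lim_seq_minus'; [|apply is_lim_seq_const]. apply is_lim_seq_incr_n, Ha.
  - intros M. rewrite Nat.add_comm, Rsum_add. set (s := Rsum (fun i => a (A + i)%nat) M).
    replace (Rsum a A + s - Rsum a A) with s by ring. unfold s.
    apply Rle_trans with (1 := Rsum_Rabs _ M).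
    apply Rle_trans with (Rsum (fun i => b (A + i)%nat) M); [apply Rsum_le; intros; apply Hab; lia|].
    assert (H := is_series_Rsum_le b B (A + M) Pb Hb). rewrite Rsum_add in H.
    assert (0 <= Rsum b A) by (apply Rsum_pos; auto). lra.
Qed.

(** For [a <= A] the limit is taken termwise.  Beyond [A], [wave_near_0] replaces the terms by
    [- sin^2 (pi N x / a) / (4 N)] up to a summable error of size [1 / N]; extended to all [a], those add up to
    [- f (pi N x) / (4 N)]. *)
Lemma is_lim_f_pair (x : R) (A L : nat) : 0 < x -> 2 * x <= INR A -> x + 3 <= 4 * INR L ->
  is_lim_seq (fun N => PI * x / 2 * Rsum (f_pair x) (S N))
    (Rsum (fun i => PI / 2 * Rsum (fun k => chi4 (S k) * half_weight (INR (S k)) (x / INR (S i))) (4 * L)) A - PI ^ 2 * x / 8).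
Proof.
  intros Hx HA HL. pose proof PI_RGT_0 as HPI.
  assert (HW := is_series_zeta 1 (le_n 1)). set (W := _ * _) in HW. clearbody W.
  set (y := fun N => PI * INR (S N) * x).
  set (U := fun N => Rsum (fun i => wave (S N) (x / INR (S i)) + sin (y N / INR (S i)) ^ 2 / (4 * INR (S N))) A
      - f_sum (y N) / y N * (PI * x / 4)).
  assert (HU : forall N, Rabs (PI * x / 2 * Rsum (f_pair x) (S N) - U N) <= x ^ 2 * W / (INR N + 1)).
  { intros N. pose proof (INR_S_pos N) as HN.
    assert (Hy : 0 < y N) by (unfold y; apply Rmult_lt_0_compat; [apply Rmult_lt_0_compat|]; lra).
    unfold U. replace (f_sum (y N) / y N * (PI * x / 4)) with (/ (4 * INR (S N)) * f_sum (y N))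
      by (unfold y; field; lra).
    match goal with |- Rabs (?a - (?b - ?c)) <= _ => replace (a - (b - c)) with (a + c - b) by ring end.
    apply (is_series_tail_bound _ (fun i => x ^ 2 / INR (S N) * / INR (S i) ^ (2 * 1))).
    - apply @is_series_plus; [apply is_series_wave, Hx|].
      apply is_series_Rext with (fun i => / (4 * INR (S N)) * sin (y N / INR (S i)) ^ 2).
      { intros i. unfold Rdiv. ring. }
      apply is_series_Rmult, f_term_sum.
    - rewrite <- S_INR. replace (x ^ 2 * W / INR (S N)) with (x ^ 2 / INR (S N) * W) by (field; lra).
      apply is_series_Rmult, HW.
    - intros i. apply Rmult_le_pos.
      + apply Rdiv_le_0_compat; [apply pow2_ge_0|lra].
      + left; apply Rinv_0_lt_compat, pow_lt, INR_S_pos.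
    - intros i Hi. pose proof (INR_S_pos i) as Hi'.
      assert (HAi : INR A <= INR (S i)) by (apply le_INR; lia).
      assert (Hv : 0 <= x / INR (S i) <= 1 / 2).
      { split; [apply Rdiv_le_0_compat; lra|]. apply Rmult_le_reg_r with (INR (S i)); [lra|].
        unfold Rdiv at 1. rewrite Rmult_assoc, Rinv_l by lra. lra. }
      assert (B := wave_near_0 N (x / INR (S i)) Hv).
      replace (PI * INR (S N) * (x / INR (S i))) with (y N / INR (S i)) in B by (unfold y; field; lra).
      apply Rle_trans with (1 := B). right. simpl (2 * 1)%nat. field. lra. }
  apply is_lim_seq_ext with (fun N => U N + (PI * x / 2 * Rsum (f_pair x) (S N) - U N)); [intros; ring|].
  match goal with |- is_lim_seq _ (Finite ?l) => replace l with (l + 0) by ring end.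
  apply is_lim_seq_plus'.
  2:{ apply is_lim_seq_bound_inv with (x ^ 2 * W). intros N. rewrite Rminus_0_r. apply HU. }
  apply is_lim_seq_minus'.
  - apply (is_lim_seq_Rsum (fun N i => wave (S N) (x / INR (S i)) + sin (y N / INR (S i)) ^ 2 / (4 * INR (S N)))).
    intros i _. pose proof (INR_S_pos i).
    match goal with |- is_lim_seq _ (Finite ?l) => replace l with (l + 0) by ring end.
    apply is_lim_seq_plus'.
    + apply (is_lim_seq_incr_1 (fun N => wave N (x / INR (S i)))).
      apply is_lim_wave; [apply Rdiv_lt_0_compat; lra|].
      apply Rle_trans with (2 := HL). apply Rplus_le_compat_r. apply Rmult_le_reg_r with (INR (S i)); [lra|].
      unfold Rdiv; rewrite Rmult_assoc, Rinv_l, Rmult_1_r by lra.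
      rewrite S_INR. pose proof (pos_INR i). nra.
    + apply is_lim_seq_bound_inv with 1. intros N. rewrite Rminus_0_r, <- S_INR. pose proof (INR_S_pos N).
      assert (B := SIN_bound (y N / INR (S i))). set (s := sin _) in *.
      rewrite Rabs_pos_eq by (apply Rdiv_le_0_compat; [apply pow2_ge_0|lra]).
      apply Rmult_le_reg_r with (4 * INR (S N)); [lra|].
      replace (s ^ 2 / (4 * INR (S N)) * (4 * INR (S N))) with (s ^ 2) by (field; lra).
      replace (1 / INR (S N) * (4 * INR (S N))) with 4 by (field; lra). nra.
  - replace (PI ^ 2 * x / 8) with (PI / 2 * (PI * x / 4)) by field.
    apply is_lim_seq_mult'; [|apply is_lim_seq_const].
    apply is_lim_seq_ext with (fun N => (fun M => f_sum (PI * x * INR M) / (PI * x * INR M)) (S N)).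
    { intros N. unfold y. replace (PI * x * INR (S N)) with (PI * INR (S N) * x) by ring. reflexivity. }
    apply (is_lim_seq_incr_1 (fun M => f_sum (PI * x * INR M) / (PI * x * INR M))).
    apply (is_lim_seq_scal_INR (fun y => f_sum y / y)); [nra|apply is_lim_f_sum].
Qed.

Lemma circle_error_series (x : R) : 0 < x ->
  is_series (f_pair x) ((circle_error x - 1) / (4 * x)).
Proof.
  intros Hx. pose proof PI_RGT_0 as HPI.
  (* [A] separates the two regimes of [is_lim_f_pair]; both [A] and [4 L] exceed all relevant divisors *)
  destruct (nfloor_ex x ltac:(lra)) as [X HX].
  destruct (INR_unbounded (2 * x + INR X)) as [A HA]. destruct (INR_unbounded (x + 3 + INR X)) as [L HL].
  assert (HXA : (X <= A)%nat) by (apply INR_le; lra).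
  assert (HXL : (X <= 4 * L)%nat) by (assert (X <= L)%nat by (apply INR_le; lra); lia).
  pose proof (pos_INR X) as HX0. pose proof (pos_INR L) as HL0.
  assert (H := is_lim_f_pair x A L Hx ltac:(lra) ltac:(lra)).
  rewrite Rsum_scal in H.
  rewrite (Rsum_ext _ (fun i => Rsum (fun k => chi4 (S k) * half_weight (INR (S i * S k)) x) (4 * L))) in H.
  2:{ intros i _. apply Rsum_ext; intros k _. f_equal. pose proof (INR_S_pos i).
      rewrite (half_weight_scal (INR (S i)) _ 0 (x / INR (S i))) by assumption.
      rewrite mult_INR. f_equal; field; lra. }
  rewrite (hyperbola (fun n => half_weight (INR n) x) X A (4 * L)) in H; [|  |exact HXA|exact HXL].
  2:{ intros n Hn. apply half_weight_gt. assert (INR (S X) <= INR n) by (apply le_INR; lia).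
      rewrite S_INR in *. lra. }
  apply is_series_Rsum, is_lim_seq_incr_1.
  unfold circle_error. rewrite (starred_sum_r2 x X Hx HX).
  set (E := Rsum (fun n => _ * chi4_divsum _ _) X) in *.
  apply is_lim_seq_ext with (fun N => 2 / (PI * x) * (PI * x / 2 * Rsum (f_pair x) (S N))).
  { intros N. field. lra. }
  replace ((1 + 4 * E - PI * x - 1) / (4 * x)) with (2 / (PI * x) * (PI / 2 * E - PI ^ 2 * x / 8)) by (field; lra).
  apply (is_lim_seq_scal_l _ (2 / (PI * x)) (Finite _)), H.
Qed.

Theorem theorem3 :
  (forall y : R,
     ex_series (f_term y) /\
     is_series (fun i : nat => (sin (y / INR (S i))) ^ 2) (f_sum y)) /\
  (forall (theta x : R) (n : nat), 0 < theta < 1 -> 0 < x ->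
     is_series
       (fun i : nat =>
          BesselJ1 (4 * PI * sqrt (INR (S i) * (INR n + theta) * x))
          / sqrt (INR (S i) * (INR n + theta)))
       (sqrt x *
          (- PI + 1 / (2 * Y_arg theta x n) + 2 * (f_sum (Y_arg theta x n) / Y_arg theta x n)))) /\
  (forall x : R, 0 < x ->
     ex_series (fun n : nat =>
       f_sum (Y_arg (1 / 4) x n) / Y_arg (1 / 4) x n - f_sum (Y_arg (3 / 4) x n) / Y_arg (3 / 4) x n) /\
     circle_error x = 1 + 4 * x *
       Series (fun n : nat =>
         f_sum (Y_arg (1 / 4) x n) / Y_arg (1 / 4) x n - f_sum (Y_arg (3 / 4) x n) / Y_arg (3 / 4) x n)).
Proof.
  split; [exact f_term_sum|split; [exact is_series_BesselJ1|]].
  intros x Hx. assert (H := circle_error_series x Hx).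
  split; [eexists; exact H|].
  change (circle_error x = 1 + 4 * x * Series (f_pair x)).
  rewrite (is_series_unique _ _ H). field. lra.
Qed.
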